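(* Let $n\geq 2$, let $x_1,\ldots,x_n$ be $n$ distinct points of $\mathbb{S}^2$, and write $B_{m,n}=B_m(\mathbb{S}^2\setminus\{x_1,\ldots,x_n\})$. Then: (a) If $m\geq 3$ then $\Gamma_3(B_{m,n})=\Gamma_2(B_{m,n})$. (b) If $m\geq 5$ then $(B_{m,n})^{(2)}=(B_{m,n})^{(1)}$. (c) If $m=4$ then $$B_{4,n}/(B_{4,n})^{(2)}\cong(\mathbb{Z}^2\rtimes\mathbb{Z})\times\mathbb{Z}^{n-1},$$ where, in the semi-direct product, $\mathbb{Z}^2$ is free Abelian with basis $\{\overline{u},\overline{v}\}$ and a generator $\sigma$ of $\mathbb{Z}$ acts by $\sigma\cdot\overline{u}=\overline{v}$, $\sigma\cdot\overline{v}=-\overline{u}+\overline{v}$; and $$(B_{4,n})^{(1)}/(B_{4,n})^{(2)}\cong\mathbb{Z}^2.$$ Alternatively, $$B_{4,n}/(B_{4,n})^{(2)}\cong\mathbb{Z}^2\rtimes\mathbb{Z}^n,$$ where $\mathbb{Z}^2\cong(B_{4,n})^{(1)}/(B_{4,n})^{(2)}$ is the free Abelian group with basis $\{\overline{u},\overline{v}\}$, $\mathbb{Z}^n\cong(B_{4,n})^{\mathrm{Ab}}$ has basis $\{\sigma,\rho_1,\ldots,\rho_{n-1}\}$, and the action is given by $$\sigma\cdot\overline{u}=\overline{v},\quad\sigma\cdot\overline{v}=-\overline{u}+\overline{v},\quad\rho_i\cdot\overline{u}=\overline{u},\quad\rho_i\cdot\overline{v}=\overline{v}$$ for all $1\leq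 i\leq n-1$.
   Context: For a surface $M$, $F_m(M)=\{(y_1,\ldots,y_m)\in M^m: y_i\neq y_j\text{ if }i\neq j\}$, and $B_m(M)=\pi_1(F_m(M)/S_m)$ is the $m$-string braid group of $M$. Lower central series: $\Gamma_1(G)=G$, $\Gamma_{i+1}(G)=[G,\Gamma_i(G)]$; derived series: $G^{(0)}=G$, $G^{(i)}=[G^{(i-1)},G^{(i-1)}]$; $G^{\mathrm{Ab}}=G/\Gamma_2(G)$. In $N\rtimes Q$ the normal subgroup is $N$. *)

(* Defs.v *)
From HB Require Import structures.
From mathcomp Require Import all_boot all_order all_algebra generic_quotient perm.
From mathcomp Require Import all_classical all_reals all_analysis.
From mathcomp Require Import ring lra.

Set Implicit Arguments.
Unset Strict Implicit.
Unset Printing Implicit Defensive.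

Import Order.TTheory GRing.Theory Num.Theory.
Import numFieldNormedType.Exports.

Local Open Scope classical_set_scope.
Local Open Scope group_scope.

HB.mixin Record isSubgroup (G : groupType) (A : set G) := {
  sgrp1 : A 1;
  sgrpM : forall x y, A x -> A y -> A (x * y);
  sgrpV : forall x, A x -> A x^-1
}.

#[short(type="subgroup")]
HB.structure Definition Subgroup (G : groupType) := {A of isSubgroup G A}.

HB.mixin Record isNormal (G : groupType) (A : set G) of isSubgroup G A := {
  sgrpJ : forall x y, A x -> A (x ^ y)
}.

#[short(type="normalSubgroup")]
HB.structure Definition NormalSubgroup (G : groupType) :=
  {A of isNormal G A & isSubgroup G A}.

Section Subgroups.
Variable G : groupType.
Implicit Types A B S : set G.

Definition generated S : set G :=
  \bigcap_(A in [set A | [/\ A 1, forall x y, A x -> A y -> A (x * y),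
                            forall x, A x -> A x^-1 & S `<=` A]]) A.

Fact gen1 S : generated S 1. Proof. by move=> A []. Qed.

Fact genM S x y : generated S x -> generated S y -> generated S (x * y).
Proof. by move=> Sx Sy A hA; have [_ AM _ _] := hA; apply: AM; [exact: Sx | exact: Sy]. Qed.

Fact genV S x : generated S x -> generated S x^-1.
Proof. by move=> Sx A hA; have [_ _ AV _] := hA; apply: AV; exact: Sx. Qed.

Fact genJ S : (forall x y, S x -> S (x ^ y)) ->
  forall x y, generated S x -> generated S (x ^ y).
Proof.
move=> SJ x y Sx A [A1 AM AV SA].
apply: (Sx [set z | A (z ^ y)]); split => /=.
- by rewrite conj1g.
- by move=> u v; rewrite conjMg; apply: AM.
- by move=> u; rewrite conjVg; apply: AV.
- by move=> u Su; apply/SA/SJ.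
Qed.

Definition commutator_subgroup A B : set G :=
  generated [set z | exists x y, [/\ A x, B y & z = [~ x, y]]].

Fact commJ A B : (forall x y, A x -> A (x ^ y)) ->
  (forall x y, B x -> B (x ^ y)) -> forall x y, commutator_subgroup A B x -> commutator_subgroup A B (x ^ y).
Proof.
move=> AJ BJ; apply: genJ => _ z [x [y [Ax By ->]]].
by exists (x ^ z), (y ^ z); split; [apply: AJ | apply: BJ | rewrite conjRg].
Qed.

(* Indexed from 1, as Gamma_1(G) = G; the value at 0 is a junk value. *)
Definition lower_central (i : nat) : set G :=
  iter i.-1 (commutator_subgroup setT) setT.

Definition derived (i : nat) : set G :=
  iter i (fun A => commutator_subgroup A A) setT.

Fact lower_central_subgroup i :
  [/\ lower_central i 1,
      forall x y, lower_central i x -> lower_central i y ->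
        lower_central i (x * y) &
      forall x, lower_central i x -> lower_central i x^-1].
Proof.
rewrite /lower_central; case: i.-1 => [|j] //=.
by split; [apply: gen1 | move=> x y; apply: genM | move=> x; apply: genV].
Qed.

Fact lower_centralJ i x y : lower_central i x -> lower_central i (x ^ y).
Proof.
by rewrite /lower_central; elim: i.-1 x y => [//|j IH] x y /=; apply: commJ.
Qed.

Fact derived_subgroup i :
  [/\ derived i 1,
      forall x y, derived i x -> derived i y -> derived i (x * y) &
      forall x, derived i x -> derived i x^-1].
Proof.
rewrite /derived; case: i => [|j] //=.
by split; [apply: gen1 | move=> x y; apply: genM | move=> x; apply: genV].
Qed.

Fact derivedJ i x y : derived i x -> derived i (x ^ y).
Proof. by rewrite /derived; elim: i x y => [//|j IH] x y /=; apply: commJ. Qed.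

HB.instance Definition _ i :=
  let: And3 h1 hM hV := lower_central_subgroup i in
  isSubgroup.Build G (lower_central i) h1 hM hV.
HB.instance Definition _ i :=
  isNormal.Build G (lower_central i) (@lower_centralJ i).
HB.instance Definition _ i :=
  let: And3 h1 hM hV := derived_subgroup i in
  isSubgroup.Build G (derived i) h1 hM hV.
HB.instance Definition _ i := isNormal.Build G (derived i) (@derivedJ i).

End Subgroups.

Arguments lower_central : clear implicits.
Arguments derived : clear implicits.

Section SubgroupType.
Variables (G : groupType) (A : subgroup G).

Definition subgroup_group : Type := set_type A.
HB.instance Definition _ := Choice.on subgroup_group.

Let inA (x : subgroup_group) : (A : set G) (\val x). Proof. exact: set_mem (valP x). Qed.
Let mkA x (Ax : (A : set G) x) : subgroup_group := exist _ x (mem_set Ax).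
Let one := mkA (sgrp1 (s := A)).
Let mul x y := mkA (sgrpM _ _ (inA x) (inA y)).
Let inv x := mkA (sgrpV _ (inA x)).

Fact subgroup_mulA : associative mul.
Proof. by move=> x y z; apply/val_inj; rewrite /= mulgA. Qed.
Fact subgroup_mul1 : left_id one mul.
Proof. by move=> x; apply/val_inj; rewrite /= mul1g. Qed.
Fact subgroup_mulg1 : right_id one mul.
Proof. by move=> x; apply/val_inj; rewrite /= mulg1. Qed.
Fact subgroup_mulV : left_inverse one inv mul.
Proof. by move=> x; apply/val_inj; rewrite /= mulVg. Qed.
Fact subgroup_mulgV : right_inverse one inv mul.
Proof. by move=> x; apply/val_inj; rewrite /= mulgV. Qed.

HB.instance Definition _ := isGroup.Build subgroup_group
  subgroup_mulA subgroup_mul1 subgroup_mulg1 subgroup_mulV subgroup_mulgV.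

Definition subgroup_val (x : subgroup_group) : G := \val x.

End SubgroupType.

Section Restriction.
Variables (G : groupType) (A : subgroup G) (N : normalSubgroup G).

(* N /\ A, seen inside the group A: A / N is [quotient_group (restr A N)]. *)
Definition restr : set (subgroup_group A) :=
  [set x | (N : set G) (subgroup_val x)].

Fact restr1 : restr 1. Proof. exact: (sgrp1 (s := N)). Qed.
Fact restrM x y : restr x -> restr y -> restr (x * y).
Proof. exact: (sgrpM (s := N)). Qed.
Fact restrV x : restr x -> restr x^-1. Proof. exact: (sgrpV (s := N)). Qed.
Fact restrJ x y : restr x -> restr (x ^ y). Proof. exact: (sgrpJ (s := N)). Qed.

HB.instance Definition _ :=
  isSubgroup.Build (subgroup_group A) restr restr1 restrM restrV.
HB.instance Definition _ := isNormal.Build (subgroup_group A) restr restrJ.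

End Restriction.

Arguments restr {G} A N _.

Section Quotient.
Local Open Scope quotient_scope.
Variables (G : groupType) (N : normalSubgroup G).

Definition coset_rel (x y : G) : bool := `[< (N : set G) (x^-1 * y) >].

Fact coset_rel_refl : reflexive coset_rel.
Proof. by move=> x; apply/asboolP; rewrite mulVg; apply: sgrp1. Qed.
Fact coset_rel_sym : symmetric coset_rel.
Proof.
by move=> x y; apply/asboolP/asboolP => /(sgrpV _); rewrite invgM invgK.
Qed.
Fact coset_rel_trans : transitive coset_rel.
Proof.
move=> y x z /asboolP xy /asboolP yz; apply/asboolP.
by have := sgrpM _ _ xy yz; rewrite mulgA -(mulgA x^-1) mulgV mulg1.
Qed.

Canonical coset_equiv :=
  EquivRel coset_rel coset_rel_refl coset_rel_sym coset_rel_trans.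

Definition quotient_group : Type := {eq_quot coset_equiv}.
HB.instance Definition _ := Choice.on quotient_group.

Definition coset (x : G) : quotient_group := \pi_{eq_quot coset_equiv} x.

Fact coset_eq x y : (coset x = coset y) <-> (N : set G) (x^-1 * y).
Proof.
split=> [/eqP|h]; first by rewrite eqmodE => /asboolP.
by apply/eqP; rewrite eqmodE; apply/asboolP.
Qed.

Definition coset_repr (X : quotient_group) : G :=
  repr (X : {eq_quot coset_equiv}).

Fact coset_reprK X : coset (coset_repr X) = X. Proof. exact: reprK. Qed.

Let one := coset 1.
Let mul X Y := coset (coset_repr X * coset_repr Y).
Let inv X := coset (coset_repr X)^-1.

Fact coset_mul x y : mul (coset x) (coset y) = coset (x * y).
Proof.
apply/coset_eq; rewrite invgM.
have /coset_eq hx := coset_reprK (coset x).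
have /coset_eq hy := coset_reprK (coset y).
set x' := coset_repr _ in hx *; set y' := coset_repr _ in hy *.
have := sgrpM _ _ (sgrpJ _ y' hx) hy.
rewrite conjgE; congr ((N : set G) _); rewrite -!mulgA; do 3 congr (_ * _).
by rewrite (mulgA y') mulgV mul1g.
Qed.

Fact coset_inv x : inv (coset x) = coset x^-1.
Proof.
apply/coset_eq; rewrite invgK.
have /coset_eq := coset_reprK (coset x); set x' := coset_repr _ => hx.
have := sgrpV _ (sgrpJ _ x'^-1 hx).
by rewrite conjgE invgK !mulgA mulgV mul1g invgM invgK.
Qed.

Fact quotient_mulA : associative mul.
Proof.
move=> X Y Z; rewrite -(coset_reprK X) -(coset_reprK Y) -(coset_reprK Z).
by rewrite !coset_mul mulgA.
Qed.
Fact quotient_mul1 : left_id one mul.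
Proof. by move=> X; rewrite -(coset_reprK X) coset_mul mul1g. Qed.
Fact quotient_mulg1 : right_id one mul.
Proof. by move=> X; rewrite -(coset_reprK X) coset_mul mulg1. Qed.
Fact quotient_mulV : left_inverse one inv mul.
Proof. by move=> X; rewrite -(coset_reprK X) coset_inv coset_mul mulVg. Qed.
Fact quotient_mulgV : right_inverse one inv mul.
Proof. by move=> X; rewrite -(coset_reprK X) coset_inv coset_mul mulgV. Qed.

HB.instance Definition _ := isGroup.Build quotient_group
  quotient_mulA quotient_mul1 quotient_mulg1 quotient_mulV quotient_mulgV.

Fact coset_gmulfM : {morph coset : x y / x * y}.
Proof. by move=> x y; rewrite -coset_mul. Qed.
Fact coset_gmulf1 : coset 1 = 1. Proof. by []. Qed.

HB.instance Definition _ :=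
  isUMagmaMorphism.Build G quotient_group coset (coset_gmulf1, coset_gmulfM).

End Quotient.

Definition isomorphic (G H : groupType) : Prop :=
  exists f : {multiplicative G -> H}, bijective f.

(* An action of Q on N by automorphisms. *)
Record group_action (Q N : groupType) := GroupAction {
  gact :> Q -> N -> N;
  gact1 : forall a, gact 1 a = a;
  gactM : forall s t a, gact (s * t) a = gact s (gact t a);
  gact_morph : forall s a b, gact s (a * b) = gact s a * gact s b
}.

Section SemidirectProduct.
Variables (Q N : groupType).

(* The semi-direct product of the normal subgroup N (first component) by Q,
   with the law (a, s) (c, t) = (a (s . c), s t), so that conjugation by
   (1, s) restricts to the action of s on N. *)
Definition semidirect (act : group_action Q N) : Type := (N * Q)%type.
HB.instance Definition _ act := Choice.on (semidirect act).

Variable act : group_action Q N.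
Implicit Types x y z : semidirect act.

Let one : semidirect act := (1, 1).
Let mul x y : semidirect act := (x.1 * act x.2 y.1, x.2 * y.2).
Let inv x : semidirect act := (act x.2^-1 x.1^-1, x.2^-1).

Fact gact_one s : act s 1 = 1.
Proof.
by apply: (@mulgI _ (act s 1)); rewrite -gact_morph !mulg1.
Qed.

Fact semidirect_mulA : associative mul.
Proof. by move=> x y z; rewrite /mul /= gact_morph gactM !mulgA. Qed.
Fact semidirect_mul1 : left_id one mul.
Proof. by case=> a s; rewrite /mul /= gact1 !mul1g. Qed.
Fact semidirect_mulg1 : right_id one mul.
Proof. by case=> a s; rewrite /mul /= gact_one !mulg1. Qed.
Fact semidirect_mulV : left_inverse one inv mul.
Proof. by case=> a s; rewrite /mul /= -gact_morph !mulVg gact_one. Qed.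
Fact semidirect_mulgV : right_inverse one inv mul.
Proof. by case=> a s; rewrite /mul /= -gactM !mulgV gact1 mulgV. Qed.

HB.instance Definition _ := isGroup.Build (semidirect act)
  semidirect_mulA semidirect_mul1 semidirect_mulg1
  semidirect_mulV semidirect_mulgV.

End SemidirectProduct.

Section ContinuityTools.
Variable R : realType.
Local Open Scope ring_scope.

Fact within_comp (T U V : topologicalType) (A : set T) (B : set U)
    (g : T -> U) (f : U -> V) :
  {within A, continuous g} -> {within B, continuous f} ->
  (forall x, A x -> B (g x)) -> {within A, continuous (fun x => f (g x))}.
Proof.
move=> /subspace_continuousP cg /subspace_continuousP cf AB.
apply/subspace_continuousP => x Ax W Wfgx.
have h : \forall y \near nbhs (g x), B y -> W (f y) := cf _ (AB _ Ax) W Wfgx.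
have h2 : \forall y \near nbhs x, A y -> B (g y) -> W (f (g y)) :=
  cg _ Ax _ h.
apply: filterS h2 => y h2 Ay.
by apply: h2 => //; apply: AB.
Qed.

Fact pair_continuous (T U V : topologicalType) (f : T -> U) (g : T -> V) :
  continuous f -> continuous g -> continuous (fun x => (f x, g x)).
Proof. by move=> cf cg x; apply: (cvg_pair (cf x) (cg x)). Qed.

Fact within_glue (T X : topologicalType) (D : set T) (c : T -> R)
    (f g : T -> X) :
  closed D -> continuous c ->
  {within D `&` [set x | c x <= 2^-1], continuous f} ->
  {within D `&` [set x | 2^-1 <= c x], continuous g} ->
  (forall x, D x -> c x = 2^-1 -> f x = g x) ->
  {within D, continuous (fun x => if c x <= 2^-1 then f x else g x)}.
Proof.
move=> cD cc cf cg fg.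
have -> : D = (D `&` [set x | c x <= 2^-1]) `|` (D `&` [set x | 2^-1 <= c x]).
  rewrite -setIUr; apply/seteqP; split=> [x Dx|x []//]; split => //.
  by have /orP[] := le_total (c x) 2^-1; [left|right].
apply: withinU_continuous.
- apply: closedI => //.
  by apply: (@preimage_closed _ _ c _ _ (@closed_le R 2^-1)) => z _; apply: cc.
- apply: closedI => //.
  by apply: (@preimage_closed _ _ c _ _ (@closed_ge R 2^-1)) => z _; apply: cc.
- apply: (@subspace_eq_continuous _ _ _ f _ _ cf) => x /set_mem [_ /= h].
  by rewrite /from_subspace h.
- apply: (@subspace_eq_continuous _ _ _ g _ _ cg) => x /set_mem [Dx /= h]; rewrite /from_subspace.
  by case: ifPn => // h'; rewrite fg//; apply/eqP; rewrite eq_le h h'.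
Qed.

End ContinuityTools.

Section FundamentalGroup.
Variables (R : realType) (X : topologicalType) (b : X).
Local Open Scope ring_scope.
Local Open Scope quotient_scope.

Local Notation I := (`[0%R, 1%R]%classic : set R).

(* A loop is a function on the whole real line of which only the restriction
   to [0, 1] matters: values elsewhere are irrelevant and homotopies ignore
   them. *)
Record loop := Loop {
  loop_fun :> R -> X;
  loop_continuous : {within I, continuous loop_fun};
  loop0 : loop_fun 0 = b;
  loop1 : loop_fun 1 = b
}.

Definition homotopic (f g : loop) : Prop := exists H : R * R -> X,
  [/\ {within I `*` I, continuous H},
      forall t, I t -> H (t, 0) = f t,
      forall t, I t -> H (t, 1) = g t &
      forall s, I s -> H (0, s) = b /\ H (1, s) = b].

HB.instance Definition _ := gen_eqMixin loop.
HB.instance Definition _ := gen_choiceMixin loop.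

Fact itv01P t : I t <-> 0 <= t <= 1.
Proof. by rewrite /= in_itv. Qed.

Fact closedII : closed (I `*` I).
Proof.
have cI : closed I by exact: itv_closed.
apply: (@closedI _ (fst @^-1` I) (snd @^-1` I)).
  by apply: preimage_closed cI => z _; apply: cvg_fst.
by apply: preimage_closed cI => z _; apply: cvg_snd.
Qed.

Fact homotopic_reparam (f g h : loop) (p q : R -> R) :
  continuous p -> continuous q ->
  (forall t, 0 <= t <= 1 -> 0 <= p t <= 1) ->
  (forall t, 0 <= t <= 1 -> 0 <= q t <= 1) ->
  p 0 = q 0 -> p 1 = q 1 ->
  (forall t, 0 <= t <= 1 -> g t = f (p t)) ->
  (forall t, 0 <= t <= 1 -> h t = f (q t)) -> homotopic g h.
Proof.
move=> cp cq pI qI pq0 pq1 gE hE.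
exists (fun z => f ((1 - z.2) * p z.1 + z.2 * q z.1)); split.
- apply: (@within_comp _ _ _ (I `*` I) I
    (fun z : R * R => (1 - z.2) * p z.1 + z.2 * q z.1)).
  + apply: continuous_subspaceT => z.
    apply: cvgD; apply: cvgM.
    * by apply: cvgB; [exact: cvg_cst | exact: cvg_snd].
    * by apply: (@continuous_comp _ _ _ fst p); [exact: cvg_fst | exact: cp].
    * exact: cvg_snd.
    * by apply: (@continuous_comp _ _ _ fst q); [exact: cvg_fst | exact: cq].
  + exact: loop_continuous.
  + move=> [t s] [/itv01P/= ht /itv01P/= hs]; apply/itv01P => /=.
    have := pI _ ht; have := qI _ ht; nra.
- by move=> t /itv01P ht /=; rewrite gE// subr0 mul1r mul0r addr0.
- by move=> t /itv01P ht /=; rewrite hE// subrr mul1r mul0r add0r.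
- move=> s /itv01P hs /=.
  rewrite pq0 pq1 -!mulrDl subrK !mul1r -hE ?lexx ?ler01// -hE ?lexx ?ler01//.
  by rewrite loop0 loop1.
Qed.

Fact homotopic_refl f : homotopic f f.
Proof.
by apply: (@homotopic_reparam f f f id id) => // x; apply: cvg_id.
Qed.

Fact homotopic_sym f g : homotopic f g -> homotopic g f.
Proof.
move=> [H [cH H0 H1 Hb]]; exists (fun z => H (z.1, 1 - z.2)); split.
- apply: (@within_comp _ _ _ (I `*` I) (I `*` I)
    (fun z : R * R => (z.1, 1 - z.2))) => //.
  + apply: continuous_subspaceT; apply: pair_continuous => z; first exact: cvg_fst.
    by apply: cvgB; [exact: cvg_cst | exact: cvg_snd].
  + by move=> [t s] [ht /itv01P/= hs]; split => //=; rewrite in_itv/=; lra.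
- by move=> t ht /=; rewrite subr0 H1.
- by move=> t ht /=; rewrite subrr H0.
- by move=> s /itv01P hs /=; apply: Hb; apply/itv01P; lra.
Qed.

Fact homotopic_trans f g h : homotopic f g -> homotopic g h -> homotopic f h.
Proof.
move=> [H [cH H0 H1 Hb]] [K [cK K0 K1 Kb]].
exists (fun z => if z.2 <= 2^-1 then H (z.1, 2 * z.2) else K (z.1, 2 * z.2 - 1)).
split.
- apply: within_glue.
  + exact: closedII.
  + by move=> z; apply: cvg_snd.
  + apply: (@within_comp _ _ _ _ (I `*` I)
      (fun z : R * R => (z.1, 2 * z.2))) cH _.
    * apply: continuous_subspaceT; apply: pair_continuous => z; first exact: cvg_fst.
      by apply: cvgM; [exact: cvg_cst | exact: cvg_snd].
    * move=> [t s] [[ht /itv01P/= hs] /= hs']; split => //=.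
      by rewrite in_itv/=; lra.
  + apply: (@within_comp _ _ _ _ (I `*` I)
      (fun z : R * R => (z.1, 2 * z.2 - 1))) cK _.
    * apply: continuous_subspaceT; apply: pair_continuous => z; first exact: cvg_fst.
      apply: cvgB; last exact: cvg_cst.
      by apply: cvgM; [exact: cvg_cst | exact: cvg_snd].
    * move=> [t s] [[ht /itv01P/= hs] /= hs']; split => //=.
      by rewrite in_itv/=; lra.
  + by move=> [t s] [ht _] /= ->; rewrite divff// subrr H1// K0.
- by move=> t ht /=; rewrite invr_ge0 ler0n mulr0 H0.
- move=> t ht /=; case: ifPn => [|_]; first by move=> ?; exfalso; lra.
  by rewrite mulr1 (_ : 2 - 1 = 1) ?K1//; lra.
- move=> s /itv01P hs /=; case: ifPn => hs'.
    by apply: Hb; apply/itv01P; lra.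
  by apply: Kb; apply/itv01P; move: hs'; rewrite -ltNge => hs'; lra.
Qed.

Definition const_loop : loop :=
  @Loop (cst b) (continuous_subspaceT (fun x => cvg_cst b)) erefl erefl.

(* f is followed first. *)
Definition concat_fun (f g : R -> X) (t : R) : X :=
  if t <= 2^-1 then f (2 * t) else g (2 * t - 1).

Fact concat_continuous (f g : loop) : {within I, continuous (concat_fun f g)}.
Proof.
apply: within_glue.
- exact: itv_closed.
- by move=> x; apply: cvg_id.
- apply: (@within_comp _ _ _ _ I (fun t : R => 2 * t) f _ (@loop_continuous f)).
    by apply: continuous_subspaceT => t; apply: cvgM; [exact: cvg_cst|exact: cvg_id].
  by move=> t [/itv01P ht /= ht']; rewrite in_itv/=; lra.
- apply: (@within_comp _ _ _ _ I (fun t : R => 2 * t - 1) g _ (@loop_continuous g)).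
    apply: continuous_subspaceT => t; apply: cvgB; last exact: cvg_cst.
    by apply: cvgM; [exact: cvg_cst|exact: cvg_id].
  by move=> t [/itv01P ht /= ht']; rewrite in_itv/=; lra.
- by move=> t _ ->; rewrite divff// subrr loop0 loop1.
Qed.

Fact concat0 (f g : loop) : concat_fun f g 0 = b.
Proof. by rewrite /concat_fun invr_ge0 ler0n mulr0 loop0. Qed.

Fact concat1 (f g : loop) : concat_fun f g 1 = b.
Proof.
rewrite /concat_fun; case: ifPn => [|_]; first by move=> ?; exfalso; lra.
by rewrite mulr1 (_ : 2 - 1 = 1) ?loop1//; lra.
Qed.

Definition concat (f g : loop) : loop :=
  Loop (@concat_continuous f g) (concat0 f g) (concat1 f g).

Fact reverse_continuous (f : loop) :
  {within I, continuous (fun t => f (1 - t))}.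
Proof.
apply: (@within_comp _ _ _ I I (fun t : R => 1 - t) f _ (@loop_continuous f)).
  by apply: continuous_subspaceT => t; apply: cvgB; [exact: cvg_cst|exact: cvg_id].
by move=> t /itv01P ht; rewrite /= in_itv/=; lra.
Qed.

Fact reverse0 (f : loop) : f (1 - 0) = b. Proof. by rewrite subr0 loop1. Qed.
Fact reverse1 (f : loop) : f (1 - 1) = b. Proof. by rewrite subrr loop0. Qed.

Definition reverse (f : loop) : loop :=
  Loop (@reverse_continuous f) (reverse0 f) (reverse1 f).

Fact homotopic_concat f f' g g' :
  homotopic f f' -> homotopic g g' -> homotopic (concat f g) (concat f' g').
Proof.
move=> [H [cH H0 H1 Hb]] [K [cK K0 K1 Kb]].
exists (fun z => if z.1 <= 2^-1 then H (2 * z.1, z.2) else K (2 * z.1 - 1, z.2)).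
split.
- apply: within_glue.
  + exact: closedII.
  + by move=> z; apply: cvg_fst.
  + apply: (@within_comp _ _ _ _ (I `*` I)
      (fun z : R * R => (2 * z.1, z.2))) cH _.
    * apply: continuous_subspaceT; apply: pair_continuous => z; last exact: cvg_snd.
      by apply: cvgM; [exact: cvg_cst | exact: cvg_fst].
    * move=> [t s] [[/itv01P/= ht hs] /= ht']; split => //=.
      by rewrite in_itv/=; lra.
  + apply: (@within_comp _ _ _ _ (I `*` I)
      (fun z : R * R => (2 * z.1 - 1, z.2))) cK _.
    * apply: continuous_subspaceT; apply: pair_continuous => z; last exact: cvg_snd.
      apply: cvgB; last exact: cvg_cst.
      by apply: cvgM; [exact: cvg_cst | exact: cvg_fst].
    * move=> [t s] [[/itv01P/= ht hs] /= ht']; split => //=.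
      by rewrite in_itv/=; lra.
  + move=> [t s] [_ hs] /= ->; rewrite divff// subrr.
    by rewrite (Hb _ hs).2 (Kb _ hs).1.
- move=> t /itv01P ht /=; rewrite /concat_fun; case: ifPn => ht'.
    by rewrite H0//=; rewrite in_itv/=; lra.
  by move: ht'; rewrite -ltNge => ht'; rewrite K0//=; rewrite in_itv/=; lra.
- move=> t /itv01P ht /=; rewrite /concat_fun; case: ifPn => ht'.
    by rewrite H1//=; rewrite in_itv/=; lra.
  by move: ht'; rewrite -ltNge => ht'; rewrite K1//=; rewrite in_itv/=; lra.
- move=> s hs /=; split.
    by rewrite invr_ge0 ler0n mulr0 (Hb _ hs).1.
  case: ifPn => [|_]; first by move=> ?; exfalso; lra.
  by rewrite mulr1 (_ : 2 - 1 = 1) ?(Kb _ hs).2//; lra.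
Qed.

Fact homotopic_reverse f g :
  homotopic f g -> homotopic (reverse f) (reverse g).
Proof.
move=> [H [cH H0 H1 Hb]]; exists (fun z => H (1 - z.1, z.2)); split.
- apply: (@within_comp _ _ _ (I `*` I) (I `*` I)
    (fun z : R * R => (1 - z.1, z.2))) => //.
  + apply: continuous_subspaceT; apply: pair_continuous => z; last exact: cvg_snd.
    by apply: cvgB; [exact: cvg_cst | exact: cvg_fst].
  + by move=> [t s] [/itv01P/= ht hs]; split => //=; rewrite in_itv/=; lra.
- by move=> t /itv01P ht /=; apply: H0; apply/itv01P; lra.
- by move=> t /itv01P ht /=; apply: H1; apply/itv01P; lra.
- by move=> s hs /=; rewrite subr0 subrr; have [] := Hb _ hs.
Qed.

Let cmul (a : R) : continuous (fun t : R => a * t).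
Proof. by move=> t; apply: cvgM; [exact: cvg_cst | exact: cvg_id]. Qed.
Let cadd (p : R -> R) (a : R) : continuous p -> continuous (fun t => p t + a).
Proof. by move=> cp t; apply: cvgD; [exact: cp | exact: cvg_cst]. Qed.
Let cmin (p q : R -> R) : continuous p -> continuous q ->
  continuous (fun t => Num.min (p t) (q t)).
Proof. by move=> cp cq t; apply: continuous_min; [exact: cp | exact: cq]. Qed.
Let cmax (p q : R -> R) : continuous p -> continuous q ->
  continuous (fun t => Num.max (p t) (q t)).
Proof. by move=> cp cq t; apply: continuous_max; [exact: cp | exact: cq]. Qed.
Let cidR : continuous (id : R -> R). Proof. by move=> t; apply: cvg_id. Qed.
Let ccst (a : R) : continuous (fun _ : R => a).
Proof. by move=> t; apply: cvg_cst. Qed.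

Local Ltac split_cases := repeat match goal with
  | |- context [Order.min ?x ?y] =>
      lazymatch x with context [Order.min] => fail | _ => case: (leP x y) => ? end
  | |- context [Order.max ?x ?y] => case: (leP x y) => ?
  | |- context [if (?x <= ?y)%R then _ else _] => case: (leP x y) => ?
  end.
Local Ltac piecewise := split_cases;
  first [by exfalso; lra | by rewrite ?loop0 ?loop1 | by congr (loop_fun _ _); lra].

Fact homotopic_concatA f g h :
  homotopic (concat f (concat g h)) (concat (concat f g) h).
Proof.
apply: homotopic_sym.
apply: (@homotopic_reparam (concat f (concat g h)) _ _
  (fun t => Num.min (Num.min (2 * t) (t + 4^-1)) (2^-1 * t + 2^-1)) id) => //.
- by apply: cmin; [apply: cmin => //; exact: cadd | exact: cadd].
- by move=> t ht; split_cases; lra.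
- by split_cases; lra.
- by split_cases; lra.
- by move=> t ht /=; rewrite /concat_fun /= /concat_fun; piecewise.
Qed.

Fact homotopic_1concat f : homotopic (concat const_loop f) f.
Proof.
apply: (@homotopic_reparam f _ _ (fun t => Num.max 0 (2 * t - 1)) id) => //.
- by apply: cmax => //; exact: cadd.
- by move=> t ht; split_cases; lra.
- by split_cases; lra.
- by split_cases; lra.
- move=> t ht /=; rewrite /concat_fun /=; split_cases; rewrite ?loop0 //.
    by rewrite (_ : 2 * t - 1 = 0) ?loop0//; lra.
  by exfalso; lra.
Qed.

Fact homotopic_concat1 f : homotopic (concat f const_loop) f.
Proof.
apply: (@homotopic_reparam f _ _ (fun t => Num.min (2 * t) 1) id) => //.
- exact: cmin.
- by move=> t ht; split_cases; lra.
- by split_cases; lra.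
- by split_cases; lra.
- move=> t ht /=; rewrite /concat_fun /=; split_cases; rewrite ?loop1 //;
  by exfalso; lra.
Qed.

Fact homotopic_concatV f : homotopic (concat f (reverse f)) const_loop.
Proof.
apply: (@homotopic_reparam f _ _
  (fun t => Num.min (2 * t) (2 - 2 * t)) (fun=> 0)) => //.
- apply: cmin => // t; apply: cvgB; [exact: cvg_cst | exact: cmul].
- by move=> t ht; split_cases; lra.
- by move=> t ht; lra.
- by split_cases; lra.
- by split_cases; lra.
- by move=> t ht /=; rewrite /concat_fun /=; piecewise.
- by move=> t ht /=; rewrite loop0.
Qed.

Fact homotopic_concatVl f : homotopic (concat (reverse f) f) const_loop.
Proof.
apply: (@homotopic_reparam f _ _
  (fun t => Num.max (1 - 2 * t) (2 * t - 1)) (fun=> 1)) => //.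
- apply: cmax; last exact: cadd.
  by move=> t; apply: cvgB; [exact: cvg_cst | exact: cmul].
- by move=> t ht; split_cases; lra.
- by move=> t ht; lra.
- by split_cases; lra.
- by split_cases; lra.
- by move=> t ht /=; rewrite /concat_fun /=; piecewise.
- by move=> t ht /=; rewrite loop1.
Qed.

Definition homotopic_rel (f g : loop) : bool := `[< homotopic f g >].

Fact homotopic_rel_refl : reflexive homotopic_rel.
Proof. by move=> f; apply/asboolP/homotopic_refl. Qed.
Fact homotopic_rel_sym : symmetric homotopic_rel.
Proof. by move=> f g; apply/asboolP/asboolP; apply: homotopic_sym. Qed.
Fact homotopic_rel_trans : transitive homotopic_rel.
Proof.
by move=> g f h /asboolP fg /asboolP gh; apply/asboolP/(homotopic_trans fg gh).
Qed.

Canonical homotopic_equiv := EquivRel homotopic_rel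
  homotopic_rel_refl homotopic_rel_sym homotopic_rel_trans.

Definition pi1 : Type := {eq_quot homotopic_equiv}.
HB.instance Definition _ := Choice.on pi1.

Definition pi1_class (f : loop) : pi1 := \pi_{eq_quot homotopic_equiv} f.
Definition pi1_repr (a : pi1) : loop := repr (a : {eq_quot homotopic_equiv}).

Fact pi1_reprK a : pi1_class (pi1_repr a) = a. Proof. exact: reprK. Qed.

Fact pi1_classP f g : pi1_class f = pi1_class g <-> homotopic f g.
Proof.
split=> [/eqP|h]; first by rewrite eqmodE => /asboolP.
by apply/eqP; rewrite eqmodE; apply/asboolP.
Qed.

Definition pi1_one : pi1 := pi1_class const_loop.
Definition pi1_mul (a c : pi1) : pi1 :=
  pi1_class (concat (pi1_repr a) (pi1_repr c)).
Definition pi1_inv (a : pi1) : pi1 := pi1_class (reverse (pi1_repr a)).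

Fact pi1_mulE f g : pi1_mul (pi1_class f) (pi1_class g) = pi1_class (concat f g).
Proof. by apply/pi1_classP/homotopic_concat; apply/pi1_classP/pi1_reprK. Qed.

Fact pi1_invE f : pi1_inv (pi1_class f) = pi1_class (reverse f).
Proof. by apply/pi1_classP/homotopic_reverse/pi1_classP/pi1_reprK. Qed.

Fact pi1_mulA : associative pi1_mul.
Proof.
move=> x y z; rewrite -(pi1_reprK x) -(pi1_reprK y) -(pi1_reprK z) !pi1_mulE.
exact/pi1_classP/homotopic_concatA.
Qed.
Fact pi1_mul1 : left_id pi1_one pi1_mul.
Proof.
move=> x; rewrite -(pi1_reprK x) pi1_mulE.
exact/pi1_classP/homotopic_1concat.
Qed.
Fact pi1_mulg1 : right_id pi1_one pi1_mul.
Proof.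
move=> x; rewrite -(pi1_reprK x) pi1_mulE.
exact/pi1_classP/homotopic_concat1.
Qed.
Fact pi1_mulV : left_inverse pi1_one pi1_inv pi1_mul.
Proof.
move=> x; rewrite -(pi1_reprK x) pi1_invE pi1_mulE.
exact/pi1_classP/homotopic_concatVl.
Qed.
Fact pi1_mulgV : right_inverse pi1_one pi1_inv pi1_mul.
Proof.
move=> x; rewrite -(pi1_reprK x) pi1_invE pi1_mulE.
exact/pi1_classP/homotopic_concatV.
Qed.

HB.instance Definition _ := isGroup.Build pi1
  pi1_mulA pi1_mul1 pi1_mulg1 pi1_mulV pi1_mulgV.

End FundamentalGroup.

Section Configurations.
Local Open Scope quotient_scope.
Variables (M : topologicalType) (m : nat).

(* F_m(M), with the topology induced by the product topology of M^m. *)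
Definition config : topologicalType :=
  set_type [set y : {ptws 'I_m -> M} | forall i j, i != j -> y i <> y j].

Definition config_fun (y : config) : 'I_m -> M := \val y.

Definition perm_rel (y z : config) : bool :=
  `[< exists s : 'S_m, forall i, config_fun y (s i) = config_fun z i >].

Fact perm_rel_refl : reflexive perm_rel.
Proof. by move=> y; apply/asboolP; exists 1 => i; rewrite perm1. Qed.
Fact perm_rel_sym : symmetric perm_rel.
Proof.
by move=> y z; apply/asboolP/asboolP => -[s ys]; exists s^-1 => i;
  rewrite -ys permKV.
Qed.
Fact perm_rel_trans : transitive perm_rel.
Proof.
move=> z y w /asboolP[s ys] /asboolP[t zt]; apply/asboolP; exists (t * s) => i.
by rewrite permM ys zt.
Qed.

Canonical perm_equiv :=
  EquivRel perm_rel perm_rel_refl perm_rel_sym perm_rel_trans.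

(* F_m(M) / S_m *)
Definition unordered_config : topologicalType :=
  quotient_topology {eq_quot perm_equiv}.

End Configurations.

(* The base point b is explicit; R is the real line in which the parameter
   interval of the loops is taken. *)
Definition braid_group (R : realType) (M : topologicalType) (m : nat)
  (b : unordered_config M m) : groupType := pi1 R b.

Definition sphere2 (R : realType) : topologicalType :=
  set_type [set p : 'rV[R]_3 | (\sum_i p ord0 i ^+ 2 = 1)%R].

Definition punctured_sphere (R : realType) (n : nat) (x : 'I_n -> sphere2 R) :
  topologicalType := set_type (~` range x).

(* Z^k, written multiplicatively (so the group law is the sum of vectors). *)
Definition freeZ (k : nat) : groupType := Algebra.to_multiplicative 'rV[int]_k.

Definition freeZ_basis (k : nat) (i : 'I_k) : freeZ k :=
  delta_mx (ord0 : 'I_1) i : 'rV[int]_k.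

Definition ubar : freeZ 2 := freeZ_basis ord0.
Definition vbar : freeZ 2 := freeZ_basis ord_max.

(* Main.v *)
Require Import Defs.
From mathcomp Require Import all_boot all_order all_algebra.
From mathcomp Require Import all_classical all_reals all_analysis.
From HB Require Import structures.
From mathcomp Require Import fingroup perm ring lra zify.

Set Implicit Arguments.
Unset Strict Implicit.
Unset Printing Implicit Defensive.

Import Order.TTheory GRing.Theory Num.Theory.
Import numFieldNormedType.Exports.

(* Project the sphere stereographically from x_1: the other punctures become
   N = n - 1 points of the plane, in general position after a shear. Straight
   motions inside families of configurations with coherent relative directions
   yield elements sigma_r (half twists) and rho_(i,k) (strand i around puncture
   k) of B. Comparing motions inside one coherent family gives the relations of
   the sigma_r, rho_(i,k) = sigma_i rho_(i+1,k) sigma_i^-1, the commutation of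
   rho_(i,k) with rho_(i+1,l) for suitably ordered k <> l, and that of rho_(i,k)
   with the sigma_r away from i; subdividing loops shows that these elements
   generate. In B / Gamma_3, and in B / B'' for m >= 5, the relations force all
   sigma_r to be equal, hence the group to be abelian; in B / B'' for m = 4 they
   give sigma_1 = sigma_3 and a normal form u^i v^j sigma^k prod rho_l^(t_l).
   That nothing more collapses is detected by an explicit homomorphism onto
   (Z^2 x| Z) x Z^N, obtained as the monodromy of locally constant transition
   functions: a configuration is covered by the charts in which a linear
   projection separates its points, and the change of projection is a positive
   permutation braid. *)

(** * Coherent families of plane configurations *)

Local Open Scope ring_scope.
Local Open Scope group_scope.

(** No presentation of the group is established. The relations bound the quotients from above and
    the homomorphism [phi] bounds them from below. Injectivity is then formal: a map [psi] out of
    the explicit group satisfies [psi (phi g) = coset g] on generators, hence everywhere. The target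
    comes from B_3: identifying sigma_3 with sigma_1 maps B_4 onto B_3, whose commutator subgroup is
    free of rank two, and a half twist acts on the abelianisation of that subgroup by a matrix with
    characteristic polynomial t^2 - t + 1, the Alexander polynomial of the trefoil. The obstacle is
    that the fundamental group consists of classes of arbitrary continuous loops of unordered
    configurations. It is overcome by two devices: a cocycle on pairs of labelled configurations,
    multiplicative on every family whose convex hull avoids collisions, and a supremum argument that
    turns local statements along an interval into global ones. *)

Inductive dir := East | West | North | South.

Definition towards (R : realFieldType) (d : dir) (p q : R * R) : bool :=
  match d with
  | East => p.1 < q.1 | West => q.1 < p.1
  | North => p.2 < q.2 | South => q.2 < p.2
  end%R.

Definition opp_dir d :=
  match d with East => West | West => East | North => South | South => North end.

Lemma towards_opp (R : realFieldType) d (p q : R * R) :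
  towards (opp_dir d) q p = towards d p q.
Proof. by case: d. Qed.

Section Coherent.
Variables (R : realFieldType) (m N : nat) (P : 'I_N -> R * R).
Local Notation V := ('I_m -> R * R).

(* The convex hull of a coherent family avoids all collisions: this makes the
   straight-line motions between its members, and their homotopies, available. *)
Definition coherent (A : V -> Prop) : Prop :=
  (forall i j : 'I_m, i != j ->
     exists d, forall a, A a -> towards d (a i) (a j)) /\
  (forall (i : 'I_m) k, exists d, forall a, A a -> towards d (a i) (P k)).

Definition relabel (s : 'S_m) (a : V) : V := fun i => a (s i).

Definition in_conf (a : V) : Prop :=
  (forall i j, i != j -> a i <> a j) /\ (forall i k, a i <> P k).

(** Stronger than [in_conf]: the first coordinate alone separates everything, so the strands may
    move vertically at will. *)
Definition generic (a : V) : Prop :=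
  (forall i j, i != j -> (a i).1 != (a j).1) /\
  (forall i k, (a i).1 != (P k).1).

Lemma coherent_sub (A A' : V -> Prop) :
  (forall a, A' a -> A a) -> coherent A -> coherent A'.
Proof.
move=> sub [h1 h2]; split=> [i j /h1|i k]; last have := h2 i k.
  by case=> d hd; exists d => a /sub /hd.
by case=> d hd; exists d => a /sub /hd.
Qed.

Lemma coherent_lt (A : V -> Prop) :
  (forall i j : 'I_m, (i < j)%N -> exists d, forall a, A a -> towards d (a i) (a j)) ->
  (forall (i : 'I_m) k, exists d, forall a, A a -> towards d (a i) (P k)) ->
  coherent A.
Proof.
move=> h1 h2; split=> // i j; rewrite neq_ltn => /orP[/h1//|/h1[d hd]].
by exists (opp_dir d) => a /hd; rewrite towards_opp.
Qed.

Definition rk (a : V) (i : 'I_m) : nat := #|[pred j | ((a j).1 < (a i).1)%R]|.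

Lemma rk_relabel s a i : rk (relabel s a) i = rk a (s i).
Proof.
rewrite /rk -(fintype.card_image (@perm_inj _ s)); apply: eq_card => j.
rewrite !inE; apply/fintype.imageP/idP => [[l]|h].
  by rewrite inE => hl ->.
by exists (s^-1 j); rewrite ?inE /relabel permKV.
Qed.

Lemma rk_lt a i j : ((a i).1 < (a j).1)%R -> (rk a i < rk a j)%N.
Proof.
move=> ij; apply/fintype.proper_card/fintype.properP; split.
  by apply/fintype.subsetP=> l; rewrite !inE => /lt_trans; apply.
by exists i; rewrite inE ?ltxx.
Qed.

Lemma rk_bound a i : (rk a i < m)%N.
Proof.
rewrite -[ltnRHS]card_ord; apply/fintype.proper_card/fintype.properP; split.
  exact: fintype.subset_predT.
by exists i; rewrite ?inE ?ltxx.
Qed.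

Lemma rk_eq a b : (forall i j, ((a i).1 < (a j).1) = ((b i).1 < (b j).1))%R ->
  rk a =1 rk b.
Proof. by move=> h i; apply: eq_card => j; rewrite !inE h. Qed.

Definition sorted_conf (a : V) :=
  forall i j : 'I_m, ((a i).1 < (a j).1)%R = (i < j)%N.

Lemma sorted_rk a i : sorted_conf a -> rk a i = i.
Proof.
move=> sa; rewrite /rk.
have -> : #|[pred j : 'I_m | ((a j).1 < (a i).1)%R]| = #|[pred j : 'I_m | (j < i)%N]|.
  by apply: eq_card => j; rewrite !inE sa.
rewrite -sum1_card -(big_ord_widen_cond m (fun=> true) (fun=> 1%N)).
  by rewrite sum1_card card_ord.
exact: ltnW.
Qed.

Lemma sort_conf a : (forall i j, i != j -> (a i).1 != (a j).1) ->
  exists s, sorted_conf (relabel s a).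
Proof.
move=> ga.
have lt_rk i j : ((a i).1 < (a j).1)%R = (rk a i < rk a j)%N.
  apply/idP/idP; first exact: rk_lt.
  case: (eqVneq i j) => [->|/ga]; first by rewrite ltnn.
  by rewrite neq_lt => /orP[//|/rk_lt/ltnW]; rewrite leqNgt => /negP.
pose f i := Ordinal (rk_bound a i).
have f_inj : injective f.
  move=> i j [eq_rk]; apply/eqP/negPn/negP => /ga.
  by rewrite neq_lt !lt_rk eq_rk ltnn.
(* Place i of [relabel s a] holds strand s i, which has to be the strand of rank i; hence the
   inverse of the rank permutation. *)
exists (perm f_inj)^-1 => i j.
rewrite /relabel lt_rk.
have E l : rk a ((perm f_inj)^-1 l) = l.
  by rewrite -[RHS](congr1 val (permKV (perm f_inj) l)) permE.
by rewrite !E.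
Qed.

End Coherent.

(** * Generators *)

Local Open Scope ring_scope.
Local Open Scope group_scope.

Definition swap (r x : nat) : nat :=
  if x == r then r.+1 else if x == r.+1 then r else x.

Lemma swap_ltn r x y : ~~ ((x == r) && (y == r.+1)) ->
  ~~ ((x == r.+1) && (y == r)) -> (swap r x < swap r y)%N = (x < y)%N.
Proof. by rewrite /swap; repeat case: eqP => //=; lia. Qed.

Lemma swap_bound m r x : (r.+1 < m)%N -> (x < m)%N -> (swap r x < m)%N.
Proof. by rewrite /swap; repeat case: eqP => //=; lia. Qed.

Lemma swap_inj r : injective (swap r).
Proof. by move=> x y; rewrite /swap; repeat case: eqP => //=; lia. Qed.

Section Cocycle.
Variables (R : realFieldType) (m N : nat) (P : 'I_N -> R * R).
Local Notation V := ('I_m -> R * R).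
(** Heights 2 and -2 are free passages above and below the punctures. With abscissae more than 4
    [gap] apart, the intervals of radius 2 [gap] around the punctures are disjoint. *)
Hypothesis P_height : forall k, (-1 < (P k).2 < 1)%R.
Variables (x0 x1 gap : R).
Hypothesis gap_gt0 : (0 < gap)%R.
Hypothesis x0_left : forall k, (x0 + m%:R + gap *+ 4 < (P k).1)%R.
Hypothesis x1_right : forall k, ((P k).1 + gap *+ 4 < x1)%R.
Hypothesis P_gap : forall k l : 'I_N, k != l ->
  ((P k).1 + gap *+ 4 < (P l).1)%R \/ ((P l).1 + gap *+ 4 < (P k).1)%R.

(** All the topology that enters here: invariance under relabelling and multiplicativity on coherent
    families. The instance is [edge]. *)
Variables (B : groupType) (e : V -> V -> B).
Hypothesis e_relabel : forall s a b, e (relabel s a) (relabel s b) = e a b.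
Hypothesis e_coherent : forall A, coherent P A ->
  forall a b c, A a -> A b -> A c -> e a b * e b c = e a c.

Implicit Types (a b c : V) (i j : 'I_m) (k l : 'I_N).

Let coherent1 A a : coherent P A -> A a -> e a a = 1.
Proof.
move=> cA Aa; apply: (@mulgI _ (e a a)).
by rewrite (e_coherent cA) // mulg1.
Qed.

Let coherentV A a b : coherent P A -> A a -> A b -> e b a = (e a b)^-1.
Proof.
move=> cA Aa Ab; apply: (@mulgI _ (e a b)).
by rewrite (e_coherent cA) // mulgV (coherent1 cA).
Qed.

(* [e a b] stands for the class of the straight motion from a to b. It depends
   on auxiliary paths to the endpoints, and [ge] normalises it by closing the
   motion up along a standard path: lift every point of a vertically to height
   2, above all punctures, then slide to standard positions left of them. *)
Definition base a : V := fun i => (x0 + (rk a i)%:R, 2)%R.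
Definition raise a : V := fun i => ((a i).1, 2)%R.
Definition gauge a : B := e (base a) (raise a) * e (raise a) a.
Definition ge a b : B := gauge a * e a b * (gauge b)^-1.

Lemma ge_coherent A a b c : coherent P A -> A a -> A b -> A c ->
  ge a b * ge b c = ge a c.
Proof.
move=> cA Aa Ab Ac.
rewrite /ge; move: (gauge a) (gauge b) (gauge c) => u v w.
by rewrite -!mulgA mulKg (mulgA (e a b)) (e_coherent cA).
Qed.

Lemma geV A a b : coherent P A -> A a -> A b -> ge b a = (ge a b)^-1.
Proof.
move=> cA Aa Ab; rewrite /ge; move: (gauge a) (gauge b) => u v.
by rewrite (coherentV cA Aa Ab) !invgM invgK mulgA.
Qed.

(** In a square inside one coherent family, two trivial opposite sides carry the value of [ge] from
    one pair to the other. This is how a motion is brought into standard position. *)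
Lemma ge_quad A a b c d : coherent P A -> A a -> A b -> A c -> A d ->
  ge a c = 1 -> ge b d = 1 -> ge a b = ge c d.
Proof.
move=> cA Aa Ab Ac Ad ac1 bd1.
rewrite -(ge_coherent cA Aa Ac Ab) -(ge_coherent cA Ac Ad Ab) ac1 mul1g.
by rewrite (geV cA Ab Ad) bd1 invg1 mulg1.
Qed.

Lemma base_relabel s a : base (relabel s a) = relabel s (base a).
Proof. by apply/funext => i; rewrite /base rk_relabel. Qed.

Lemma ge_relabel s a b : ge (relabel s a) (relabel s b) = ge a b.
Proof. by rewrite /ge /gauge !base_relabel -![raise (relabel s _)]/(relabel s (raise _)) !e_relabel. Qed.

Definition same_order a b := forall i j,
  ((a i).1 < (a j).1)%R = ((b i).1 < (b j).1)%R.

Definition same_strip a b i := forall k,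
  ((a i).1 < (P k).1)%R = ((b i).1 < (P k).1)%R.

(** The two ways for a strand to move without winding around a puncture. *)
Definition free_strip a b i :=
  same_strip a b i \/ (1 < (a i).2 /\ 1 < (b i).2)%R.

Lemma generic_dir a i j : generic P a -> i != j ->
  ((a i).1 < (a j).1)%R \/ ((a j).1 < (a i).1)%R.
Proof. by move=> [ga _] /ga; rewrite neq_lt => /orP. Qed.

Lemma ge_triv a b : generic P a -> generic P b -> same_order a b ->
  (forall i, free_strip a b i) -> ge a b = 1.
Proof.
move=> ga gb sab fab.
have hP := P_height.
pose ord (x : V) := forall i j, ((a i).1 < (a j).1)%R -> ((x i).1 < (x j).1)%R.
pose A1 (x : V) := ord x /\ forall i, (1 < (x i).2)%R.
have ordC (C : V -> Prop) : (forall x, C x -> ord x) -> forall i j, i != j ->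
    exists d, forall x, C x -> towards d (x i) (x j).
  move=> Cord i j ij; have [h|h] := generic_dir ga ij.
    by exists East => x /Cord; apply.
  by exists West => x /Cord; apply.
have cA1 : coherent P A1.
  split; first by apply: ordC => x [].
  move=> i k; exists South => x [_ /(_ i)] /= h; have := hP k; lra.
pose A2 (x : V) := ord x /\ forall i,
  (~ same_strip a b i -> (1 < (x i).2)%R) /\
  (same_strip a b i -> forall k, ((a i).1 < (P k).1 -> (x i).1 < (P k).1)%R /\
     ((P k).1 < (a i).1 -> (P k).1 < (x i).1)%R).
have cA2 : coherent P A2.
  split; first by apply: ordC => x [].
  move=> i k; have [ss|nss] := pselect (same_strip a b i); last first.
    exists South => x [_ /(_ i)[/(_ nss) h _]] /=; have := hP k; lra.
  have := ga.2 i k; rewrite neq_lt => /orP[h|h].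
    by exists East => x [_ /(_ i)[_ /(_ ss k)[/(_ h)]]].
  by exists West => x [_ /(_ i)[_ /(_ ss k)[_ /(_ h)]]].
have A2a : A2 a.
  split=> [//|i]; split=> // nss.
  by have [//|[]] := fab i.
have ord_b : ord b by move=> i j; rewrite sab.
have A2b : A2 b.
  split=> [//|i]; split=> [nss|ss k].
    by have [//|[]] := fab i.
  split; first by rewrite ss.
  by move=> h; rewrite lt_neqAle eq_sym gb.2 leNgt -ss -leNgt ltW.
have lt12 : (1 < 2 :> R)%R by lra.
have A2ra : A2 (raise a) by split=> // i; split.
have A2rb : A2 (raise b).
  split=> [|i]; first exact: ord_b.
  by split=> //; have [_ h] := A2b.2 i.
have rkE : base a = base b.
  by apply/funext=> i; rewrite /base (rk_eq sab).
have A1ra : A1 (raise a) by split.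
have A1rb : A1 (raise b) by split.
have A1o : A1 (base b).
  split=> // i j; rewrite -rkE /= ltrD2l ltr_nat; exact: rk_lt.
rewrite /ge /gauge rkE.
apply/eqP; rewrite divg_eq1 -(mulgA (e (base b) _)) (e_coherent cA2 A2ra A2a A2b).
by rewrite -(e_coherent cA2 A2ra A2rb A2b) mulgA (e_coherent cA1 A1o A1ra A1rb).
Qed.

Definition line (w : 'I_m -> nat) (t : 'I_m -> R) : V :=
  fun i => (x0 + (w i)%:R, t i)%R.

Definition bump (r x : nat) : R := if x == r.+1 then 3%R else 2%R.

(* Of two strands exchanging their places, the one at height 3 passes above. *)
Definition sig (r : nat) : B :=
  ge (line (@nat_of_ord m) (bump r)) (line (swap r) (bump r)).

(** The strands after r wait to the right of all punctures, so the configuration remains sorted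
    while strand r passes puncture k. *)
Definition pole (r : nat) k (u : R) : V := fun i =>
  if (i < r)%N then (x0 + i%:R, 2)%R
  else if i == r :> nat then ((P k).1 + u, -2)%R
  else (x1 + i%:R, 2)%R.

(* Strand r comes down from the top left of puncture k, passes below it and goes
   up again on its right: the loop thus encircles puncture k alone. *)
Definition rho (r : nat) k : B := ge (pole r k (- gap)%R) (pole r k gap).

Lemma bump_gt1 r x : (1 < bump r x)%R.
Proof. by rewrite /bump; case: eqP => _; lra. Qed.

Lemma left_of_P n k : (n < m)%N -> (x0 + n%:R < (P k).1)%R.
Proof.
move=> nm; have := x0_left k; have : (n%:R <= m%:R :> R)%R by rewrite ler_nat ltnW.
by have := gap_gt0; lra.
Qed.

Lemma generic_line w t : injective w -> (forall i, (w i < m)%N) ->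
  generic P (line w t).
Proof.
move=> w_inj wm; split=> [i j ij|i k] /=.
  by rewrite (inj_eq (addrI _)) eqr_nat (inj_eq w_inj).
by rewrite lt_eqF // left_of_P.
Qed.

(** Strand i passes below strand j from left to right. As no other pair changes its order, i and j
    must be neighbours; [ge_sig] deduces this. *)
Definition swapped a b i j :=
  [/\ ((a i).1 < (a j).1)%R, ((b j).1 < (b i).1)%R, ((a i).2 < (a j).2)%R,
      ((b i).2 < (b j).2)%R &
      forall x y, ~~ ((x == i) && (y == j)) -> ~~ ((x == j) && (y == i)) ->
        ((a x).1 < (a y).1)%R = ((b x).1 < (b y).1)%R].

Let In4 (a b c d x : V) := x = a \/ x = b \/ x = c \/ x = d.

Lemma strip_dir a b i k : generic P a -> same_strip a b i ->
  (b i).1 != (P k).1 ->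
  (((a i).1 < (P k).1) && ((b i).1 < (P k).1))%R \/
  (((P k).1 < (a i).1) && ((P k).1 < (b i).1))%R.
Proof.
move=> ga /(_ k) ss bk; have := ga.2 i k; rewrite neq_lt ss => /orP[h|].
  by left; rewrite h.
by move=> h; right; rewrite h /= lt_neqAle eq_sym bk leNgt -ss -leNgt ltW.
Qed.

(** Two squares: the heights become those of [bump] with abscissae fixed, then the abscissae slide
    to standard positions with heights fixed. The pair i, j is separated by height, all other pairs
    by their horizontal order. *)
Lemma ge_sig_sorted a b i j : sorted_conf a -> generic P a -> generic P b ->
  swapped a b i j -> (forall x, free_strip a b x) -> j = i.+1 :> nat ->
  ge a b = sig i.
Proof.
move=> sa ga gb [aij bij a2 b2 ab] fab ji.
have hP := P_height.
pose a' : V := fun x => ((a x).1, bump i x).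
pose b' : V := fun x => ((b x).1, bump i x).
have bumpi : (bump i i < bump i j)%R.
  by rewrite /bump -ji eqxx ifF; [lra | apply/eqP; lia].
have i1m : (i.+1 < m)%N by rewrite -ji.
have pairC (x y : 'I_m) : (x < y)%N -> ~~ ((x == i) && (y == j)) ->
    [/\ ((a x).1 < (a y).1)%R, ((b x).1 < (b y).1)%R & (swap i x < swap i y)%N].
  move=> xy nxy; have nyx : ~~ ((x == j) && (y == i)).
    by apply/negP => /andP[/eqP ? /eqP ?]; subst; lia.
  by rewrite -ab // sa xy swap_ltn // -?ji.
transitivity (ge a' b').
  apply: (@ge_quad (In4 a b a' b')); rewrite /In4; try tauto.
  - apply: coherent_lt => [x y xy|x k].
      have [/andP[/eqP-> /eqP->]|/(pairC _ _ xy)[h1 h2 h3]] :=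
        boolP ((x == i) && (y == j)).
        by exists North => ? [->|[->|[->|->]]].
      by exists East => ? [->|[->|[->|->]]].
    have [ss|[h1 h2]] := fab x.
      by case: (strip_dir ga ss (gb.2 x k)) => /andP[h1 h2];
        [exists East | exists West] => ? [->|[->|[->|->]]].
    have := hP k => hk; have hb := bump_gt1 i x.
    by exists South => ? [->|[->|[->|->]]] /=; lra.
  - by apply: ge_triv => // x; left.
  - by apply: ge_triv => // x; left.
apply: (@ge_quad (In4 a' b' (line (@nat_of_ord m) (bump i)) (line (swap i) (bump i))));
  rewrite /In4; try tauto.
- apply: coherent_lt => [x y xy|x k].
    have [/andP[/eqP-> /eqP->]|/(pairC _ _ xy)[h1 h2 h3]] :=
        boolP ((x == i) && (y == j)).
      by exists North => ? [->|[->|[->|->]]].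
    by exists East => ? [->|[->|[->|->]]] //=; rewrite ltrD2l ltr_nat.
  have := hP k => hk; have hb := bump_gt1 i x.
  by exists South => ? [->|[->|[->|->]]] /=; lra.
- apply: ge_triv => //.
  + by apply: generic_line => [|x]; [exact: ord_inj|].
  + by move=> x y /=; rewrite sa ltrD2l ltr_nat.
  + by move=> x; right; split; exact: bump_gt1.
- apply: ge_triv => //.
  + apply: generic_line => [x y /swap_inj/ord_inj//|x].
    exact: swap_bound.
  + move=> x y /=; rewrite ltrD2l ltr_nat.
    have [/andP[/eqP-> /eqP->]|nxy] := boolP ((x == i) && (y == j)).
      rewrite ltNge ltW //= /swap eqxx ji eqxx ifF; last by apply/eqP; lia.
      by apply/esym/negbTE; lia.
    have [/andP[/eqP-> /eqP->]|nyx] := boolP ((x == j) && (y == i)).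
      rewrite bij /swap eqxx ji eqxx ifF; last by apply/eqP; lia.
      by lia.
    by rewrite -ab // sa swap_ltn // -?ji.
  + by move=> x; right; split; exact: bump_gt1.
Qed.

Lemma generic_relabel s a : generic P a -> generic P (relabel s a).
Proof.
move=> [h1 h2]; split=> [i j ij|i k]; rewrite /relabel //.
by apply: h1; rewrite (inj_eq perm_inj).
Qed.

Lemma ge_sig a b i j : generic P a -> generic P b ->
  swapped a b i j -> (forall x, free_strip a b x) -> ge a b = sig (rk a i).
Proof.
move=> ga gb [aij bij a2 b2 ab] fab; have [s sa] := sort_conf ga.1.
rewrite -(ge_relabel s) -(permKV s i) -rk_relabel sorted_rk //.
have ab' x y : ~~ ((x == s^-1 i) && (y == s^-1 j)) ->
    ~~ ((x == s^-1 j) && (y == s^-1 i)) ->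
    ((relabel s a x).1 < (relabel s a y).1)%R =
    ((relabel s b x).1 < (relabel s b y).1)%R.
  have E z t : (z == s^-1 t) = (s z == t) by rewrite -(inj_eq (@perm_inj _ s)) permKV.
  by rewrite !E => n1 n2; rewrite /relabel ab.
have ij' : (s^-1 i < s^-1 j)%N by rewrite -sa /relabel !permKV.
apply: (@ge_sig_sorted _ _ _ (s^-1 j)) => //; try exact: generic_relabel.
- by split; rewrite /relabel ?permKV.
- by move=> x; exact: fab.
(* A strand l strictly between the two would stay right of the first and left of the second,
   although these are exchanged. *)
apply/eqP; rewrite eqn_leq ij' andbT leqNgt; apply/negP => lt_ij.
have lm : ((s^-1 i).+1 < m)%N by apply: ltn_trans lt_ij _.
pose l := Ordinal lm.
have n1 : l != s^-1 i by apply/eqP => /(congr1 val) /=; lia.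
have n2 : l != s^-1 j by apply/eqP => /(congr1 val) /=; lia.
have h1 : ((relabel s b (s^-1 i)%g).1 < (relabel s b l).1)%R.
  by rewrite -ab' ?sa ?(negPf n2) ?(negPf n1) ?andbF //=.
have h2 : ((relabel s b l).1 < (relabel s b (s^-1 j)%g).1)%R.
  by rewrite -ab' ?sa ?(negPf n2) ?(negPf n1) ?andbF //=.
by have := lt_trans h1 h2; rewrite /relabel !permKV ltNge ltW.
Qed.

Lemma sorted_pole r k u : (`|u| <= gap *+ 2)%R -> sorted_conf (pole r k u).
Proof.
rewrite ler_norml => /andP[u1 u2].
suff lt_pole (i j : 'I_m) : (i < j)%N -> ((pole r k u i).1 < (pole r k u j).1)%R.
  move=> i j; apply/idP/idP => [|/lt_pole//]; rewrite ltNge => /negP h.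
  rewrite ltnNge leq_eqVlt; apply/negP => /orP[/eqP/ord_inj ji|/lt_pole/ltW//].
  by case: h; rewrite ji.
move=> ij.
have h1 := x0_left k; have h2 := x1_right k; have h3 := gap_gt0.
have h4 : (i%:R < j%:R :> R)%R by rewrite ltr_nat.
have h5 : (0 <= i%:R :> R)%R by rewrite ler0n.
have h6 : (i%:R <= m%:R :> R)%R by rewrite ler_nat ltnW.
rewrite /pole; case: (ltngtP i r) => ir; case: (ltngtP j r) => jr /=;
  try (by exfalso; clear -ij ir jr; lia); clear -u1 u2 h1 h2 h3 h4 h5 h6; lra.
Qed.

Lemma generic_pole r k u : (0 < `|u| <= gap *+ 2)%R -> generic P (pole r k u).
Proof.
move=> /andP[u0 u2]; split=> [i j|i l].
  rewrite neq_ltn -!(sorted_pole r k u2) => /orP[/lt_eqF->//|/gt_eqF->//].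
have := gap_gt0 => hg.
rewrite /pole; case: ltngtP => _ /=.
- by rewrite lt_eqF // left_of_P.
- by rewrite gt_eqF //; have := x1_right l; have : (0 <= i%:R :> R)%R by []; lra.
have [->|/P_gap lk] := eqVneq l k.
  by rewrite -subr_eq0 addrAC subrr add0r -normr_gt0.
by move: u2; rewrite ler_norml neq_lt => /andP[v1 v2]; apply/orP; lra.
Qed.

(** The two squares of [ge_sig_sorted] again: first to heights 2 and -2, then horizontally to
    [pole]. All strands keep their horizontal order, and strand i stays below every puncture. *)
Lemma ge_rho_sorted a b i k : sorted_conf a -> generic P a -> generic P b ->
  same_order a b -> (forall x, x != i -> free_strip a b x) ->
  ((a i).1 < (P k).1 < (b i).1)%R ->
  (forall l, l != k -> ((a i).1 < (P l).1)%R = ((b i).1 < (P l).1)%R) ->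
  ((a i).2 < -1)%R -> ((b i).2 < -1)%R -> ge a b = rho i k.
Proof.
move=> sa ga gb sab fab /andP[ak kb] labl a2 b2.
have hP := P_height; have hg := gap_gt0.
pose a' : V := fun x => ((a x).1, if x == i then -2 else 2)%R.
pose b' : V := fun x => ((b x).1, if x == i then -2 else 2)%R.
have ng : (`|- gap| <= gap *+ 2)%R by rewrite normrN gtr0_norm //; lra.
have pg : (`|gap| <= gap *+ 2)%R by rewrite gtr0_norm //; lra.
have gng : (0 < `|- gap| <= gap *+ 2)%R by rewrite ng normrN gtr0_norm ?hg.
have gpg : (0 < `|gap| <= gap *+ 2)%R by rewrite pg gtr0_norm ?hg.
have pole2 u x : (pole i k u x).2 = (if x == i then -2 else 2)%R.
  by rewrite /pole -val_eqE; case: ltngtP.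
have polei u : (pole i k u i).1 = ((P k).1 + u)%R by rewrite /pole ltnn eqxx.
transitivity (ge a' b').
  apply: (@ge_quad (In4 a b a' b')); rewrite /In4; try tauto.
  - apply: coherent_lt => [x y xy|x l].
      by exists East => ? [->|[->|[->|->]]] //=; rewrite -?sab sa.
    have := hP l => hl; have [->|xi] := eqVneq x i.
      by exists North => ? [->|[->|[->|->]]] /=; rewrite ?eqxx; lra.
    have [ss|[h1 h2]] := fab x xi.
      by case: (strip_dir ga ss (gb.2 x l)) => /andP[h1 h2];
        [exists East | exists West] => ? [->|[->|[->|->]]].
    by exists South => ? [->|[->|[->|->]]] /=; rewrite ?(negPf xi); lra.
  - by apply: ge_triv => // x; left.
  - by apply: ge_triv => // x; left.
apply: (@ge_quad (In4 a' b' (pole i k (- gap)%R) (pole i k gap)));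
  rewrite /In4; try tauto.
- apply: coherent_lt => [x y xy|x l].
    exists East => ? [->|[->|[->|->]]] /=; rewrite -?sab ?sa //.
      by rewrite sorted_pole.
    by rewrite sorted_pole.
  have := hP l => hl; have [->|xi] := eqVneq x i.
    by exists North => ? [->|[->|[->|->]]] /=; rewrite ?pole2 ?eqxx; lra.
  by exists South => ? [->|[->|[->|->]]] /=; rewrite ?pole2 ?(negPf xi); lra.
- apply: ge_triv => //; first exact: generic_pole.
  + by move=> x y /=; rewrite sa sorted_pole.
  + move=> x; have [->|xi] := eqVneq x i.
      left=> l; rewrite polei /=.
      have [->|lk] := eqVneq l k; first by rewrite ak; apply/esym; lra.
      have [h|h] := P_gap lk.
        rewrite labl //; apply/idP/idP; lra.
      by apply/idP/idP; lra.
    by right; rewrite pole2 /= (negPf xi); split; lra.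
- apply: ge_triv => //; first exact: generic_pole.
  + by move=> x y /=; rewrite -sab sa sorted_pole.
  + move=> x; have [->|xi] := eqVneq x i.
      left=> l; rewrite polei /=.
      have [->|lk] := eqVneq l k; first by apply/idP/idP; lra.
      have [h|h] := P_gap lk; first by apply/idP/idP; lra.
      by rewrite -labl //; apply/idP/idP; lra.
    by right; rewrite pole2 /= (negPf xi); split; lra.
Qed.

Lemma ge_rho a b i k : generic P a -> generic P b ->
  same_order a b -> (forall x, x != i -> free_strip a b x) ->
  ((a i).1 < (P k).1 < (b i).1)%R ->
  (forall l, l != k -> ((a i).1 < (P l).1)%R = ((b i).1 < (P l).1)%R) ->
  ((a i).2 < -1)%R -> ((b i).2 < -1)%R -> ge a b = rho (rk a i) k.
Proof.
move=> ga gb sab fab akb labl a2 b2; have [s sa] := sort_conf ga.1.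
rewrite -(ge_relabel s) -(permKV s i) -rk_relabel sorted_rk //.
apply: ge_rho_sorted => //; rewrite /relabel ?permKV //; try exact: generic_relabel.
by move=> x; rewrite -(inj_eq (@perm_inj _ s)) permKV => /fab.
Qed.

End Cocycle.

(** * Braid relations *)

Local Open Scope ring_scope.
Local Open Scope group_scope.

Lemma rk_perm (R : realFieldType) m (s : 'S_m) (b : 'I_m -> R * R) x :
  (forall x y, ((b x).1 < (b y).1)%R = (s x < s y)%N) -> rk b x = s x.
Proof.
move=> h; rewrite -{1}(permK s x) -rk_relabel sorted_rk // => y z.
by rewrite /relabel h !permKV.
Qed.

Lemma tperm_swap m (p q : 'I_m) : q = p.+1 :> nat ->
  forall x, tperm p q x = swap p x :> nat.
Proof.
move=> qp x; rewrite /swap -qp; case: tpermP => [->|->|/eqP xp /eqP xq].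
- by rewrite eqxx.
- by rewrite ifF ?eqxx //; apply/eqP; lia.
by rewrite !val_eqE (negPf xp) (negPf xq).
Qed.

Lemma sorted_lt (R : realFieldType) m (a : 'I_m -> R * R) :
  (forall i j : 'I_m, (i < j)%N -> ((a i).1 < (a j).1)%R) -> sorted_conf a.
Proof.
move=> h i j; apply/idP/idP => [|/h//]; rewrite ltNge => /negP nle.
rewrite ltnNge leq_eqVlt; apply/negP => /orP[/eqP/ord_inj ji|/h/ltW//].
by case: nle; rewrite ji.
Qed.

Lemma sorted_generic (R : realFieldType) m N (P : 'I_N -> R * R)
    (a : 'I_m -> R * R) : sorted_conf a ->
  (forall i k, (a i).1 != (P k).1) -> generic P a.
Proof.
move=> sa h; split=> // i j; rewrite neq_ltn -!sa.
by case/orP=> [/lt_eqF->|/gt_eqF->].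
Qed.

Section Relations.
Variables (R : realFieldType) (m N : nat) (P : 'I_N -> R * R).
Local Notation V := ('I_m -> R * R).
Hypothesis P_height : forall k, (-1 < (P k).2 < 1)%R.
Variables (x0 x1 gap : R).
Hypothesis gap_gt0 : (0 < gap)%R.
Hypothesis x0_left : forall k, (x0 + m%:R + gap *+ 4 < (P k).1)%R.
Hypothesis x1_right : forall k, ((P k).1 + gap *+ 4 < x1)%R.
Hypothesis P_gap : forall k l : 'I_N, k != l ->
  ((P k).1 + gap *+ 4 < (P l).1)%R \/ ((P l).1 + gap *+ 4 < (P k).1)%R.

Variables (B : groupType) (e : V -> V -> B).
Hypothesis e_relabel : forall s a b, e (relabel s a) (relabel s b) = e a b.
Hypothesis e_coherent : forall A, coherent P A ->
  forall a b c, A a -> A b -> A c -> e a b * e b c = e a c.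

Local Notation ge := (ge x0 e).
Local Notation sig := (sig x0 e).
Local Notation rho := (rho P x0 x1 gap e).
Let geC := ge_coherent x0 e_coherent.
Let geV := geV x0 e_coherent.
Let ge_triv := ge_triv P_height x0 e_coherent.
Let ge_sig := ge_sig P_height gap_gt0 x0_left e_relabel e_coherent.
Let ge_rho := ge_rho P_height gap_gt0 x0_left x1_right P_gap e_relabel e_coherent.
Let left_of_P := left_of_P gap_gt0 x0_left.

(** Strand j is above strand i whenever i < j, whatever the permutation, so all ladders form a
    single coherent family. The motions from [ladder 1] are the positive permutation braids. *)
Let ladder (s : 'S_m) : V := line x0 (fun i => s i) (fun i => 2 + i%:R)%R.

Let rising (x : V) := exists s, x = ladder s.

Let rising_coherent : coherent P rising.
Proof.
apply: coherent_lt => [i j ij|i k].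
  by exists North => _ [s ->]; rewrite /= ltrD2l ltr_nat.
exists South => _ [s ->] /=; have := P_height k.
have : (0 <= i%:R :> R)%R by rewrite ler0n.
by lra.
Qed.

Let ge_ladder (s : 'S_m) (p q i j : 'I_m) : q = p.+1 :> nat ->
  s i = p -> s j = q -> (i < j)%N ->
  ge (ladder s) (ladder (s * tperm p q)) = sig p.
Proof.
move=> qp sip sjq ij.
have pq : p != q by rewrite -val_eqE /= qp; apply/eqP; lia.
have <- : rk (ladder s) i = p.
  by rewrite (@rk_perm _ _ s) ?sip // => x y; rewrite ltrD2l ltr_nat.
have gl t : generic P (ladder t).
  apply: (generic_line gap_gt0 x0_left) => // x y /ord_inj; exact: perm_inj.
apply: (@ge_sig _ _ _ j) => //; last first.
  by move=> x; right; split=> /=; have := ler0n R x; lra.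
split; rewrite /= ?ltrD2l ?ltr_nat ?permM ?sip ?sjq ?tpermL ?tpermR ?qp //.
have E0 (z t : 'I_m) : (z == t) = (s z == s t) by rewrite (inj_eq perm_inj).
move=> x y; rewrite (E0 x i) (E0 y j) (E0 x j) (E0 y i) sip sjq !ltrD2l !ltr_nat !permM.
move: (s x) (s y) => {}x {}y n1 n2.
by rewrite !(tperm_swap qp) swap_ltn // -?qp !val_eqE.
Qed.

Lemma sig_far (p q p' q' : 'I_m) : q = p.+1 :> nat -> q' = p'.+1 :> nat ->
  (q < p')%N -> sig p * sig p' = sig p' * sig p.
Proof.
move=> qp qp' far.
have n1 : p' != p by rewrite -val_eqE /=; apply/eqP; lia.
have n2 : p' != q by rewrite -val_eqE /=; apply/eqP; lia.
have n3 : q' != p by rewrite -val_eqE /=; apply/eqP; lia.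
have n4 : q' != q by rewrite -val_eqE /=; apply/eqP; lia.
have [n1' n2' n3' n4'] : [/\ p != p', q != p', p != q' & q != q'].
  by rewrite ![_ == p']eq_sym ![_ == q']eq_sym n1 n2 n3 n4.
have pq : (p < q)%N by lia.
have pq' : (p' < q')%N by lia.
have C : tperm p q * tperm p' q' = tperm p' q' * tperm p q.
  by rewrite conjgC tpermJ !tpermD.
have r1 s : rising (ladder s) by exists s.
have h1 := @ge_ladder 1 p q p q qp (perm1 p) (perm1 q) pq.
have h2 := @ge_ladder (tperm p q) p' q' p' q' qp' (tpermD n1' n2') (tpermD n3' n4') pq'.
have h3 := @ge_ladder 1 p' q' p' q' qp' (perm1 p') (perm1 q') pq'.
have h4 := @ge_ladder (tperm p' q') p q p q qp (tpermD n1 n3) (tpermD n2 n4) pq.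
rewrite -[in LHS]h1 -[in LHS]h2 -[in RHS]h3 -[in RHS]h4.
by rewrite !mul1g !(geC rising_coherent) // C.
Qed.

(** Both sides are words for the transposition of p and r in which no pair is exchanged twice, hence
    two chains from [ladder 1] to the same ladder. *)
Lemma sig_braid (p q r : 'I_m) : q = p.+1 :> nat -> r = q.+1 :> nat ->
  sig p * sig q * sig p = sig q * sig p * sig q.
Proof.
move=> qp rq.
have pq : p != q by rewrite -val_eqE /=; apply/eqP; lia.
have qr : q != r by rewrite -val_eqE /=; apply/eqP; lia.
have pr : p != r by rewrite -val_eqE /=; apply/eqP; lia.
have C : tperm p q * tperm q r * tperm p q = tperm q r * tperm p q * tperm q r.
  rewrite -{1}(tpermV p q) -{2}(tpermV q r) -!mulgA -!conjgE !tpermJ.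
  by rewrite !tpermR !tpermL !tpermD // eq_sym.
have r1 s : rising (ladder s) by exists s.
have lpq : (p < q)%N by lia.
have lqr : (q < r)%N by lia.
have lpr : (p < r)%N by lia.
have rp : r != p by rewrite eq_sym.
have qp' : q != p by rewrite eq_sym.
have rq' : r != q by rewrite eq_sym.
have h1 := @ge_ladder 1 p q p q qp (perm1 p) (perm1 q) lpq.
have h2 := @ge_ladder (tperm p q) q r p r rq (tpermL _ _) (tpermD pr qr) lpr.
have h3 : ge (ladder (tperm p q * tperm q r))
    (ladder (tperm p q * tperm q r * tperm p q)) = sig p.
  apply: (@ge_ladder _ p q q r) => //; rewrite permM.
    by rewrite tpermR tpermD.
  by rewrite [tperm p q r]tpermD // tpermR.
have h4 := @ge_ladder 1 q r q r rq (perm1 q) (perm1 r) lqr.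
have h5 := @ge_ladder (tperm q r) p q p r qp (tpermD qp' rp) (tpermR _ _) lpr.
have h6 : ge (ladder (tperm q r * tperm p q))
    (ladder (tperm q r * tperm p q * tperm q r)) = sig q.
  apply: (@ge_ladder _ q r p q) => //; rewrite permM.
    by rewrite [tperm q r p]tpermD // tpermL.
  by rewrite tpermL tpermD.
rewrite -[X in X * _ * _ = _]h1 -[X in _ * X * _ = _]h2 -[X in _ * _ * X = _]h3.
rewrite -[X in _ = X * _ * _]h4 -[X in _ = _ * X * _]h5 -[X in _ = _ * _ * X]h6.
by rewrite !mul1g !(geC rising_coherent) // C.
Qed.

Let P_side k l u v : (`|u| <= gap *+ 2)%R -> (`|v| <= gap *+ 2)%R ->
  l != k \/ (u < 0)%R = (v < 0)%R ->
  ((P k).1 + u < (P l).1)%R = ((P k).1 + v < (P l).1)%R.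
Proof.
have hg := gap_gt0; rewrite !ler_norml => /andP[u1 u2] /andP[v1 v2].
have [->|/P_gap lk _] := eqVneq l k.
  by case=> // uv; rewrite -![(_ + _ < _)%R]subr_gt0 !opprD !addNKr !oppr_gt0.
by case: lk => lk; apply/idP/idP; lra.
Qed.

Let P_off k l u : (0 < `|u| <= gap *+ 2)%R -> ((P k).1 + u)%R != (P l).1.
Proof.
have hg := gap_gt0; move=> /andP[u0]; rewrite ler_norml => /andP[u1 u2].
have [->|/P_gap lk] := eqVneq l k.
  by rewrite -subr_eq0 addrAC subrr add0r -normr_gt0.
by rewrite neq_lt; case: lk => lk; apply/orP; [right|left]; lra.
Qed.

Let window (z : R * R) := (x0 + m%:R < z.1 < x1)%R.

Let window_P k u t : (`|u| <= gap *+ 2)%R -> window ((P k).1 + u, t)%R.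
Proof.
rewrite ler_norml /window /= => /andP[u1 u2].
have := gap_gt0; have := x0_left k; have := x1_right k.
by move=> *; apply/andP; split; lra.
Qed.

Let right_of_P (x : nat) k : (x1 + x%:R)%R != (P k).1.
Proof.
have := x1_right k; have := gap_gt0; have := ler0n R x.
by move=> *; rewrite gt_eqF //; lra.
Qed.

(** Two neighbouring strands are active; the others wait at height 2 outside the window that
    contains the punctures. *)
Let two (i : 'I_m) (z z' : R * R) : V := fun x =>
  if (x < i)%N then (x0 + x%:R, 2)%R else if x == i :> nat then z
  else if x == i.+1 :> nat then z' else (x1 + x%:R, 2)%R.

Let two_lt (i : 'I_m) z z' (x y : 'I_m) : window z -> window z' -> (x < y)%N ->
  ~~ ((x == i :> nat) && (y == i.+1 :> nat)) ->
  ((two i z z' x).1 < (two i z z' y).1)%R.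
Proof.
move=> /andP[z1 z2] /andP[z1' z2'] xy nxy.
have hx : (x%:R < y%:R :> R)%R by rewrite ltr_nat.
have hy : (y%:R <= m%:R :> R)%R by rewrite ler_nat ltnW.
have x0' := ler0n R x.
rewrite /two; case: (ltngtP x i) nxy => xi; case: (ltngtP y i) => yi;
  try (by exfalso; clear -xy xi yi; lia); case: eqP => yi1;
  try case: eqP => xi1; rewrite //= => _;
  try (by exfalso; clear -xy xi yi xi1 yi1; lia);
  lra.
Qed.

Let two_sorted (i : 'I_m) z z' : window z -> window z' -> (z.1 < z'.1)%R ->
  sorted_conf (two i z z').
Proof.
move=> hz hz' zz'; apply: sorted_lt => x y xy.
have [/andP[/eqP xi /eqP yi]|] :=
  boolP ((x == i :> nat) && (y == i.+1 :> nat)); last exact: two_lt.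
rewrite /two xi yi ltnn eqxx ltnNge leqnSn /= eqxx ifF //.
by apply/eqP; lia.
Qed.

(** With strand i at height -2 and strand j at height 2, all horizontal motions of the two form one
    coherent family. To get from offsets (-2 gap, -gap) to (gap, 2 gap), either j moves away over
    the puncture and i crosses as first of the two, or they exchange places, the low one crosses as
    second, and they exchange back. *)
Lemma rho_sig (i j : 'I_m) k : j = i.+1 :> nat ->
  rho i k = sig i * rho j k * (sig i)^-1.
Proof.
move=> ji; have hg := gap_gt0.
pose T u v := two i ((P k).1 + u, -2)%R ((P k).1 + v, 2)%R.
(* Both strands stand beside the same puncture, so two offsets are used on each side: [gap] and
   [gap *+ 2]. *)
pose ok (u : R) := (0 < `|u| <= gap *+ 2)%R.
have okW u : ok u -> (`|u| <= gap *+ 2)%R by move=> /andP[].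
have o1 : ok gap by rewrite /ok gtr0_norm // hg; lra.
have o2 : ok (gap *+ 2)%R by rewrite /ok gtr0_norm; lra.
have o1' : ok (- gap)%R by rewrite /ok normrN.
have o2' : ok (- (gap *+ 2))%R by rewrite /ok normrN.
have sT u v : ok u -> ok v -> (u < v)%R -> sorted_conf (T u v).
  move=> hu hv uv; apply: two_sorted; try (by apply: window_P; exact: okW).
  by rewrite ltrD2l.
have Ti u v : T u v i = ((P k).1 + u, -2)%R by rewrite /T /two ltnn eqxx.
have Tj u v : T u v j = ((P k).1 + v, 2)%R.
  by rewrite /T /two ji ltnNge leqnSn /= eqxx ifF //; apply/eqP; lia.
have ij : i != j by rewrite -val_eqE /= ji; apply/eqP; lia.
have T2 u v x : x != i -> (T u v x).2 = 2%R.
  by rewrite /T /two -val_eqE /=; case: ltngtP => //; case: eqP.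
have TP u v x l : ok u -> ok v -> (T u v x).1 != (P l).1.
  move=> hu hv; rewrite /T /two; case: ltngtP => _ /=; last exact: P_off.
    by rewrite lt_eqF // left_of_P.
  by case: ifP => _ /=; [exact: P_off | exact: right_of_P].
have Tt u v x : (T u v x).1 = (T v u (tperm i j x)).1.
  case: tpermP => [->|->|/eqP xi /eqP xj]; rewrite ?Ti ?Tj //.
  by rewrite /T /two -ji !val_eqE (negPf xi) (negPf xj).
have oT u v : ok u -> ok v -> (v < u)%R -> forall x y,
    ((T u v x).1 < (T u v y).1)%R = (tperm i j x < tperm i j y)%N.
  by move=> hu hv vu x y; rewrite !(Tt u v) sT.
have gT u v : ok u -> ok v -> u != v -> generic P (T u v).
  move=> hu hv huv; split=> [x y xy|x l]; last exact: TP.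
  move: huv; rewrite neq_lt => /orP[uv|vu].
    by apply: (@sorted_generic _ _ _ P _ (sT _ _ hu hv uv) _).1 => // ? ?; exact: TP.
  by rewrite (Tt u) (Tt u v y); apply: (@sorted_generic _ _ _ P _ (sT _ _ hv hu vu) _).1;
    [move=> ? ?; exact: TP | rewrite (inj_eq perm_inj)].
pose A x := exists u v, [/\ ok u, ok v & x = T u v].
have AT u v : ok u -> ok v -> A (T u v) by exists u, v.
have cA : coherent P A.
  apply: coherent_lt => [x y xy|x l].
    have [/andP[/eqP xi /eqP yj]|nxy] := boolP ((x == i) && (y == j)).
      by exists North => _ [u [v [_ _ ->]]]; rewrite xi yj Ti Tj /=; lra.
    exists East => _ [u [v [/okW hu /okW hv ->]]]; apply: two_lt => //; try exact: window_P.
    by rewrite -ji !val_eqE.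
  have := P_height l; have [->|xi] := eqVneq x i.
    by exists North => _ [u [v [_ _ ->]]]; rewrite Ti /=; lra.
  by exists South => _ [u [v [_ _ ->]]]; rewrite /= T2 //; lra.
have free u v u' v' x : ok u -> ok v -> ok u' -> ok v' ->
    x != i \/ (u < 0)%R = (u' < 0)%R -> free_strip P (T u v) (T u' v') x.
  move=> hu hv hu' hv'; have [->|xi _] := eqVneq x i.
    by case=> // uu'; left=> l; rewrite !Ti; apply: P_side; [exact: okW..|right].
  by right; rewrite !T2 //; split; lra.
have sw u v u' v' : ok u -> ok v -> ok u' -> ok v' -> (u < v)%R -> (v' < u')%R ->
    (u < 0)%R = (u' < 0)%R -> ge (T u v) (T u' v') = sig i.
  move=> hu hv hu' hv' uv vu' uu'.
  rewrite -(sorted_rk i (sT _ _ hu hv uv)).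
  apply: (@ge_sig _ _ _ j); first by apply: gT => //; rewrite lt_eqF.
  - by apply: gT => //; rewrite gt_eqF.
  - split; try by rewrite Ti Tj /= ?ltrD2l //; lra.
    move=> x y; rewrite sT // oT // !(tperm_swap ji) -!val_eqE /= ji => n1 n2.
    by rewrite swap_ltn.
  - by move=> x; apply: free => //; right.
have mv u v u' v' : ok u -> ok v -> ok u' -> ok v' -> (u < 0 < u')%R ->
    (u < v)%R = (u' < v')%R -> u != v -> u' != v' ->
    ge (T u v) (T u' v') = rho (if u < v then i else j)%R k.
  move=> hu hv hu' hv' /andP[u0 u0'] E nuv nuv'.
  have sot : same_order (T u v) (T u' v').
    move: nuv nuv'; rewrite !neq_lt -E => /orP[uv _|vu]; last first.
      have -> : (u < v)%R = false by rewrite ltNge ltW.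
      by move=> /= vu' x y; rewrite !oT.
    by move=> x y; rewrite !sT // -E.
  have -> : (if u < v then i else j)%R = rk (T u v) i :> nat.
    move: nuv; rewrite neq_lt => /orP[uv|vu]; first by rewrite uv sorted_rk //; exact: sT.
    have -> : (u < v)%R = false by rewrite ltNge ltW.
    by rewrite (rk_perm _ (oT _ _ hu hv vu)) tpermL.
  apply: ge_rho; rewrite ?Ti /=.
  - exact: gT.
  - exact: gT.
  - exact: sot.
  - by move=> x xi; apply: free => //; left.
  - by apply/andP; split; lra.
  - by move=> l lk; apply: P_side; [exact: okW..|left].
  - by lra.
  - by lra.
have g0 : (- gap < 0)%R by lra.
have e1 : ge (T (- (gap *+ 2)) (- gap))%R (T (- gap) (- (gap *+ 2)))%R = sig i.
  by apply: sw => //; lra.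
have n1 : (- gap < - (gap *+ 2))%R = false by apply/negbTE; rewrite -leNgt; lra.
have n2 : (gap < - (gap *+ 2))%R = false by apply/negbTE; rewrite -leNgt; lra.
have l1 : (- (gap *+ 2) < - gap)%R by lra.
have l2 : (- (gap *+ 2) < gap)%R by lra.
have l3 : (- (gap *+ 2) < gap *+ 2)%R by lra.
have l4 : (gap < gap *+ 2)%R by lra.
have e2 : ge (T (- gap) (- (gap *+ 2)))%R (T gap (- (gap *+ 2)))%R = rho j k.
  rewrite mv // ?n1 ?n2 //; first by apply/andP; split; lra.
    by rewrite gt_eqF.
  by rewrite gt_eqF.
have e3 : ge (T gap (gap *+ 2))%R (T gap (- (gap *+ 2)))%R = sig i.
  exact: sw.
have e4 : ge (T (- (gap *+ 2)) (- gap))%R (T (- (gap *+ 2)) (gap *+ 2))%R = 1.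
  apply: ge_triv; try by apply: gT; rewrite ?lt_eqF.
  - by move=> x y; rewrite !sT.
  - by move=> x; apply: free => //; right.
have e5 : ge (T (- (gap *+ 2)) (gap *+ 2))%R (T gap (gap *+ 2))%R = rho i k.
  rewrite mv // ?l3 ?l4 //; first by apply/andP; split; lra.
    by rewrite lt_eqF.
  by rewrite lt_eqF.
rewrite -e5 -[LHS]mul1g -e4 (geC cA (AT _ _ o2' o1') (AT _ _ o2' o2) (AT _ _ o1 o2)).
rewrite -(geC cA (AT _ _ o2' o1') (AT _ _ o1' o2') (AT _ _ o1 o2)) e1.
rewrite -(geC cA (AT _ _ o1' o2') (AT _ _ o1 o2') (AT _ _ o1 o2)) e2.
by rewrite (geV cA (AT _ _ o1 o2) (AT _ _ o1 o2')) e3 mulgA.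
Qed.

(** Both strands are low, i beside puncture k and j beside puncture l further right. They move
    independently, so the two products are the two ways around one square; the order of the
    punctures keeps every corner sorted. *)
Lemma rho_rho (i j : 'I_m) (k l : 'I_N) : j = i.+1 :> nat -> ((P k).1 < (P l).1)%R ->
  rho i k * rho j l = rho j l * rho i k.
Proof.
move=> ji kl; have hg := gap_gt0.
have nkl : k != l by apply: contraTneq kl => ->; rewrite ltxx.
have kl' : ((P k).1 + gap *+ 4 < (P l).1)%R by case: (P_gap nkl); lra.
pose T u v := two i ((P k).1 + u, -2)%R ((P l).1 + v, -2)%R.
pose ok (u : R) := (0 < `|u| <= gap)%R.
have okW u : ok u -> (`|u| <= gap *+ 2)%R by move=> /andP[]; lra.
have okW' u : ok u -> (0 < `|u| <= gap *+ 2)%R by move=> /andP[-> ?] /=; lra.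
have o1 : ok gap by rewrite /ok gtr0_norm // hg; lra.
have o1' : ok (- gap)%R by rewrite /ok normrN.
have sT u v : ok u -> ok v -> sorted_conf (T u v).
  move=> hu hv; apply: two_sorted; try (by apply: window_P; exact: okW).
  move: hu hv => /andP[_]; rewrite ler_norml => /andP[_ u1] /andP[_].
  by rewrite ler_norml => /andP[v1 _] /=; lra.
have Ti u v : T u v i = ((P k).1 + u, -2)%R by rewrite /T /two ltnn eqxx.
have Tj u v : T u v j = ((P l).1 + v, -2)%R.
  by rewrite /T /two ji ltnNge leqnSn /= eqxx ifF //; apply/eqP; lia.
have ij : i != j by rewrite -val_eqE /= ji; apply/eqP; lia.
have T2 u v x : x != i -> x != j -> (T u v x).2 = 2%R.
  by rewrite /T /two -!val_eqE /= ji; case: ltngtP => //; case: eqP.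
have gT u v : ok u -> ok v -> generic P (T u v).
  move=> hu hv; apply: sorted_generic; first exact: sT.
  move=> x l'; rewrite /T /two; case: ltngtP => _ /=; last by apply: P_off; exact: okW'.
    by rewrite lt_eqF // left_of_P.
  by case: ifP => _ /=; [apply: P_off; exact: okW' | exact: right_of_P].
pose A x := exists u v, [/\ ok u, ok v & x = T u v].
have AT u v : ok u -> ok v -> A (T u v) by exists u, v.
have cA : coherent P A.
  apply: coherent_lt => [x y xy|x k'].
    by exists East => _ [u [v [hu hv ->]]]; rewrite /= sT.
  have := P_height k'; have [->|xi] := eqVneq x i.
    by exists North => _ [u [v [_ _ ->]]]; rewrite Ti /=; lra.
  have [->|xj] := eqVneq x j.
    by exists North => _ [u [v [_ _ ->]]]; rewrite Tj /=; lra.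
  by exists South => _ [u [v [_ _ ->]]]; rewrite /= T2 //; lra.
have free u v u' v' x : ok u -> ok v -> ok u' -> ok v' ->
    x != i \/ u = u' -> x != j \/ v = v' -> free_strip P (T u v) (T u' v') x.
  move=> hu hv hu' hv'; have [->|xi _] := eqVneq x i.
    by case=> // <- _; left=> l'; rewrite !Ti.
  have [->|xj _] := eqVneq x j; first by case=> // <-; left=> l'; rewrite !Tj.
  by right; rewrite !T2 //; split; lra.
have cross : (0 < gap)%R && (- gap < 0)%R by apply/andP; split; lra.
have e1 v : ok v -> ge (T (- gap) v)%R (T gap v) = rho i k.
  move=> hv; rewrite -(sorted_rk i (sT _ _ o1' hv)).
  apply: ge_rho; rewrite ?Ti /=.
  - exact: gT.
  - exact: gT.
  - by move=> x y; rewrite !sT.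
  - by move=> x xi; apply: free => //; [left|right].
  - by apply/andP; split; lra.
  - by move=> l' lk; apply: P_side; [exact: okW..|left].
  - by lra.
  - by lra.
have e2 u : ok u -> ge (T u (- gap)%R) (T u gap) = rho j l.
  move=> hu; rewrite -(sorted_rk j (sT _ _ hu o1')).
  apply: ge_rho; rewrite ?Tj /=.
  - exact: gT.
  - exact: gT.
  - by move=> x y; rewrite !sT.
  - by move=> x xi; apply: free => //; [right|left].
  - by apply/andP; split; lra.
  - by move=> l' lk; apply: P_side; [exact: okW..|left].
  - by lra.
  - by lra.
rewrite -[in LHS](e1 _ o1') -[in LHS](e2 _ o1) -[in RHS](e2 _ o1') -[in RHS](e1 _ o1).
by rewrite !(geC cA) //; exact: AT.
Qed.

(** The exchange takes place above height 1 and on one side of the window, out of reach of strand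
    i. *)
Lemma rho_sig_far (i p q : 'I_m) k : q = p.+1 :> nat -> p != i -> q != i ->
  rho i k * sig p = sig p * rho i k.
Proof.
move=> qp pi qi; have hg := gap_gt0.
pose T u (s : 'S_m) : V := fun x => if x == i then ((P k).1 + u, -2)%R else
  ((if (x < i)%N then x0 else x1) + (s x)%:R, bump R p x)%R.
pose t := tperm p q.
pose ok (u : R) := (0 < `|u| <= gap)%R.
have okW u : ok u -> (`|u| <= gap *+ 2)%R by move=> /andP[]; lra.
have okW' u : ok u -> (0 < `|u| <= gap *+ 2)%R by move=> /andP[-> ?] /=; lra.
have o1 : ok gap by rewrite /ok gtr0_norm // hg; lra.
have o1' : ok (- gap)%R by rewrite /ok normrN.
have s1 u : ok u -> sorted_conf (T u 1).
  move=> hu; apply: sorted_lt => x y xy.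
  have := okW _ hu; rewrite ler_norml => /andP[u1 u2].
  have hx : (x%:R < y%:R :> R)%R by rewrite ltr_nat.
  have hy : (y%:R <= m%:R :> R)%R by rewrite ler_nat ltnW.
  have := x0_left k; have := x1_right k; have x0' := ler0n R x.
  rewrite /T !perm1 -!(inj_eq (@ord_inj m)).
  case: (ltngtP x i) => xi; case: (ltngtP y i) => yi /=;
    try (by exfalso; clear -xy xi yi; lia); lra.
have ti : t i = i by rewrite tpermD.
have tE := tperm_swap qp.
have t_side (x : 'I_m) : (t x < i)%N = (x < i)%N.
  have npi : nat_of_ord p <> i by move=> /ord_inj pi'; rewrite pi' eqxx in pi.
  have nqi : nat_of_ord q <> i by move=> /ord_inj qi'; rewrite qi' eqxx in qi.
  rewrite /t tE /swap; clear -npi nqi qp.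
  by case: eqP => [->|_]; [|case: eqP => [->|_]] => //; lia.
have Tt u x : (T u t x).1 = (T u 1 (t x)).1.
  have tx : (t x == i) = (x == i) by rewrite -{1}ti (inj_eq perm_inj).
  rewrite /T perm1 t_side tx.
  by case: ifP.
have st u x y : ok u -> ((T u t x).1 < (T u t y).1)%R = (t x < t y)%N.
  by move=> hu; rewrite !Tt s1.
have Ti u s : T u s i = ((P k).1 + u, -2)%R by rewrite /T eqxx.
have T2 u s x : x != i -> (T u s x).2 = bump R p x by rewrite /T => /negPf ->.
have off u x l : ok u -> (T u 1 x).1 != (P l).1.
  move=> hu; rewrite /T perm1; case: ifP => _ /=; first by apply: P_off; exact: okW'.
  by case: ifP => _; [rewrite lt_eqF // left_of_P | exact: right_of_P].
have g1 u : ok u -> generic P (T u 1).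
  move=> hu; apply: sorted_generic; first exact: s1.
  by move=> x l; exact: off.
have gt u : ok u -> generic P (T u t).
  move=> hu; split=> [x y xy|x l]; last by rewrite Tt off.
  by rewrite !Tt; apply: (g1 _ hu).1; rewrite (inj_eq perm_inj).
pose A x := exists u s, [/\ ok u, s = 1 \/ s = t & x = T u s].
have A1 u : ok u -> A (T u 1) by exists u, 1; split=> //; left.
have At u : ok u -> A (T u t) by exists u, t; split=> //; right.
have pltq : (bump R p p < bump R p q)%R.
  by rewrite /bump -qp eqxx ifF; [lra | apply/eqP; lia].
have swP (x y : 'I_m) : ~~ ((x == p) && (y == q)) -> ~~ ((x == q) && (y == p)) ->
    (t x < t y)%N = (x < y)%N.
  by rewrite /t !tE -!(inj_eq (@ord_inj m)) qp => *; rewrite swap_ltn.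
have cA : coherent P A.
  apply: coherent_lt => [x y xy|x k'].
    have [/andP[/eqP-> /eqP->]|nxy] := boolP ((x == p) && (y == q)).
      by exists North => _ [u [s [hu _ ->]]] /=; rewrite !T2.
    exists East => _ [u [s [hu [] -> ->]]]; rewrite /= ?s1 ?st // swP //.
    by apply/negP => /andP[/eqP xq /eqP yp]; move: xy; rewrite xq yp qp; lia.
  have := P_height k'; have [->|xi] := eqVneq x i.
    by exists North => _ [u [s [_ _ ->]]]; rewrite Ti /=; lra.
  by exists South => _ [u [s [_ _ ->]]]; rewrite /= T2 //; have := bump_gt1 R p x; lra.
have free u u' s s' x : x != i \/ u = u' -> free_strip P (T u s) (T u' s') x.
  have [->|xi _] := eqVneq x i; first by case=> // <-; left=> l; rewrite !Ti.
  by right; rewrite !T2 //; split; exact: bump_gt1.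
have esig u : ok u -> ge (T u 1) (T u t) = sig p.
  move=> hu; rewrite -(sorted_rk p (s1 _ hu)).
  apply: (@ge_sig _ _ _ q); [exact: g1|exact: gt| |by move=> x; apply: free; right].
  split; rewrite ?s1 ?st ?T2 // /t ?tpermL ?tpermR ?qp //.
  by move=> x y n1 n2; rewrite s1 // st // swP.
have erho s : s = 1 \/ s = t -> ge (T (- gap)%R s) (T gap s) = rho i k.
  move=> hs; have -> : nat_of_ord i = rk (T (- gap)%R s) i.
    case: hs => ->; first by rewrite sorted_rk //; exact: s1.
    by rewrite (@rk_perm _ _ t) ?ti // => x y; rewrite st.
  apply: ge_rho; rewrite ?Ti /=.
  - by case: hs => ->; [exact: g1 | exact: gt].
  - by case: hs => ->; [exact: g1 | exact: gt].
  - by case: hs => -> x y; rewrite ?s1 ?st.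
  - by move=> x xi; apply: free; left.
  - by apply/andP; split; lra.
  - by move=> l lk; apply: P_side; [exact: okW..|left].
  - by lra.
  - by lra.
rewrite -[in LHS](erho 1) -?[in LHS](esig _ o1) -?[in RHS](esig _ o1') -?[in RHS](erho t);
  try by [left|right].
by rewrite !(geC cA) //; by [exact: A1 | exact: At].
Qed.

End Relations.

(** * Boxes around a configuration *)

Local Open Scope ring_scope.
Local Open Scope group_scope.

(** Source of the small constants. It also serves to avoid values: a positive number below every
    positive member of a list is not in the list. *)
Lemma small_pos (R : realFieldType) (s : seq R) (d : R) : (0 < d)%R ->
  exists2 x, (0 < x < d)%R & forall y, y \in s -> (0 < y)%R -> (x < y)%R.
Proof.
move=> d0; elim: s => [|y s [x /andP[x0 xd] hx]].
  by exists (d / 2)%R => //; apply/andP; split; lra.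
have [y0|y0] := ltP 0%R y; last first.
  exists x; first by rewrite x0.
  by move=> z; rewrite inE => /orP[/eqP->|/hx//]; rewrite ltNge y0.
have [xy|yx] := ltP x y.
  exists x; first by rewrite x0.
  by move=> z; rewrite inE => /orP[/eqP->|/hx].
exists (y / 2)%R; first by apply/andP; split; lra.
move=> z; rewrite inE => /orP[/eqP-> _|/hx h /h]; lra.
Qed.

Section Boxes.
Variables (R : realFieldType) (m N : nat) (P : 'I_N -> R * R).
Local Notation V := ('I_m -> R * R).

Definition box (c : V) (r : R) (y : V) : Prop := forall i,
  (`|(y i).1 - (c i).1| < r /\ `|(y i).2 - (c i).2| < r)%R.

(** Twice the radius, since both points of a pair may move by r. *)
Definition clear_radius (c : V) (r : R) : Prop :=
  [/\ (0 < r)%R,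
      forall i j, i != j -> (r *+ 2 <= `|(c i).1 - (c j).1| \/
        r *+ 2 <= `|(c i).2 - (c j).2|)%R &
      forall i k, (r *+ 2 <= `|(c i).1 - (P k).1| \/
        r *+ 2 <= `|(c i).2 - (P k).2|)%R].

Lemma box_center c r : (0 < r)%R -> box c r c.
Proof. by move=> r0 i; rewrite !subrr normr0. Qed.

Lemma box_coherent c r : clear_radius c r -> coherent P (box c r).
Proof.
move=> [r0 h1 h2]; split=> [i j /h1|i k]; last have := h2 i k.
  by case; rewrite ler_normr => /orP[h|h];
    [exists West | exists East | exists South | exists North] => y hy /=;
    have [] := hy i; have [] := hy j; rewrite !ltr_norml; lra.
by case; rewrite ler_normr => /orP[h|h];
  [exists West | exists East | exists South | exists North] => y hy /=;
  have [] := hy i; rewrite !ltr_norml; lra.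
Qed.

Lemma exists_clear_radius c d : in_conf P c -> (0 < d)%R ->
  exists2 r, (r < d)%R & clear_radius c r.
Proof.
move=> [cc cP] d0.
have pos (p q : R * R) : p <> q -> (0 < `|p.1 - q.1| / 2 \/ 0 < `|p.2 - q.2| / 2)%R.
  move=> pq; have [E|] := eqVneq p.1 q.1; last first.
    by rewrite -subr_eq0 -normr_gt0 => h; left; lra.
  have [E'|] := eqVneq p.2 q.2; first by case: pq; case: p q E E' => ? ? [? ?] /= -> ->.
  by rewrite -subr_eq0 -normr_gt0 => h; right; lra.
pose s1 := [seq (`|(c p.1).1 - (c p.2).1| / 2)%R | p <- enum {: 'I_m * 'I_m}].
pose s2 := [seq (`|(c p.1).2 - (c p.2).2| / 2)%R | p <- enum {: 'I_m * 'I_m}].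
pose s3 := [seq (`|(c p.1).1 - (P p.2).1| / 2)%R | p <- enum {: 'I_m * 'I_N}].
pose s4 := [seq (`|(c p.1).2 - (P p.2).2| / 2)%R | p <- enum {: 'I_m * 'I_N}].
have [r /andP[r0 rd] hr] := small_pos (s1 ++ s2 ++ s3 ++ s4) d0.
exists r => //; split=> // [i j ij|i k].
  have m1 : (`|(c i).1 - (c j).1| / 2)%R \in s1.
    by apply/mapP; exists (i, j); rewrite ?mem_enum.
  have m2 : (`|(c i).2 - (c j).2| / 2)%R \in s2.
    by apply/mapP; exists (i, j); rewrite ?mem_enum.
  case: (pos _ _ (cc i j ij)) => h; [left|right].
    by have := hr _ _ h; rewrite !mem_cat m1 => /(_ isT); lra.
  by have := hr _ _ h; rewrite !mem_cat m2 orbT => /(_ isT); lra.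
have m3 : (`|(c i).1 - (P k).1| / 2)%R \in s3.
  by apply/mapP; exists (i, k); rewrite ?mem_enum.
have m4 : (`|(c i).2 - (P k).2| / 2)%R \in s4.
  by apply/mapP; exists (i, k); rewrite ?mem_enum.
case: (pos _ _ (cP i k)) => h; [left|right].
  by have := hr _ _ h; rewrite !mem_cat m3 !orbT => /(_ isT); lra.
by have := hr _ _ h; rewrite !mem_cat m4 !orbT => /(_ isT); lra.
Qed.

(** Strand i is shifted by (i + 1) x. The speeds differ, so each coincidence excludes a single x;
    they are nonzero, so strand 0 too can avoid the punctures and L. *)
Lemma perturb c r (L : seq R) : (0 < r)%R ->
  exists c' : V, [/\ box c r c', forall i, (c' i).2 = (c i).2, generic P c' &
    forall i, (c' i).1 \notin L].
Proof.
move=> r0.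
pose L' := L ++ [seq (P k).1 | k <- enum 'I_N].
pose s1 := [seq ((l - (c i).1) / i.+1%:R)%R | i <- enum 'I_m, l <- L'].
pose s2 := [seq (((c i).1 - (c j).1) / (j%:R - i%:R))%R | i <- enum 'I_m, j <- enum 'I_m].
have d0 : (0 < r / m.+1%:R)%R by rewrite divr_gt0 // ltr0n.
have [x /andP[x0 xr] hx] := small_pos (s1 ++ s2) d0.
have off i l : l \in L' -> ((c i).1 + i.+1%:R * x)%R != l.
  move=> lL; apply/eqP => E.
  have E' : x = ((l - (c i).1) / i.+1%:R)%R.
    by rewrite -E addrC addKr mulrC mulKf // pnatr_eq0.
  have lin : ((l - (c i).1) / i.+1%:R)%R \in s1.
    by apply/allpairsP; exists (i, l); rewrite mem_enum.
  by rewrite -E' in lin; have := hx x; rewrite mem_cat lin ltxx => /(_ isT x0).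
exists (fun i => ((c i).1 + i.+1%:R * x, (c i).2))%R; split=> // [i||i] /=.
- split=> /=; last by rewrite subrr normr0.
  rewrite addrC addKr gtr0_norm ?mulr_gt0 ?ltr0n //.
  rewrite mulrC -ltr_pdivlMr ?ltr0n //; apply: (lt_le_trans xr).
  by rewrite ler_pM2l // lef_pV2 ?posrE ?ltr0n // ler_nat ltnS ltnW.
- split=> [i j ij|i k] /=; last first.
    apply: off; rewrite mem_cat; apply/orP; right.
    by apply/mapP; exists k; rewrite ?mem_enum.
  apply/eqP => E.
  have ne : (j%:R - i%:R != 0 :> R)%R by rewrite subr_eq0 eqr_nat eq_sym.
  have E' : x = (((c i).1 - (c j).1) / (j%:R - i%:R))%R.
    apply: (canRL (mulfK ne)); move: E; rewrite -!natr1; lra.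
  have lin : (((c i).1 - (c j).1) / (j%:R - i%:R))%R \in s2.
    by apply/allpairsP; exists (i, j); rewrite !mem_enum.
  rewrite -E' in lin; have := hx x; rewrite mem_cat lin orbT ltxx.
  by move=> /(_ isT x0).
- apply/negP => iL; have := @off i _ _; rewrite /L'.
  by move=> /(_ ((c i).1 + i.+1%:R * x)%R); rewrite mem_cat iL eqxx => /(_ isT).
Qed.

End Boxes.

(** * Local motions are products of generators *)

Local Open Scope ring_scope.
Local Open Scope group_scope.

Lemma same_side (R : realFieldType) (u v p : R) : (u <= v)%R ->
  p != u -> p != v -> ~~ (u < p < v)%R ->
  ((u < p) = (v < p))%R /\ ((p < u) = (p < v))%R.
Proof.
move=> uv; rewrite !neq_lt negb_and -!leNgt => /orP[pu|up] /orP[pv|vp] hp;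
by split; apply/idP/idP => ?; lra.
Qed.

Lemma count_ltn (T : eqType) (p q : pred T) (s : seq T) x : x \in s ->
  p x -> ~~ q x -> subpred q p -> (count q s < count p s)%N.
Proof.
move=> xs px nqx qp; rewrite -!size_filter.
have -> : [seq y <- s | q y] = [seq y <- [seq y <- s | p y] | q y].
  by rewrite -filter_predI; apply: eq_filter => y /=; case: (boolP (q y)) => // /qp->.
rewrite size_filter ltn_neqAle count_size andbT -all_count; apply/negP => /allP.
by move=> /(_ x); rewrite mem_filter px xs (negPf nqx) => /(_ isT).
Qed.

Section Generation.
Variables (R : realFieldType) (m N : nat) (P : 'I_N -> R * R).
Local Notation V := ('I_m -> R * R).
Hypothesis P_height : forall k, (-1 < (P k).2 < 1)%R.
Variables (x0 x1 gap : R).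
Hypothesis gap_gt0 : (0 < gap)%R.
Hypothesis x0_left : forall k, (x0 + m%:R + gap *+ 4 < (P k).1)%R.
Hypothesis x1_right : forall k, ((P k).1 + gap *+ 4 < x1)%R.
Hypothesis P_gap : forall k l : 'I_N, k != l ->
  ((P k).1 + gap *+ 4 < (P l).1)%R \/ ((P l).1 + gap *+ 4 < (P k).1)%R.

Variables (B : groupType) (e : V -> V -> B).
Hypothesis e_relabel : forall s a b, e (relabel s a) (relabel s b) = e a b.
Hypothesis e_coherent : forall A, coherent P A ->
  forall a b c, A a -> A b -> A c -> e a b * e b c = e a c.

Local Notation ge := (ge x0 e).
Local Notation sig := (sig x0 e).
Local Notation rho := (rho P x0 x1 gap e).
Let geC := ge_coherent x0 e_coherent.
Let geV := geV x0 e_coherent.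
Let ge_triv := ge_triv P_height x0 e_coherent.
Let ge_sig := ge_sig P_height gap_gt0 x0_left e_relabel e_coherent.
Let ge_rho := ge_rho P_height gap_gt0 x0_left x1_right P_gap e_relabel e_coherent.

(** Generation is expressed through an arbitrary subgroup [H] that contains the candidates. *)
Variable H : B -> Prop.
Hypothesis H1 : H 1.
Hypothesis HM : forall x y, H x -> H y -> H (x * y).
Hypothesis HV : forall x, H x -> H x^-1.
Hypothesis H_sig : forall r, (r.+1 < m)%N -> H (sig r).
Hypothesis H_rho : forall (i : 'I_m) k, H (rho i k).

Definition move (a : V) (i : 'I_m) (v : R) : V :=
  fun x => if x == i then (v, (a i).2) else a x.

Let moveE a i v x : x != i -> move a i v x = a x.
Proof. by rewrite /move => /negPf ->. Qed.

Let moveii a i v : move a i v i = (v, (a i).2).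
Proof. by rewrite /move eqxx. Qed.

Definition height_clear (a : V) i u v :=
  (forall j, j != i -> (u < (a j).1 < v)%R -> (a j).2 != (a i).2) /\
  (forall k, (u < (P k).1 < v)%R -> (P k).2 != (a i).2).

Let off (a : V) i v := (forall j, j != i -> (a j).1 != v) /\
  (forall k, (P k).1 != v).

Let generic_move a i v : generic P a -> off a i v -> generic P (move a i v).
Proof.
move=> [g1 g2] [v1 v2]; split=> [x y xy|x k].
  have [xi|xi] := eqVneq x i.
    by rewrite xi moveii moveE -?xi 1?eq_sym // v1 // -xi eq_sym.
  rewrite moveE //; have [->|yi] := eqVneq y i; first by rewrite moveii v1.
  by rewrite moveE // g1.
have [->|xi] := eqVneq x i; first by rewrite moveii eq_sym v2.
by rewrite moveE.
Qed.

Let moves a i u v (y : V) :=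
  exists2 w, (u <= w <= v)%R & y = move a i w.

(** An obstacle passed by strand i differs from it in height, and the height of i is constant: the
    obstacle stays above or below during the whole motion. *)
Let moves_coherent a i u v : generic P a -> off a i u -> off a i v ->
  height_clear a i u v -> coherent P (moves a i u v).
Proof.
move=> ga [u1 u2] [v1 v2] [h1 h2].
have key (p : R * R) : p.1 != u -> p.1 != v ->
    ((u < p.1 < v)%R -> p.2 != (a i).2) ->
    exists d, forall w, (u <= w <= v)%R -> towards d (w, (a i).2) p.
  rewrite !neq_lt => /orP[pu|up] hp hc.
    by exists West => w /andP[h _] /=; exact: lt_le_trans h.
  case/orP: hp => [pv|vp].
    move: hc; rewrite up pv => /(_ isT)/orP[h|h];
    [by exists South|by exists North].
  by exists East => w /andP[_ h] /=; exact: le_lt_trans vp.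
split=> [x y xy|x k].
  have [xi|xi] := eqVneq x i.
    have yi : y != i by rewrite -xi eq_sym.
    have [d hd] := key (a y) (u1 _ yi) (v1 _ yi) (h1 _ yi).
    by exists d => _ [w hw ->]; rewrite xi moveii moveE //; exact: hd.
  have [yi|yi] := eqVneq y i.
    have [d hd] := key (a x) (u1 _ xi) (v1 _ xi) (h1 _ xi).
    exists (opp_dir d) => _ [w hw ->]; rewrite towards_opp yi moveii moveE //.
    exact: hd.
  have [h|h] := generic_dir ga xy.
    by exists East => _ [w _ ->] /=; rewrite !moveE.
  by exists West => _ [w _ ->] /=; rewrite !moveE.
have [->|xi] := eqVneq x i.
  have [d hd] := key (P k) (u2 k) (v2 k) (h2 k).
  by exists d => _ [w hw ->]; rewrite moveii; exact: hd.
have := ga.2 x k; rewrite neq_lt => /orP[h|h].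
  by exists East => _ [w _ ->] /=; rewrite moveE.
by exists West => _ [w _ ->] /=; rewrite moveE.
Qed.

Let H_free a i u v : generic P a -> off a i u -> off a i v -> (u <= v)%R ->
  (forall j, j != i -> ~~ (u < (a j).1 < v)%R) ->
  (forall k, ~~ (u < (P k).1 < v)%R) -> ge (move a i u) (move a i v) = 1.
Proof.
move=> ga ou ov uv hj hk.
have side := same_side uv.
apply: ge_triv; try exact: generic_move.
  move=> x y; have [->|xi] := eqVneq x i; have [->|yi] := eqVneq y i.
  - by rewrite !moveii !ltxx.
  - by rewrite !moveii !moveE //= (side _ (ou.1 _ yi) (ov.1 _ yi) (hj _ yi)).1.
  - by rewrite !moveii !moveE //= (side _ (ou.1 _ xi) (ov.1 _ xi) (hj _ xi)).2.
  - by rewrite !moveE.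
move=> x; left=> k; have [->|xi] := eqVneq x i; last by rewrite !moveE.
by rewrite !moveii /= (side _ (ou.2 k) (ov.2 k) (hk k)).1.
Qed.

Let In4 (a b c d x : V) := x = a \/ x = b \/ x = c \/ x = d.

Let H_cross_strand a i j u v : generic P a -> off a i u -> off a i v ->
  height_clear a i u v -> j != i -> (u < (a j).1 < v)%R ->
  (forall l, l != i -> l != j -> ~~ (u < (a l).1 < v)%R) ->
  (forall k, ~~ (u < (P k).1 < v)%R) -> H (ge (move a i u) (move a i v)).
Proof.
move=> ga ou ov hc ji hj hl hk; have /andP[uj jv] := hj.
have cA := moves_coherent ga ou ov hc.
have uv : (u < v)%R by apply: lt_trans jv.
have side := same_side (ltW uv).
have gu : generic P (move a i u) by exact: generic_move.
have gv : generic P (move a i v) by exact: generic_move.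
have free x : free_strip P (move a i u) (move a i v) x.
  left=> k; have [->|xi] := eqVneq x i; last by rewrite !moveE.
  by rewrite !moveii /= (side _ (ou.2 k) (ov.2 k) (hk k)).1.
have ord x y : ~~ ((x == i) && (y == j)) -> ~~ ((x == j) && (y == i)) ->
    ((move a i u x).1 < (move a i u y).1)%R = ((move a i v x).1 < (move a i v y).1)%R.
  have [->|xi] := eqVneq x i; have [->|yi] := eqVneq y i => /=.
  - by rewrite !moveii !ltxx.
  - by move=> yj _; rewrite !moveii !moveE //= (side _ (ou.1 _ yi) (ov.1 _ yi) (hl _ yi yj)).1.
  - rewrite andbT => _ xj.
    by rewrite !moveii !moveE //= (side _ (ou.1 _ xi) (ov.1 _ xi) (hl _ xi xj)).2.
  - by rewrite !moveE.
have Au : moves a i u v (move a i u) by exists u; rewrite // lexx ltW.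
have Av : moves a i u v (move a i v) by exists v; rewrite // lexx ltW.
(* In [sig] the lower strand starts on the left. If the moving strand is the higher one, the reverse
   motion is the [sig]. *)
have := hc.1 j ji hj; rewrite neq_lt => /orP[hji|hij].
- rewrite (geV cA Av Au).
  have -> : ge (move a i v) (move a i u) = sig (rk (move a i v) j).
    apply: (@ge_sig _ _ _ i) => //; last by move=> x; case: (free x) => [h|[]]; [left=> k; rewrite h|right].
    by split; rewrite ?moveii ?moveE //= => x y h1 h2; rewrite ord.
  apply/HV/H_sig; apply: leq_ltn_trans (rk_bound (move a i v) i).
  by apply: rk_lt; rewrite moveii moveE.
- have -> : ge (move a i u) (move a i v) = sig (rk (move a i u) i).
    by apply: (@ge_sig _ _ _ j) => //; split; rewrite ?moveii ?moveE.
  apply: H_sig; apply: leq_ltn_trans (rk_bound (move a i u) j).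
  by apply: rk_lt; rewrite moveii moveE.
Qed.

(** The height of strand i can be changed on its side of puncture k: raised to 2 the crossing
    becomes trivial, lowered to -2 it becomes a [rho]. *)
Let H_cross_pole a i k u v : generic P a -> off a i u -> off a i v ->
  height_clear a i u v -> (u < (P k).1 < v)%R ->
  (forall j, j != i -> ~~ (u < (a j).1 < v)%R) ->
  (forall l, l != k -> ~~ (u < (P l).1 < v)%R) -> H (ge (move a i u) (move a i v)).
Proof.
move=> ga ou ov hc hk hj hl; have /andP[uk kv] := hk.
have uv : (u < v)%R by apply: lt_trans kv.
have side := same_side (ltW uv).
pose T w t : V := fun x => if x == i then (w, t) else a x.
have Ti w t : T w t i = (w, t) by rewrite /T eqxx.
have TE w t x : x != i -> T w t x = a x by rewrite /T => /negPf ->.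
have gT w t : off a i w -> generic P (T w t).
  move=> ow; have [g1 g2] := generic_move ga ow; split=> [x y /g1|x l];
    last have := g2 x l; rewrite /T /move; by repeat case: eqP.
have sT t t' : same_order (T u t) (T v t').
  move=> x y; have [->|xi] := eqVneq x i; have [->|yi] := eqVneq y i.
  - by rewrite !Ti !ltxx.
  - by rewrite !Ti !TE //= (side _ (ou.1 _ yi) (ov.1 _ yi) (hj _ yi)).1.
  - by rewrite !Ti !TE //= (side _ (ou.1 _ xi) (ov.1 _ xi) (hj _ xi)).2.
  - by rewrite !TE.
have lab t t' l : l != k -> ((T u t i).1 < (P l).1 = ((T v t' i).1 < (P l).1))%R.
  by move=> lk; rewrite !Ti /= (side _ (ou.2 l) (ov.2 l) (hl _ lk)).1.
have lift t : (forall s, s = (a i).2 \/ s = t -> ((P k).2 < s)%R) \/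
              (forall s, s = (a i).2 \/ s = t -> (s < (P k).2)%R) ->
    ge (move a i u) (move a i v) = ge (T u t) (T v t).
  move=> ht; apply: (@ge_quad _ _ _ P x0 _ e e_coherent
    (In4 (move a i u) (move a i v) (T u t) (T v t))); rewrite /In4; try tauto.
  - have inT (x : V) : In4 (move a i u) (move a i v) (T u t) (T v t) x ->
      exists w s, [/\ w = u \/ w = v, s = (a i).2 \/ s = t & x = T w s].
      case=> [->|[->|[->|->]]]; [exists u, (a i).2|exists v, (a i).2|
        exists u, t|exists v, t]; split=> //; tauto.
    apply: (coherent_sub inT).
    split=> [x y xy|x l].
      have [h|h] := generic_dir (gT u t ou) xy.
        exists East => _ [w [s [hw hs ->]]] /=.
        have : ((T w t x).1 < (T w t y).1)%R by case: hw => ->; rewrite // -(sT t).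
        by rewrite /T; repeat case: eqP.
      exists West => _ [w [s [hw hs ->]]] /=.
      have : ((T w t y).1 < (T w t x).1)%R by case: hw => ->; rewrite // -(sT t).
      by rewrite /T; repeat case: eqP.
    have [->|xi] := eqVneq x i; last first.
      have := ga.2 x l; rewrite neq_lt => /orP[h|h].
        by exists East => _ [w [s [_ _ ->]]] /=; rewrite TE.
      by exists West => _ [w [s [_ _ ->]]] /=; rewrite TE.
    have [->|lk] := eqVneq l k.
      by case: ht => ht; [exists South|exists North] => _ [w [s [_ hs ->]]] /=;
        rewrite Ti; exact: ht.
    have [s1 s2] := side _ (ou.2 l) (ov.2 l) (hl _ lk).
    have := ou.2 l; rewrite neq_lt => /orP[h|h].
      by exists West => _ [w [s [hw _ ->]]] /=; rewrite Ti /=; case: hw => ->; rewrite -?s2.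
    by exists East => _ [w [s [hw _ ->]]] /=; rewrite Ti /=; case: hw => ->; rewrite -?s1.
  - apply: ge_triv; [exact: generic_move | exact: gT | |].
      by move=> x y; rewrite /T /move; repeat case: eqP.
    by move=> x; left=> l; rewrite /T /move; case: eqP.
  - apply: ge_triv; [exact: generic_move | exact: gT | |].
      by move=> x y; rewrite /T /move; repeat case: eqP.
    by move=> x; left=> l; rewrite /T /move; case: eqP.
have hPk := P_height k.
have := hc.2 k hk; rewrite neq_lt => /orP[lo|hi].
  rewrite (lift 2%R); last by left=> s [->//|->]; lra.
  have -> // : ge (T u 2%R) (T v 2%R) = 1.
  apply: ge_triv; try exact: gT; first exact: sT.
  move=> x; have [->|xi] := eqVneq x i; last by left=> l; rewrite !TE.
  by right; rewrite !Ti /=; split; lra.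
rewrite (lift (-2)%R); last by right=> s [->//|->]; lra.
have -> : ge (T u (-2)%R) (T v (-2)%R) = rho (rk (T u (-2)%R) i) k.
  apply: ge_rho; rewrite ?Ti /=.
  - exact: gT.
  - exact: gT.
  - exact: sT.
  - by move=> x xi; left=> l; rewrite !TE.
  - by [].
  - by move=> l lk; have := lab (-2)%R (-2)%R l lk; rewrite !Ti.
  - by lra.
  - by lra.
exact: (H_rho (Ordinal (rk_bound (T u (-2)%R) i))).
Qed.

Let obstacles (a : V) i : seq R :=
  [seq (a j).1 | j <- enum 'I_m & j != i] ++ [seq (P k).1 | k <- enum 'I_N].

(** Induction on the number of obstacles strictly between u and v. By genericity their abscissae are
    distinct, so a small window around one of them, z, contains no other, and the motion is cut at z
    - d and z + d. *)
Let H_move_up a i u v : generic P a -> off a i u -> off a i v -> (u <= v)%R ->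
  height_clear a i u v -> H (ge (move a i u) (move a i v)).
Proof.
move=> ga; have [n] := ubnP (count (fun z => u < z < v)%R (obstacles a i)).
have a_obs j : j != i -> (a j).1 \in obstacles a i.
  move=> ji; rewrite mem_cat; apply/orP; left; apply/mapP; exists j => //.
  by rewrite mem_filter ji mem_enum.
have P_obs k : (P k).1 \in obstacles a i.
  by rewrite mem_cat; apply/orP; right; apply/mapP; exists k; rewrite ?mem_enum.
elim: n u v => // n IH u v; rewrite ltnS => hn ou ov uv hc.
have [|] := boolP (has (fun z => u < z < v)%R (obstacles a i)); last first.
  move=> /hasPn hno; rewrite H_free // => [j /a_obs/hno//|k].
  exact/hno/P_obs.
case/hasP => z zin /[dup] huzv /andP[uz zv].
pose L := [:: z - u; v - z]%R ++ [seq `|y - z|%R | y <- obstacles a i].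
have [d /andP[d0 _] hd] := small_pos L (@ltr01 R).
have du : (d < z - u)%R by apply: hd; rewrite ?inE ?eqxx // subr_gt0.
have dv : (d < v - z)%R by apply: hd; rewrite ?inE ?eqxx ?orbT // subr_gt0.
have away y : y \in obstacles a i -> y != z -> (y < z - d \/ z + d < y)%R.
  move=> yin yz; have : (d < `|y - z|)%R.
    apply: hd; last by rewrite normr_gt0 subr_eq0.
    by rewrite mem_cat; apply/orP; right; apply/mapP; exists y.
  by rewrite ltr_normr => /orP[h|h]; [right|left]; lra.
have off_near w : (w = z - d \/ w = z + d)%R -> off a i w.
  move=> hw; have key y : y \in obstacles a i -> y != w.
    move=> yin; have [->|yz] := eqVneq y z.
      by rewrite neq_lt; apply/orP; case: hw => ->; [right|left]; lra.
    have := away _ yin yz; rewrite neq_lt => h; apply/orP.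
    by case: hw => ->; case: h => h; [left|right|left|right]; lra.
  by split=> [j /a_obs|k]; [exact: key | apply/key/P_obs].
have o1 : off a i (z - d)%R by apply: off_near; left.
have o2 : off a i (z + d)%R by apply: off_near; right.
have hc_sub u' v' : (u <= u')%R -> (v' <= v)%R -> height_clear a i u' v'.
  move=> uu' vv'; split=> [j ji|k] /andP[h1 h2].
    by apply: hc.1 => //; rewrite (le_lt_trans uu' h1) (lt_le_trans h2).
  by apply: hc.2; rewrite (le_lt_trans uu' h1) (lt_le_trans h2).
have cA := moves_coherent ga ou ov hc.
have Aw w : (u <= w <= v)%R -> moves a i u v (move a i w) by exists w.
have b1 : (u <= z - d <= v)%R by apply/andP; split; lra.
have b2 : (u <= z + d <= v)%R by apply/andP; split; lra.
have b0 : (u <= u <= v)%R by rewrite lexx.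
have b3 : (u <= v <= v)%R by rewrite lexx uv.
rewrite -(geC cA (Aw _ b0) (Aw _ b2) (Aw _ b3)).
rewrite -(geC cA (Aw _ b0) (Aw _ b1) (Aw _ b2)).
apply: HM; [apply: HM|].
- apply: IH => //; [|lra|by apply: hc_sub; lra].
  apply: leq_trans hn; apply: (count_ltn zin) => //=.
    by apply/negP => /andP[_]; rewrite ltNge => /negP; apply; lra.
  by move=> y /= /andP[-> h] /=; lra.
- have out y : y \in obstacles a i -> y != z -> ~~ (z - d < y < z + d)%R.
    move=> yin /(away _ yin) h; apply/negP => /andP[h1 h2]; case: h => h; lra.
  have hin : (z - d < z < z + d)%R by apply/andP; split; lra.
  have hc' : height_clear a i (z - d) (z + d) by apply: hc_sub; lra.
  have neP k l : k != l -> (P k).1 != (P l).1.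
    by move=> /P_gap h; rewrite neq_lt; apply/orP; have := gap_gt0; case: h; [left|right]; lra.
  move: zin; rewrite mem_cat => /orP[]/mapP[j jin zj].
    move: jin; rewrite mem_filter => /andP[ji _].
    apply: (@H_cross_strand _ _ j) => //; first by rewrite -zj.
      by move=> l li lj; apply: out; [exact: a_obs | rewrite zj ga.1].
    by move=> k; apply: out; [exact: P_obs | rewrite zj eq_sym ga.2].
  apply: (@H_cross_pole _ _ j) => //; first by rewrite -zj.
    by move=> l li; apply: out; [exact: a_obs | rewrite zj ga.2].
  by move=> l lj; apply: out; [exact: P_obs | rewrite zj neP].
- apply: IH => //; [|lra|by apply: hc_sub; lra].
  apply: leq_trans hn; apply: (count_ltn zin) => //=.
    by apply/negP => /andP[]; rewrite ltNge => /negP + _; apply; lra.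
  by move=> y /= /andP[h ->]; rewrite andbT; lra.
Qed.

Let H_box_move c r a b i : clear_radius P c r -> box c r a -> box c r b ->
  generic P a -> generic P b -> (a i).2 = (b i).2 ->
  (forall j, j != i -> a j = b j) -> H (ge a b).
Proof.
move=> hr ba bb ga gb ab2 abj; have cA := box_coherent hr.
wlog ab : a b ba bb ga gb ab2 abj / ((a i).1 <= (b i).1)%R.
  move=> h; have [|/ltW] := leP (a i).1 (b i).1; first exact: h.
  move=> /h hba; rewrite (geV cA bb ba); apply/HV/hba => //.
  by move=> j /abj.
have aE : a = move a i (a i).1.
  by apply/funext => x; rewrite /move; case: eqP => // ->; case: (a i).
have bE : b = move a i (b i).1.
  apply/funext => x; rewrite /move ab2; case: eqP => [->|/eqP xi]; last by rewrite abj.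
  by case: (b i).
rewrite [in X in H X]bE [X in ge X]aE.
apply: H_move_up => //; try (split=> [j ji|k]; last by rewrite eq_sym ?ga.2 ?gb.2).
- exact: ga.1.
- by rewrite abj // gb.1.
(* An obstacle at the height of strand i and between its two positions would put two centres, or a
   centre and a puncture, closer than 2 r in both coordinates. *)
split=> [j ji|k] /andP[h1 h2]; apply/eqP => E.
  have [_ /(_ _ _ ji) hc _] := hr.
  have := ba i; have := bb i; have := ba j; have := ba i.
  rewrite !ltr_norml !ler_normr in hc *; case: hc; lra.
have [_ _ /(_ i k) hc] := hr.
have := ba i; have := bb i.
rewrite !ltr_norml !ler_normr in hc *; case: hc; lra.
Qed.

(** The strands move one at a time. The hybrids are generic because a and b share no abscissa. *)
Let H_box_level c r a b : clear_radius P c r -> box c r a -> box c r b ->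
  generic P a -> generic P b -> (forall i, (a i).2 = (b i).2) ->
  (forall i j, (a i).1 != (b j).1) -> H (ge a b).
Proof.
move=> hr ba bb ga gb ab2 nab; have cA := box_coherent hr.
pose hyb n : V := fun i => if (i < n)%N then b i else a i.
have h0 : hyb 0%N = a by apply/funext.
have hm : hyb m = b by apply/funext => i; rewrite /hyb ltn_ord.
have bh n : box c r (hyb n) by move=> i; rewrite /hyb; case: ifP.
have gh n : generic P (hyb n).
  split=> [i j ij|i k]; rewrite /hyb.
    case: ifP => _; case: ifP => _ //; [exact: gb.1|by rewrite eq_sym|exact: ga.1].
  by case: ifP => _; [exact: gb.2|exact: ga.2].
suff main n : (n <= m)%N -> H (ge (hyb 0%N) (hyb n)) by rewrite -h0 -hm; apply: main.
elim: n => [|n IH] nm; first by rewrite ge_triv // => i; left.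
rewrite -(geC cA (bh 0%N) (bh n) (bh n.+1)); apply: HM; first exact/IH/ltnW.
apply: (@H_box_move c r _ _ (Ordinal nm)) => //.
  by rewrite /hyb ltnn ltnSn.
move=> j jn; rewrite /hyb ltnS [(j <= n)%N]leq_eqVlt.
have jn' : (nat_of_ord j == n) = false by apply: contraNF jn; rewrite -val_eqE.
by rewrite jn'.
Qed.

(** After levelling the heights, a and b may still share abscissae; a detour through a configuration
    w avoiding the abscissae of both makes [H_box_level] applicable twice. *)
Lemma H_box c r a b : clear_radius P c r -> box c r a -> box c r b ->
  generic P a -> generic P b -> H (ge a b).
Proof.
move=> hr ba bb ga gb; have cA := box_coherent hr.
have r0 : (0 < r)%R by have [] := hr.
pose lev (y : V) : V := fun i => ((y i).1, (c i).2).
have blev y : box c r y -> box c r (lev y).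
  by move=> hy i; have [h _] := hy i; split=> //=; rewrite subrr normr0.
have glev y : generic P y -> generic P (lev y) by [].
have glev1 y : generic P y -> ge y (lev y) = 1.
  by move=> gy; apply: ge_triv => // i; left.
rewrite (ge_quad e_coherent cA ba bb (blev _ ba) (blev _ bb)) ?glev1 //.
have [w [bw w2 gw wL]] := perturb P c ([seq (a i).1 | i <- enum 'I_m] ++
  [seq (b i).1 | i <- enum 'I_m]) r0.
have wab i j : ((a i).1 != (w j).1) && ((w j).1 != (b i).1).
  have := wL j; rewrite mem_cat negb_or => /andP[h1 h2]; apply/andP; split.
    by apply: contraNneq h1 => <-; apply/mapP; exists i; rewrite ?mem_enum.
  by apply: contraNneq h2 => ->; apply/mapP; exists i; rewrite ?mem_enum.
rewrite -(geC cA (blev _ ba) bw (blev _ bb)); apply: HM.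
  apply: (H_box_level hr (blev _ ba) bw (glev _ ga) gw) => [i|i j].
    by rewrite w2.
  by have /andP[] := wab i j.
apply: (H_box_level hr bw (blev _ bb) gw (glev _ gb)) => [i|i j].
  by rewrite w2.
by have /andP[] := wab j i.
Qed.

End Generation.

(** * Paths and homotopies *)

Local Open Scope classical_set_scope.
Local Open Scope ring_scope.

(** Takes the place of a Lebesgue number: the supremum of the t such that Q holds on [0, t] is
    attained and equal to 1. Subdivisions of loops and of homotopies go through it. *)
Lemma interval_additive (R : realType) (Q : R -> R -> Prop) :
  (forall t, 0 <= t <= 1 -> exists2 d, 0 < d & forall s u,
     0 <= s -> s <= u -> u <= 1 -> `|s - t| < d -> `|u - t| < d -> Q s u) ->
  (forall s t u, 0 <= s -> s <= t -> t <= u -> u <= 1 -> Q s t -> Q t u -> Q s u) ->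
  Q 0 1.
Proof.
move=> loc tr.
pose S := [set t | 0 <= t <= 1 /\ Q 0 t].
have S0 : S 0.
  have [|d d0 hd] := loc 0; first by rewrite lexx ler01.
  by split; [rewrite lexx ler01 | apply: hd; rewrite ?subrr ?normr0 ?ler01].
have supS : has_sup S by split; [exists 0 | exists 1 => t [/andP[]]].
set c := sup S.
have c0 : 0 <= c by apply: (ub_le_sup supS.2).
have c1 : c <= 1 by apply: ge_sup => [|t [/andP[]]//]; exists 0.
have [|d d0 hd] := loc c; first by rewrite c0.
have [t [/andP[t0 t1] Q0t] ct] := sup_adherent d0 supS.
have tc : t <= c by apply: (ub_le_sup supS.2); split; rewrite ?t0.
rewrite -/c in ct.
have step u : t <= u -> u <= 1 -> u < c + d -> Q 0 u.
  move=> tu u1 ucd; apply: (tr _ t) => //; apply: hd => //; rewrite ltr_norml; lra.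
have [c1'|] := ltP c 1; last by move=> ?; apply: step => //; lra.
pose u := Num.min (c + d / 2) 1.
have hu : c < u <= 1 by rewrite /u; case: (leP (c + d / 2) 1) => ?; lra.
have ud : u < c + d by rewrite /u; case: (leP (c + d / 2) 1) => ?; lra.
have Su : S u by split; [lra | apply: step => //; lra].
have := ub_le_sup supS.2 Su; rewrite -/c; lra.
Qed.

Section Paths.
Variables (R : realType) (X : topologicalType).
Local Notation I := (`[0%R, 1%R]%classic : set R).

Record path (x y : X) := Path {
  path_fun :> R -> X;
  path_continuous : {within I, continuous path_fun};
  path0 : path_fun 0 = x;
  path1 : path_fun 1 = y
}.

Definition path_homotopic x y (p q : path x y) : Prop := exists H : R * R -> X,
  [/\ {within I `*` I, continuous H},
      forall t, I t -> H (t, 0) = p t,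
      forall t, I t -> H (t, 1) = q t &
      forall s, I s -> H (0, s) = x /\ H (1, s) = y].

Lemma homotopic_through (T : topologicalType) (A : set T) (F : T -> X)
    (h : R * R -> T) x y (p q : path x y) :
  {within A, continuous F} -> {within I `*` I, continuous h} ->
  (forall c : R * R, (I `*` I) c -> A (h c)) ->
  (forall t, I t -> F (h (t, 0)) = p t) ->
  (forall t, I t -> F (h (t, 1)) = q t) ->
  (forall s, I s -> F (h (0, s)) = x /\ F (h (1, s)) = y) ->
  path_homotopic p q.
Proof.
move=> cF ch hA h0 h1 hs; exists (F \o h); split=> //.
exact: within_comp ch cF hA.
Qed.

Lemma homotopic_reparametrized x y z w (f : path z w) (p q : path x y) (u v : R -> R) :
  continuous u -> continuous v ->
  (forall t, 0 <= t <= 1 -> 0 <= u t <= 1) ->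
  (forall t, 0 <= t <= 1 -> 0 <= v t <= 1) ->
  u 0 = v 0 -> u 1 = v 1 ->
  (forall t, 0 <= t <= 1 -> p t = f (u t)) ->
  (forall t, 0 <= t <= 1 -> q t = f (v t)) -> path_homotopic p q.
Proof.
move=> cu cv uI vI uv0 uv1 pE qE.
apply: (@homotopic_through R I f (fun z : R * R => (1 - z.2) * u z.1 + z.2 * v z.1)).
- exact: path_continuous.
- apply: continuous_subspaceT => c.
  apply: cvgD; apply: cvgM.
  + by apply: cvgB; [exact: cvg_cst | exact: cvg_snd].
  + by apply: (@continuous_comp _ _ _ fst u); [exact: cvg_fst | exact: cu].
  + exact: cvg_snd.
  + by apply: (@continuous_comp _ _ _ fst v); [exact: cvg_fst | exact: cv].
- move=> [t s] [/itv01P/= ht /itv01P/= hs]; apply/itv01P => /=.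
  by have := uI _ ht; have := vI _ ht; nra.
- by move=> t /itv01P ht /=; rewrite pE// subr0 mul1r mul0r addr0.
- by move=> t /itv01P ht /=; rewrite qE// subrr mul1r mul0r add0r.
- move=> s /itv01P hs /=; rewrite uv0 uv1 -!mulrDl subrK !mul1r -!qE ?lexx ?ler01//.
  by rewrite path0 path1.
Qed.

Lemma homotopic_ext x y (p q : path x y) :
  (forall t, 0 <= t <= 1 -> p t = q t) -> path_homotopic p q.
Proof.
move=> pq; apply: (@homotopic_reparametrized _ _ _ _ q p q id id) => // t.
  exact: cvg_id.
exact: cvg_id.
Qed.

Lemma path_homotopic_refl x y (p : path x y) : path_homotopic p p.
Proof. exact: homotopic_ext. Qed.

(** Serves three times: constant in the second variable it glues paths, directly it concatenates
    homotopies, and with the variables exchanged it composes them. *)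
Lemma concat_continuous2 (H K : R * R -> X) :
  {within I `*` I, continuous H} -> {within I `*` I, continuous K} ->
  (forall s, I s -> H (1, s) = K (0, s)) ->
  {within I `*` I, continuous (fun z => concat_fun (fun t => H (t, z.2))
                                          (fun t => K (t, z.2)) z.1)}.
Proof.
move=> cH cK HK; apply: within_glue.
- exact: closedII.
- by move=> z; apply: cvg_fst.
- apply: (@within_comp _ _ _ _ (I `*` I) (fun z : R * R => (2 * z.1, z.2))) cH _.
    apply: continuous_subspaceT; apply: pair_continuous => z; last exact: cvg_snd.
    by apply: cvgM; [exact: cvg_cst | exact: cvg_fst].
  by move=> [t s] [[/itv01P/= ht hs] /= ht']; split => //=; rewrite in_itv/=; lra.
- apply: (@within_comp _ _ _ _ (I `*` I) (fun z : R * R => (2 * z.1 - 1, z.2))) cK _.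
    apply: continuous_subspaceT; apply: pair_continuous => z; last exact: cvg_snd.
    apply: cvgB; last exact: cvg_cst.
    by apply: cvgM; [exact: cvg_cst | exact: cvg_fst].
  by move=> [t s] [[/itv01P/= ht hs] /= ht']; split => //=; rewrite in_itv/=; lra.
- by move=> [t s] [_ hs] /= ->; rewrite divff// subrr HK.
Qed.

Lemma path_concat_continuous x y z (p : path x y) (q : path y z) :
  {within I, continuous (concat_fun p q)}.
Proof.
have c2 (f : R -> X) : {within I, continuous f} ->
    {within I `*` I, continuous (fun z => f z.1)}.
  move=> cf; apply: (@within_comp _ _ _ _ I) cf _.
    by apply: continuous_subspaceT => ?; exact: cvg_fst.
  by move=> ? [].
have := concat_continuous2 (c2 _ (@path_continuous _ _ p)) (c2 _ (@path_continuous _ _ q)).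
move=> /(_ (fun _ _ => etrans (path1 p) (esym (path0 q)))) cpq.
apply: (@within_comp _ _ _ _ (I `*` I) (fun t : R => (t, 0))) cpq _.
  by apply: continuous_subspaceT; apply: pair_continuous => t; [exact: cvg_id|exact: cvg_cst].
by move=> t It; split=> //=; rewrite in_itv /= lexx ler01.
Qed.

Lemma concat_fun0 (f g : R -> X) : concat_fun f g 0 = f 0.
Proof. by rewrite /concat_fun invr_ge0 ler0n mulr0. Qed.

Lemma concat_fun1 (f g : R -> X) : concat_fun f g 1 = g 1.
Proof.
rewrite /concat_fun; case: ifPn => [|_]; first by move=> ?; exfalso; lra.
by rewrite mulr1 (_ : 2 - 1 = 1) //; lra.
Qed.

Definition pconcat x y z (p : path x y) (q : path y z) : path x z :=
  Path (@path_concat_continuous _ _ _ p q) (etrans (concat_fun0 p q) (path0 p))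
    (etrans (concat_fun1 p q) (path1 q)).

Lemma preverse_continuous x y (p : path x y) :
  {within I, continuous (fun t => p (1 - t))}.
Proof.
apply: (@within_comp _ _ _ I I (fun t : R => 1 - t) p _ (@path_continuous _ _ p)).
  by apply: continuous_subspaceT => t; apply: cvgB; [exact: cvg_cst|exact: cvg_id].
by move=> t /itv01P ht; rewrite /= in_itv/=; lra.
Qed.

Lemma preverse0 x y (p : path x y) : p (1 - 0) = y.
Proof. by rewrite subr0 path1. Qed.
Lemma preverse1 x y (p : path x y) : p (1 - 1) = x.
Proof. by rewrite subrr path0. Qed.

Definition preverse x y (p : path x y) : path y x :=
  Path (@preverse_continuous _ _ p) (preverse0 p) (preverse1 p).

Definition pconst (x : X) : path x x :=
  @Path x x (cst x) (continuous_subspaceT (fun y => cvg_cst x)) erefl erefl.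

Lemma path_homotopic_trans x y (p q r : path x y) :
  path_homotopic p q -> path_homotopic q r -> path_homotopic p r.
Proof.
move=> [H [cH H0 H1 Hb]] [K [cK K0 K1 Kb]].
pose sw (z : R * R) := (z.2, z.1).
have csw : continuous sw.
  by apply: pair_continuous => z; [exact: cvg_snd | exact: cvg_fst].
have c2 (L : R * R -> X) : {within I `*` I, continuous L} ->
    {within I `*` I, continuous (fun z => L (sw z))}.
  move=> cL; apply: (@within_comp _ _ _ _ (I `*` I) sw) cL _.
    exact: continuous_subspaceT csw.
  by move=> ? [].
have c12 := concat_continuous2 (c2 _ cH) (c2 _ cK)
  (fun s Is => etrans (H1 s Is) (esym (K0 s Is))).
exists (fun z => concat_fun (fun t => H (z.1, t)) (fun t => K (z.1, t)) z.2).
split; first exact: c2 c12.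
- by move=> t It /=; rewrite concat_fun0 H0.
- by move=> t It /=; rewrite concat_fun1 K1.
- move=> s /itv01P Is /=; rewrite /concat_fun; case: ifPn => hs.
    by apply: Hb; apply/itv01P; lra.
  by apply: Kb; apply/itv01P; move: hs; rewrite -ltNge => hs; lra.
Qed.

Lemma path_homotopic_sym x y (p q : path x y) :
  path_homotopic p q -> path_homotopic q p.
Proof.
move=> [H [cH H0 H1 Hb]]; apply: (@homotopic_through _ (I `*` I) H
  (fun z : R * R => (z.1, 1 - z.2))) => //.
- apply: continuous_subspaceT; apply: pair_continuous => z; first exact: cvg_fst.
  by apply: cvgB; [exact: cvg_cst | exact: cvg_snd].
- by move=> [t s] [ht /itv01P/= hs]; split => //=; rewrite in_itv/=; lra.
- by move=> t It /=; rewrite subr0 H1.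
- by move=> t It /=; rewrite subrr H0.
- by move=> s /itv01P hs /=; apply: Hb; apply/itv01P; lra.
Qed.

Lemma pconcat_homotopic x y z (p p' : path x y) (q q' : path y z) :
  path_homotopic p p' -> path_homotopic q q' ->
  path_homotopic (pconcat p q) (pconcat p' q').
Proof.
move=> [H [cH H0 H1 Hb]] [K [cK K0 K1 Kb]].
exists (fun z => concat_fun (fun t => H (t, z.2)) (fun t => K (t, z.2)) z.1); split.
- by apply: concat_continuous2 => // s Is; rewrite (Hb _ Is).2 (Kb _ Is).1.
- move=> t /itv01P ht /=; rewrite /concat_fun; case: ifPn => ht'.
    by rewrite H0//=; rewrite in_itv/=; lra.
  by move: ht'; rewrite -ltNge => ht'; rewrite K0//=; rewrite in_itv/=; lra.
- move=> t /itv01P ht /=; rewrite /concat_fun; case: ifPn => ht'.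
    by rewrite H1//=; rewrite in_itv/=; lra.
  by move: ht'; rewrite -ltNge => ht'; rewrite K1//=; rewrite in_itv/=; lra.
- move=> s Is /=; rewrite concat_fun0 concat_fun1.
  by rewrite (Hb _ Is).1 (Kb _ Is).2.
Qed.

Let cmul (a : R) : continuous (fun t : R => a * t).
Proof. by move=> t; apply: cvgM; [exact: cvg_cst | exact: cvg_id]. Qed.
Let cadd (p : R -> R) (a : R) : continuous p -> continuous (fun t => p t + a).
Proof. by move=> cp t; apply: cvgD; [exact: cp | exact: cvg_cst]. Qed.
Let cmax (p q : R -> R) : continuous p -> continuous q ->
  continuous (fun t => Num.max (p t) (q t)).
Proof. by move=> cp cq t; apply: continuous_max; [exact: cp | exact: cq]. Qed.
Let cidR : continuous (id : R -> R). Proof. by move=> t; apply: cvg_id. Qed.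

Local Ltac split_cases := repeat match goal with
  | |- context [Order.max ?x ?y] =>
      lazymatch x with context [Order.max] => fail | _ => case: (leP x y) => ? end
  | |- context [if (?x <= ?y)%R then _ else _] => case: (leP x y) => ?
  end.

Lemma pconcatA x y z w (p : path x y) (q : path y z) (r : path z w) :
  path_homotopic (pconcat (pconcat p q) r) (pconcat p (pconcat q r)).
Proof.
apply: path_homotopic_sym.
apply: (@homotopic_reparametrized _ _ _ _ (pconcat (pconcat p q) r) _ _
  (fun t => Num.max (Num.max (2^-1 * t) (t - 4^-1)) (2 * t - 1)) id) => //.
- by apply: cmax; [apply: cmax => //|]; exact: cadd.
- by move=> t ht; split_cases; lra.
- by split_cases; lra.
- by split_cases; lra.
- move=> t ht /=; rewrite /concat_fun; split_cases;
  first [by exfalso; lra | by congr path_fun; lra].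
Qed.

Lemma pconst_concat x y (p : path x y) : path_homotopic (pconcat (pconst x) p) p.
Proof.
apply: (@homotopic_reparametrized _ _ _ _ p _ _ (fun t => Num.max 0 (2 * t - 1)) id) => //.
- by apply: cmax; [move=> t; exact: cvg_cst | exact: cadd].
- by move=> t ht; split_cases; lra.
- by split_cases; lra.
- by split_cases; lra.
- move=> t ht /=; rewrite /concat_fun /=; split_cases; rewrite ?path0 //.
    by rewrite (_ : 2 * t - 1 = 0) ?path0//; lra.
  by exfalso; lra.
Qed.

Lemma preverse_concat x y (p : path x y) :
  path_homotopic (pconcat (preverse p) p) (pconst y).
Proof.
apply: (@homotopic_reparametrized _ _ _ _ p _ _
  (fun t => Num.max (1 - 2 * t) (2 * t - 1)) (fun=> 1)) => //.
- apply: cmax; last exact: cadd.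
  by move=> t; apply: cvgB; [exact: cvg_cst | exact: cmul].
- by move=> t; exact: cvg_cst.
- by move=> t ht; split_cases; lra.
- by move=> t ht; lra.
- by split_cases; lra.
- by split_cases; lra.
- move=> t ht /=; rewrite /concat_fun; split_cases;
  first [by exfalso; lra | by congr path_fun; lra].
- by move=> t ht /=; rewrite path1.
Qed.

End Paths.

(** * Classes of open paths relative to chosen paths from the base point *)

Local Open Scope classical_set_scope.
Local Open Scope ring_scope.

Section BasedClasses.
Variables (R : realType) (X : topologicalType) (b : X).
Variable delta : forall x, path R b x.
Local Notation B := (pi1 R b).

Definition loop_of (p : path R b b) : loop R b :=
  Loop (@path_continuous _ _ _ _ p) (path0 p) (path1 p).

(** [delta] is an arbitrary choice of paths from the base point; in particular [delta b] may be a
    nontrivial loop. *)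
Definition based_class x y (p : path R x y) : B :=
  pi1_class (loop_of (pconcat (delta x) (pconcat p (preverse (delta y))))).

Lemma based_class_homotopic x y (p q : path R x y) :
  path_homotopic p q -> based_class p = based_class q.
Proof.
move=> pq; apply/pi1_classP.
have hpq : path_homotopic (pconcat (delta x) (pconcat p (preverse (delta y))))
    (pconcat (delta x) (pconcat q (preverse (delta y)))).
  by apply: pconcat_homotopic; [|apply: pconcat_homotopic => //];
    exact: path_homotopic_refl.
exact: hpq.
Qed.

(** Compares paths whose endpoints are equal without being convertible. *)
Lemma based_class_ext x y x' y' (p : path R x y) (q : path R x' y') :
  (forall t, 0 <= t <= 1 -> p t = q t) -> based_class p = based_class q.
Proof.
move=> pq.
have xx' : x = x' by rewrite -(path0 p) -(path0 q) pq // lexx ler01.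
have yy' : y = y' by rewrite -(path1 p) -(path1 q) pq // lexx ler01.
subst; exact/based_class_homotopic/homotopic_ext.
Qed.

Lemma based_class_concat x y z (p : path R x y) (q : path R y z) :
  based_class (pconcat p q) = (based_class p * based_class q)%g.
Proof.
rewrite /based_class; set l1 := loop_of _; set l2 := loop_of (pconcat _ (pconcat p _)).
set l3 := loop_of _.
have -> : (pi1_class l2 * pi1_class l3)%g = pi1_class (Defs.concat l2 l3) by exact: pi1_mulE.
apply/pi1_classP/homotopic_sym.
set dx := delta x; set dy := delta y; set dz := preverse (delta z).
have tr := path_homotopic_trans; have rf := path_homotopic_refl.
have cg := pconcat_homotopic.
suff h : path_homotopic (pconcat (pconcat dx (pconcat p (preverse dy)))
    (pconcat dy (pconcat q dz))) (pconcat dx (pconcat (pconcat p q) dz)).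
  exact: h.
apply: (tr _ _ _ _ _ _ _ (pconcatA _ _ _)).
apply: (cg); first exact: rf.
apply: (tr _ _ _ _ _ _ _ (pconcatA _ _ _)).
apply: (tr _ _ _ _ _ _ _ _ (path_homotopic_sym (pconcatA _ _ _))).
apply: (cg); first exact: rf.
apply: (tr _ _ _ _ _ _ _ (path_homotopic_sym (pconcatA _ _ _))).
apply: (tr _ _ _ _ _ _ _ _ (pconst_concat _)).
by apply: (cg); [exact: preverse_concat | exact: rf].
Qed.

Lemma based_class_surj (g : B) : exists p : path R b b, based_class p = g.
Proof.
pose d := pi1_class (loop_of (delta b)).
(* On loops, [based_class] conjugates by the class d of [delta b], so the representative is taken in
   the conjugate class. *)
have [l hl] : exists l : loop R b, pi1_class l = (d^-1 * g * d)%g.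
  by exists (pi1_repr (d^-1 * g * d)%g); exact: pi1_reprK.
pose p : path R b b := Path (@loop_continuous _ _ _ l) (loop0 l) (loop1 l).
exists p.
have -> : g = (d * (pi1_class l * d^-1))%g by rewrite hl !mulgA mulgK mulgV mul1g.
have -> : (d^-1)%g = pi1_class (Defs.reverse (loop_of (delta b))) by exact: pi1_invE.
have -> : (pi1_class l * pi1_class (Defs.reverse (loop_of (delta b))))%g =
  pi1_class (Defs.concat l (Defs.reverse (loop_of (delta b)))) by exact: pi1_mulE.
have -> : (d * pi1_class (Defs.concat l (Defs.reverse (loop_of (delta b)))))%g =
  pi1_class (Defs.concat (loop_of (delta b)) (Defs.concat l (Defs.reverse (loop_of (delta b))))).
  exact: pi1_mulE.
by apply/pi1_classP; exact: homotopic_refl.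
Qed.

End BasedClasses.

(** * Restriction of a path to a subinterval *)

Section Subpath.
Variables (R : realType) (X : topologicalType) (x y : X) (p : path R x y).
Local Notation I := (`[0%R, 1%R]%classic : set R).

Lemma subpath_continuous (s t : R) : I s -> I t ->
  {within I, continuous (fun u => p (s + u * (t - s)))}.
Proof.
move=> /itv01P hs /itv01P ht.
apply: (@within_comp _ _ _ I I (fun u : R => s + u * (t - s))).
- apply: continuous_subspaceT => u; apply: cvgD; first exact: cvg_cst.
  by apply: cvgM; [exact: cvg_id | exact: cvg_cst].
- exact: path_continuous.
- by move=> u /itv01P hu; apply/itv01P; nra.
Qed.

Lemma subpath0 (s t : R) : p (s + 0 * (t - s)) = p s.
Proof. by rewrite mul0r addr0. Qed.
Lemma subpath1 (s t : R) : p (s + 1 * (t - s)) = p t.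
Proof. by rewrite mul1r addrC subrK. Qed.

Definition subpath s t (hs : I s) (ht : I t) : path R (p s) (p t) :=
  Path (subpath_continuous hs ht) (subpath0 s t) (subpath1 s t).

Lemma subpath_concat s t u (hs : I s) (ht : I t) (hu : I u) :
  s <= t -> t <= u ->
  path_homotopic (pconcat (subpath hs ht) (subpath ht hu)) (subpath hs hu).
Proof.
move=> st tu; have /itv01P hs' := hs; have /itv01P hu' := hu.
have cmax (f g : R -> R) : continuous f -> continuous g ->
    continuous (fun t => Num.max (f t) (g t)).
  by move=> cf cg v; apply: continuous_max; [exact: cf | exact: cg].
have c2 : continuous (fun v : R => 2 * v).
  by move=> v; apply: cvgM; [exact: cvg_cst | exact: cvg_id].
(* The first parameter runs from s to t in the first half and from t to u in the second; the other
   one is affine. *)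
apply: (@homotopic_reparametrized _ _ _ _ _ _ p _ _
  (fun v => s + Num.min (2 * v) 1 * (t - s) + Num.max (2 * v - 1) 0 * (u - t))
  (fun v => s + v * (u - s))).
- move=> v; apply: cvgD; [apply: cvgD; [exact: cvg_cst|]|]; apply: cvgM;
    try exact: cvg_cst.
    by apply: continuous_min; [exact: c2 | exact: cvg_cst].
  apply: (cmax (fun v => 2 * v - 1) (fun=> 0)) => w; last exact: cvg_cst.
  by apply: cvgB; [exact: c2 | exact: cvg_cst].
- move=> v; apply: cvgD; first exact: cvg_cst.
  by apply: cvgM; [exact: cvg_id | exact: cvg_cst].
- by move=> v hv; case: (leP (2 * v) 1) => h; case: (leP (2 * v - 1) 0) => h';
    try (by exfalso; lra); nra.
- by move=> v hv; nra.
- by case: (leP (2 * 0) 1) => h; case: (leP (2 * 0 - 1) 0) => h'; lra.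
- by case: (leP (2 * 1) 1) => h; case: (leP (2 * 1 - 1) 0) => h'; lra.
- move=> v hv /=; rewrite /concat_fun /=.
  case: (leP (2 * v) 1) => h; case: (leP (2 * v - 1) 0) => h'; case: ifPn => h'';
    try (by exfalso; move: h''; rewrite -?ltNge => h''; lra);
    by congr path_fun; lra.
- by [].
Qed.

End Subpath.

(** * Straight motions *)

Local Open Scope classical_set_scope.
Local Open Scope ring_scope.

Section Barycenters.
Variables (R : realFieldType) (m N : nat) (P : 'I_N -> R * R).
Local Notation V := ('I_m -> R * R).

Definition bary (a b c : V) (s t : R) : V := fun i =>
  ((a i).1 + s * ((b i).1 - (a i).1) + t * ((c i).1 - (a i).1),
   (a i).2 + s * ((b i).2 - (a i).2) + t * ((c i).2 - (a i).2)).

Definition lin (a b : V) (t : R) : V := fun i =>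
  ((a i).1 + t * ((b i).1 - (a i).1), (a i).2 + t * ((b i).2 - (a i).2)).

Lemma mix_gt0 (x y z s t : R) : 0 < x -> 0 < y -> 0 < z -> 0 <= s -> 0 <= t ->
  s + t <= 1 -> 0 < x + s * (y - x) + t * (z - x).
Proof.
move=> x0 y0 z0 s0 t0 st1.
have -> : x + s * (y - x) + t * (z - x) = (1 - s - t) * x + s * y + t * z by ring.
have h1 : 0 <= (1 - s - t) * x by apply: mulr_ge0; lra.
have h2 : 0 <= s * y by apply: mulr_ge0; lra.
have h3 : 0 <= t * z by apply: mulr_ge0; lra.
have [s0'|s0'] := ltP 0 s.
  by have : 0 < s * y by [exact: mulr_gt0]; lra.
have [t0'|t0'] := ltP 0 t.
  by have : 0 < t * z by [exact: mulr_gt0]; lra.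
have : 0 < (1 - s - t) * x by apply: mulr_gt0 => //; lra.
by lra.
Qed.

(** In a direction that separates two points at all three vertices, their difference is a convex
    combination of positive numbers. *)
Lemma bary_conf (A : V -> Prop) a b c s t : coherent P A -> A a -> A b -> A c ->
  0 <= s -> 0 <= t -> s + t <= 1 -> in_conf P (bary a b c s t).
Proof.
move=> [h1 h2] Aa Ab Ac s0 t0 st1.
have key (d : dir) (p1 p2 p3 q1 q2 q3 : R * R) :
    towards d p1 q1 -> towards d p2 q2 -> towards d p3 q3 ->
    (p1.1 + s * (p2.1 - p1.1) + t * (p3.1 - p1.1),
     p1.2 + s * (p2.2 - p1.2) + t * (p3.2 - p1.2)) <>
    (q1.1 + s * (q2.1 - q1.1) + t * (q3.1 - q1.1),
     q1.2 + s * (q2.2 - q1.2) + t * (q3.2 - q1.2)).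
  move=> H1 H2 H3 [E1 E2]; move: H1 H2 H3; case: d => /= H1 H2 H3.
  - have := @mix_gt0 (q1.1 - p1.1) (q2.1 - p2.1) (q3.1 - p3.1) s t.
    by rewrite !subr_gt0 => /(_ H1 H2 H3 s0 t0 st1); lra.
  - have := @mix_gt0 (p1.1 - q1.1) (p2.1 - q2.1) (p3.1 - q3.1) s t.
    by rewrite !subr_gt0 => /(_ H1 H2 H3 s0 t0 st1); lra.
  - have := @mix_gt0 (q1.2 - p1.2) (q2.2 - p2.2) (q3.2 - p3.2) s t.
    by rewrite !subr_gt0 => /(_ H1 H2 H3 s0 t0 st1); lra.
  - have := @mix_gt0 (p1.2 - q1.2) (p2.2 - q2.2) (p3.2 - q3.2) s t.
    by rewrite !subr_gt0 => /(_ H1 H2 H3 s0 t0 st1); lra.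
split=> [i j /h1[d hd]|i k].
  by apply: (key d); exact: hd.
have [d hd] := h2 i k; rewrite /bary.
have := key d _ _ _ (P k) (P k) (P k) (hd _ Aa) (hd _ Ab) (hd _ Ac).
by rewrite !subrr !mulr0 !addr0 => h; case: (P k) h.
Qed.

Lemma linE a b t : lin a b t = bary a b a t 0.
Proof. by apply/funext => i; rewrite /bary !mul0r !addr0. Qed.

Lemma lin_conf (A : V -> Prop) a b t : coherent P A -> A a -> A b -> 0 <= t <= 1 ->
  in_conf P (lin a b t).
Proof.
by move=> cA Aa Ab /andP[t0 t1]; rewrite linE; apply: (bary_conf cA) => //; rewrite addr0.
Qed.

Lemma lin0 a b : lin a b 0 = a.
Proof. by apply/funext => i; rewrite /lin !mul0r !addr0; case: (a i). Qed.

Lemma lin1 a b : lin a b 1 = b.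
Proof. by apply/funext => i; rewrite /lin !mul1r !(addrC (a i).1) !(addrC (a i).2) !subrK; case: (b i). Qed.

Lemma coherent_conf (A : V -> Prop) (a : V) : coherent P A -> A a -> in_conf P a.
Proof.
by move=> cA Aa; rewrite -(lin0 a a); apply: (lin_conf cA) => //; rewrite lexx ler01.
Qed.

Lemma in_conf_relabel s (a : V) : in_conf P (relabel s a) <-> in_conf P a.
Proof.
have one s' (a' : V) : in_conf P a' -> in_conf P (relabel s' a').
  move=> [h1 h2]; split=> [i j ij|i k]; rewrite /relabel //.
  by apply: h1; rewrite (inj_eq perm_inj).
split; last exact: one.
move=> /(one s^-1%g); congr in_conf; apply/funext => i.
by rewrite /relabel permKV.
Qed.

Lemma box_relabel s (c : V) r (a : V) : box c r a -> box (relabel s c) r (relabel s a).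
Proof. by move=> h i; exact: h. Qed.

Lemma clear_radius_relabel s (c : V) r : clear_radius P c r -> clear_radius P (relabel s c) r.
Proof.
move=> [r0 h1 h2]; split=> // [i j ij|i k]; rewrite /relabel //.
by apply: h1; rewrite (inj_eq perm_inj).
Qed.

(** Strands of a clear box cannot take each other's place, since their boxes are disjoint. The box
    is thus a sheet over the unordered configurations, on which lifts are unique. *)
Lemma box_relabel_uniq s (c : V) r (a : V) : clear_radius P c r -> box c r a ->
  box c r (relabel s a) -> relabel s a = a.
Proof.
move=> [_ h1 _] ba bsa; suff -> : s = 1%g by apply/funext => i; rewrite /relabel perm1.
apply/permP => i; rewrite perm1; apply/eqP; apply: contraT => si.
have [] := ba (s i); have [] := bsa i; rewrite /relabel !ltr_norml.
by have := h1 _ _ si; rewrite !ler_normr; lra.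
Qed.

Lemma box_sub (c : V) r (a : V) d : 0 < d -> box c r a ->
  exists2 r', 0 < r' < d & forall y, box a r' y -> box c r y.
Proof.
move=> d0 ba.
pose s1 := [seq r - `|(a i).1 - (c i).1| | i <- enum 'I_m].
pose s2 := [seq r - `|(a i).2 - (c i).2| | i <- enum 'I_m].
have [r' hr' hs] := small_pos (s1 ++ s2) d0.
exists r' => // y hy i; have [b1 b2] := ba i; have [y1 y2] := hy i.
have m1 : r - `|(a i).1 - (c i).1| \in s1 by apply/mapP; exists i; rewrite ?mem_enum.
have m2 : r - `|(a i).2 - (c i).2| \in s2 by apply/mapP; exists i; rewrite ?mem_enum.
have {}m1 : r' < r - `|(a i).1 - (c i).1|.
  by apply: hs; rewrite ?mem_cat ?m1 ?subr_gt0.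
have {}m2 : r' < r - `|(a i).2 - (c i).2|.
  by apply: hs; rewrite ?mem_cat ?m2 ?orbT ?subr_gt0.
have t1 := ler_distD (a i).1 (y i).1 (c i).1.
have t2 := ler_distD (a i).2 (y i).2 (c i).2.
by split; lra.
Qed.

End Barycenters.

(** * Classes of straight motions and their chains *)

Section Plane.
Variables (R : realType) (m N : nat) (P : 'I_N -> R * R).
Local Notation V := ('I_m -> R * R).
Local Notation I := (`[0%R, 1%R]%classic : set R).
(** [toX] stands for the passage to unordered configurations. On [in_conf] it is continuous, onto,
    open, and injective up to relabelling; these properties stand in for the topology of the
    punctured sphere. *)
Variables (X : topologicalType) (toX : V -> X).
Hypothesis toX_continuous : forall (T : topologicalType) (A : set T) (y : T -> V),
  (forall i, {within A, continuous (fun t => y t i)}) ->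
  (forall t, A t -> in_conf P (y t)) -> {within A, continuous (fun t => toX (y t))}.
Hypothesis toX_surj : forall x, exists2 y, in_conf P y & toX y = x.
Hypothesis toX_relabel : forall s y, toX (relabel s y) = toX y.
Hypothesis toX_inj : forall y y', in_conf P y -> in_conf P y' ->
  toX y = toX y' -> exists s, y' = relabel s y.
Hypothesis toX_open : forall y r, in_conf P y -> 0 < r ->
  nbhs (toX y) (toX @` box y r).

Lemma bary_continuous (T : topologicalType) (A : set T) (a b c : T -> V) (s t : T -> R) i :
  {within A, continuous (fun z => a z i)} -> {within A, continuous (fun z => b z i)} ->
  {within A, continuous (fun z => c z i)} ->
  {within A, continuous s} -> {within A, continuous t} ->
  {within A, continuous (fun z => bary (a z) (b z) (c z) (s z) (t z) i)}.
Proof.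
move=> ca cb cc cs ct z.
have c1 (f : T -> V) : {within A, continuous (fun z => f z i)} ->
    {for z, continuous (fun z : subspace A => (f z i).1)}.
  by move=> cf; apply: (@continuous_comp _ _ _ (fun z : subspace A => f z i) fst);
    [exact: cf | exact: cvg_fst].
have c2 (f : T -> V) : {within A, continuous (fun z => f z i)} ->
    {for z, continuous (fun z : subspace A => (f z i).2)}.
  by move=> cf; apply: (@continuous_comp _ _ _ (fun z : subspace A => f z i) snd);
    [exact: cf | exact: cvg_snd].
have comb (f g h : T -> R) : {for z, continuous (f : subspace A -> R)} ->
    {for z, continuous (g : subspace A -> R)} ->
    {for z, continuous (h : subspace A -> R)} ->
    {for z, continuous ((fun z => f z + s z * (g z - f z) + t z * (h z - f z)) :
      subspace A -> R)}.
  move=> cf cg ch; apply: cvgD; [apply: cvgD; [exact: cf|]|]; apply: cvgM;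
    [exact: cs | exact: cvgB | exact: ct | exact: cvgB].
exact: (cvg_pair (comb _ _ _ (c1 _ ca) (c1 _ cb) (c1 _ cc))
  (comb _ _ _ (c2 _ ca) (c2 _ cb) (c2 _ cc))).
Qed.

Lemma segment_continuous a b : (forall t, 0 <= t <= 1 -> in_conf P (lin a b t)) ->
  {within I, continuous (fun t => toX (lin a b t))}.
Proof.
move=> hab; apply: toX_continuous => [i|t /itv01P]; last exact: hab.
have -> : (fun t => lin a b t i) = (fun t => bary a b a t 0 i).
  by apply/funext => t; rewrite linE.
by apply: (@bary_continuous _ _ (fun=> a) (fun=> b) (fun=> a) id (fun=> 0));
  apply: continuous_subspaceT => t; [exact: cvg_cst..|exact: cvg_id|exact: cvg_cst].
Qed.

Definition segpath a b (h : forall t, 0 <= t <= 1 -> in_conf P (lin a b t)) :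
    path R (toX a) (toX b) :=
  Path (segment_continuous h) (congr1 toX (lin0 a b)) (congr1 toX (lin1 a b)).

Variables (b : X) (delta : forall x, path R b x).
Local Notation E := (based_class delta).

(** The value 1 is a default for segments with a collision; it does not arise within a coherent
    family. *)
Definition edge (u v : V) : pi1 R b :=
  match pselect (forall t, 0 <= t <= 1 -> in_conf P (lin u v t)) with
  | left h => E (segpath h)
  | right _ => 1%g
  end.

Lemma edgeE u v (h : forall t, 0 <= t <= 1 -> in_conf P (lin u v t)) :
  edge u v = E (segpath h).
Proof.
by rewrite /edge; case: pselect => // h'; apply: based_class_ext.
Qed.

Lemma edge_relabel s u v : edge (relabel s u) (relabel s v) = edge u v.
Proof.
have linR t : lin (relabel s u) (relabel s v) t = relabel s (lin u v t) by [].
have [h|h] := pselect (forall t, 0 <= t <= 1 -> in_conf P (lin u v t)).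
  have h' t : 0 <= t <= 1 -> in_conf P (lin (relabel s u) (relabel s v) t).
    by move=> /h; rewrite linR in_conf_relabel.
  rewrite (edgeE h) (edgeE h'); apply: based_class_ext => t _ /=.
  by rewrite linR toX_relabel.
rewrite /edge; case: pselect => [h'|_]; last by case: pselect.
by case: h => t /h'; rewrite linR in_conf_relabel.
Qed.

Lemma edge_coherent (A : V -> Prop) u v w : coherent P A -> A u -> A v -> A w ->
  (edge u v * edge v w)%g = edge u w.
Proof.
move=> cA Au Av Aw.
have hL p q : A p -> A q -> forall t, 0 <= t <= 1 -> in_conf P (lin p q t).
  by move=> Ap Aq t; apply: (lin_conf cA).
rewrite (edgeE (hL _ _ Au Av)) (edgeE (hL _ _ Av Aw)) (edgeE (hL _ _ Au Aw)).
rewrite -based_class_concat; apply: based_class_homotopic.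
(* In barycentric coordinates the broken path through v has weight [f t - g t] at v and [g t] at w,
   the direct one has 0 and t. The homotopy interpolates linearly between the weights. *)
pose f (t : R) : R := Num.min (2 * t) 1.
pose g (t : R) : R := Num.max (2 * t - 1) 0.
have cf : continuous f.
  move=> t; apply: continuous_min; last exact: cvg_cst.
  by apply: cvgM; [exact: cvg_cst | exact: cvg_id].
have cg : continuous g.
  have cmax (f1 f2 : R -> R) : continuous f1 -> continuous f2 ->
      continuous (fun t => Num.max (f1 t) (f2 t)).
    by move=> cf1 cf2 x; apply: continuous_max; [exact: cf1 | exact: cf2].
  apply: (cmax (fun t => 2 * t - 1) (fun=> 0)) => t; last exact: cvg_cst.
  apply: cvgB; last exact: cvg_cst.
  by apply: cvgM; [exact: cvg_cst | exact: cvg_id].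
have cf1 : continuous (fun z : R * R => f z.1).
  by move=> z; apply: (@continuous_comp _ _ _ fst f); [exact: cvg_fst | exact: cf].
have cg1 : continuous (fun z : R * R => g z.1).
  by move=> z; apply: (@continuous_comp _ _ _ fst g); [exact: cvg_fst | exact: cg].
have fgP t : 0 <= t <= 1 -> [/\ 0 <= g t, g t <= f t & f t <= 1].
  by move=> ht; rewrite /f /g; case: (leP (2 * t) 1) => h; case: (leP (2 * t - 1) 0) => h'; split; lra.
exists (fun z => toX (bary u v w ((1 - z.2) * (f z.1 - g z.1))
  ((1 - z.2) * g z.1 + z.2 * z.1))).
split.
- apply: toX_continuous => [i|[t s] [/itv01P/= ht /itv01P/= hs]]; last first.
    have [g0 gf f1] := fgP t ht.
    by apply: (bary_conf cA) => //; nra.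
  apply: (@bary_continuous _ _ (fun=> u) (fun=> v) (fun=> w));
    apply: continuous_subspaceT; try by move=> ?; exact: cvg_cst.
    move=> z; apply: cvgM; first by apply: cvgB; [exact: cvg_cst | exact: cvg_snd].
    by apply: cvgB; [exact: cf1 | exact: cg1].
  move=> z; apply: cvgD; last by apply: cvgM; [exact: cvg_snd | exact: cvg_fst].
  apply: cvgM; last exact: cg1.
  by apply: cvgB; [exact: cvg_cst | exact: cvg_snd].
- move=> t /itv01P ht /=; rewrite /concat_fun subr0 !mul1r mul0r addr0 /f /g.
  case: ifPn => h; congr toX; apply/funext => i; rewrite /bary /lin.
    have -> : Num.min (2 * t) 1 = 2 * t by apply/min_idPl; lra.
    have -> : Num.max (2 * t - 1) 0 = 0 by apply/max_idPr; lra.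
    by rewrite subr0 !mul0r !addr0.
  move: h; rewrite -ltNge => h.
  have -> : Num.min (2 * t) 1 = 1 by apply/min_idPr; lra.
  have -> : Num.max (2 * t - 1) 0 = 2 * t - 1 by apply/max_idPl; lra.
  by congr pair; ring.
- move=> t /itv01P ht /=; congr toX; apply/funext => i.
  by rewrite /bary /lin subrr !mul0r !mul1r add0r !addr0.
- move=> s /itv01P hs /=; split.
    have -> : f 0 = 0 by rewrite /f mulr0; apply/min_idPl; lra.
    have -> : g 0 = 0 by rewrite /g; apply/max_idPr; lra.
    congr toX; apply/funext => i; rewrite /bary subrr !mulr0 addr0 !mul0r !addr0.
    by case: (u i).
  have -> : f 1 = 1 by rewrite /f; apply/min_idPr; lra.
  have -> : g 1 = 1 by rewrite /g (_ : 2 * 1 - 1 = 1) ?(max_idPl ler01) //; lra.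
  congr toX; apply/funext => i; rewrite /bary subrr mulr0 !mul0r !addr0 !mulr1 subrK !mul1r.
  by rewrite !(addrC (u i).1) !(addrC (u i).2) !subrK; case: (w i).
Qed.

(** Over a clear box the path lifts uniquely to labelled configurations. The lift is pushed affinely
    onto the segment between its ends, inside the convex box. *)
Lemma local_segment x y (p : path R x y) c r s t (hs : I s) (ht : I t) a :
  clear_radius P c r -> in_conf P c -> s <= t ->
  (forall u, s <= u <= t -> exists2 z, box c r z & toX z = p u) ->
  box c r a -> toX a = p s ->
  exists a', [/\ box c r a', toX a' = p t & E (subpath p hs ht) = edge a a'].
Proof.
move=> hr cc st lift ba ap.
have /itv01P hs' := hs; have /itv01P ht' := ht.
have cA := box_coherent hr.
have r0 : 0 < r by have [] := hr.
pose l (u : R) : V := match pselect (exists2 z, box c r z & toX z = p u) with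
  left h => projT1 (cid2 h) | right _ => a end.
have lP u : s <= u <= t -> box c r (l u) /\ toX (l u) = p u.
  move=> /lift h; rewrite /l; case: pselect => // h'.
  by case: (cid2 h') => z.
have uniq z z' : box c r z -> box c r z' -> toX z = toX z' -> z = z'.
  move=> bz bz' zz'; have [] := toX_inj _ _ zz'; try exact: (coherent_conf cA).
  by move=> q E'; move: bz'; rewrite E' => /(box_relabel_uniq hr bz) ->.
pose q := subpath p hs ht.
pose w (u : R) : V := l (s + u * (t - s)).
have wP u : 0 <= u <= 1 -> box c r (w u) /\ toX (w u) = q u.
  by move=> hu; apply: lP; nra.
have h00 : 0 <= (0 : R) <= 1 by rewrite ler01 lexx.
have w0 : w 0 = a.
  apply: uniq => //; first by have [] := wP 0 h00.
  by rewrite (wP 0 h00).2 path0.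
(* The lift is continuous because [toX] is open and the representative in the box is unique. *)
have cw i : {within I, continuous (fun u => w u i)}.
  apply/subspace_continuousP => u Iu; have /itv01P hu := Iu.
  have [bu wu] := wP _ hu.
  have := @path_continuous _ _ _ _ q => /subspace_continuousP/(_ u Iu) cq.
  have near_box d : 0 < d -> \forall v \near within I (nbhs u), box (w u) d (w v).
    move=> d0; have [d' /andP[d'0 d'd] sub] := box_sub d0 bu.
    have := toX_open (coherent_conf cA bu) d'0; rewrite wu => /cq h.
    have hI : \forall v \near within I (nbhs u), I v by exact: withinT.
    near=> v.
    have /= [z bz zq] : (toX @` box (w u) d') (q v) by near: v.
    have /itv01P hv : I v by near: v.
    have [bv wv] := wP _ hv.
    have <- : z = w v by apply: uniq; [exact: sub|exact: bv|rewrite wv].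
    by move=> j; have [z1 z2] := bz j; split; lra.
  have h1 : (fun v => (w v i).1) @ within I (nbhs u) --> (w u i).1.
    apply/cvgrPdist_lt => d d0; near=> v.
    have /(_ i)[hb _] : box (w u) d (w v) by near: v; exact: near_box.
    by rewrite distrC.
  have h2 : (fun v => (w v i).2) @ within I (nbhs u) --> (w u i).2.
    apply/cvgrPdist_lt => d d0; near=> v.
    have /(_ i)[_ hb] : box (w u) d (w v) by near: v; exact: near_box.
    by rewrite distrC.
  have h : (fun v => ((w v i).1, (w v i).2)) @ within I (nbhs u) -->
    ((w u i).1, (w u i).2) by exact: (cvg_pair h1 h2).
  have E2 : (fun v => ((w v i).1, (w v i).2)) = (fun v => w v i).
    by apply/funext => v; rewrite -surjective_pairing.
  by rewrite E2 -surjective_pairing in h.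
have h01 : 0 <= (1 : R) <= 1 by rewrite ler01 lexx.
have [b1 w1] := wP 1 h01.
exists (w 1); split=> //; first by rewrite w1 path1.
have hL v : 0 <= v <= 1 -> in_conf P (lin a (w 1) v) by apply: (lin_conf cA).
rewrite (edgeE hL); pose sg := segpath hL.
have q0 : q 0 = toX a by rewrite path0.
have q1 : q 1 = toX (w 1) by rewrite path1 w1 path1.
pose q' : path R (toX a) (toX (w 1)) := Path (@path_continuous _ _ _ _ q) q0 q1.
have -> : E q = E q' by exact: based_class_ext.
apply: based_class_homotopic.
exists (fun z => toX (bary (w z.1) a (w 1) (z.2 * (1 - z.1)) (z.2 * z.1))); split.
- apply: toX_continuous => [i|[u v] [/itv01P/= hu /itv01P/= hv]]; last first.
    by apply: (bary_conf cA); [exact: (wP _ hu).1|exact: ba|exact: b1|nra|nra|nra].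
  apply: (@bary_continuous _ _ (fun z => w z.1) (fun=> a) (fun=> w 1)).
  + apply: (@within_comp _ _ _ _ I (fun z : R * R => z.1)) (cw i) _.
      by apply: continuous_subspaceT => ?; exact: cvg_fst.
    by move=> ? [].
  + by apply: continuous_subspaceT => ?; exact: cvg_cst.
  + by apply: continuous_subspaceT => ?; exact: cvg_cst.
  + apply: continuous_subspaceT => z; apply: cvgM; first exact: cvg_snd.
    by apply: cvgB; [exact: cvg_cst | exact: cvg_fst].
  + by apply: continuous_subspaceT => z; apply: cvgM; [exact: cvg_snd|exact: cvg_fst].
- move=> u /itv01P hu; rewrite -[RHS](wP _ hu).2 /=; congr toX; apply/funext => i.
  by rewrite /bary !mul0r !addr0; case: (w u i).
- move=> u _ /=; congr toX; apply/funext => i; rewrite /bary /lin.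
  by congr pair; ring.
- move=> v _ /=; split; congr toX; apply/funext => i; rewrite /bary.
    by rewrite w0 !subrr !(mulr0, mul0r, addr0); case: (a i).
  by rewrite !subrr !(mulr0, mul0r, addr0); case: (w 1 i).
Unshelve. all: by end_near. Qed.

(** [W] reads as derivability of an element by motions from u to v. The loop is cut into pieces over
    boxes; each lifted piece is relabelled to start where the previous one ends, and the last end is
    a relabelling of the start. *)
Lemma edge_chain (W : V -> V -> pi1 R b -> Prop) (v0 : V) :
  (forall c r u v, in_conf P c -> clear_radius P c r -> box c r u -> box c r v ->
     W u v (edge u v)) ->
  (forall u v w g h, in_conf P v -> W u v g -> W v w h -> W u w (g * h)%g) ->
  in_conf P v0 -> toX v0 = b ->
  forall g, exists s, W v0 (relabel s v0) g.
Proof.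
move=> Wbox Wtrans cv0 v0b g; have [p <-] := based_class_surj delta g.
pose Q s t := forall (hs : I s) (ht : I t) a, in_conf P a -> toX a = p s ->
  exists a', [/\ in_conf P a', toX a' = p t & W a a' (E (subpath p hs ht))].
have I0 : I (0 : R) by rewrite /= in_itv /= lexx ler01.
have I1 : I (1 : R) by rewrite /= in_itv /= ler01 lexx.
have : Q 0 1.
  apply: interval_additive => [t ht|s t u s0 st tu u1 Qst Qtu hs hu a ca ap].
    have It : I t by apply/itv01P.
    have [c cc cp] := toX_surj (p t).
    have [r _ hr] := exists_clear_radius cc ltr01.
    have r0 : 0 < r by have [] := hr.
    have cA := box_coherent hr.
    have := toX_open cc r0; rewrite cp => nb.
    have := @path_continuous _ _ _ _ p => /subspace_continuousP/(_ t It)/(_ _ nb).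
    rewrite /= nbhs_simpl /= => /nbhs_ballP[d /= d0 hd].
    exists d => // s u s0 su u1 sd ud hs hu a ca ap.
    have lift v : s <= v <= u -> exists2 z, box c r z & toX z = p v.
      move=> hv; have bv : ball t d v.
        rewrite /ball /= distrC; move: sd ud; rewrite !ltr_norml; lra.
      have Iv : I v by apply/itv01P; lra.
      by have [z bz zp] := hd v bv Iv; exists z.
    have hss : s <= s <= u by rewrite lexx.
    have [a0 ba0 a0p] := lift s hss.
    have [q aE] := toX_inj (coherent_conf cA ba0) ca (etrans a0p (esym ap)).
    have [a1 [ba1 a1p ->]] := local_segment hs hu hr cc su lift ba0 a0p.
    exists (relabel q a1); split.
    - by apply/in_conf_relabel; exact: (coherent_conf cA).
    - by rewrite toX_relabel.
    - rewrite aE -(edge_relabel q); apply: (Wbox (relabel q c) r).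
      + exact/in_conf_relabel.
      + exact: clear_radius_relabel.
      + exact: box_relabel.
      + exact: box_relabel.
  have ht : I t by apply/itv01P; lra.
  have [a1 [ca1 a1p W1]] := Qst hs ht a ca ap.
  have [a2 [ca2 a2p W2]] := Qtu ht hu a1 ca1 a1p.
  exists a2; split=> //.
  rewrite -(based_class_homotopic delta (subpath_concat p hs ht hu st tu)).
  by rewrite based_class_concat; exact: Wtrans W1 W2.
move=> /(_ I0 I1 v0 cv0 (etrans v0b (esym (path0 p))))[a' [ca' a'b Wg]].
have [s a'E] := toX_inj cv0 ca' (etrans v0b (esym (etrans a'b (path1 p)))).
exists s; rewrite -a'E.
have -> : E p = E (subpath p I0 I1) => //.
by apply: based_class_ext => t _ /=; rewrite add0r subr0 mulr1.
Qed.

End Plane.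

(** * Monodromy *)

Local Open Scope classical_set_scope.
Local Open Scope ring_scope.

Section Holonomy.
Variables (R : realType) (X : topologicalType) (G : groupType) (J : Type).
Variables (U : J -> X -> Prop) (F : J -> X -> G).
Hypothesis U_cover : forall x, exists j, U j x.
Hypothesis F_locally_constant : forall x j k, U j x -> U k x ->
  \forall y \near x, U j y /\ ((F j y)^-1 * F k y = (F j x)^-1 * F k x)%g.
Local Notation I := (`[0%R, 1%R]%classic : set R).

(* A lift of f to the covering of X with fibre G glued from the charts F. *)
Definition lifts (f : R -> X) (s t : R) (phi : R -> G) : Prop :=
  forall u j, s <= u <= t -> U j (f u) -> exists2 d, 0 < d &
    forall v, s <= v <= t -> `|v - u| < d ->
      (phi v * F j (f v) = phi u * F j (f u))%g.

(** A lift is determined up to left translation, which cancels in this quotient. *)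
Definition holonomy (f : R -> X) (s t : R) (g : G) : Prop :=
  exists2 phi, lifts f s t phi & g = ((phi s)^-1 * phi t)%g.

(** For two lifts, [phi v * (psi v)^-1] is locally constant, as the chart value cancels. *)
Lemma holonomy_uniq f g h : holonomy f 0 1 g -> holonomy f 0 1 h -> g = h.
Proof.
move=> [phi hphi ->] [psi hpsi ->].
pose Q s t := (phi s * (psi s)^-1 = phi t * (psi t)^-1)%g.
have : Q 0 1.
  apply: interval_additive => [t ht|s t u _ _ _ _]; last by rewrite /Q => ->.
  have [j Uj] := U_cover (f t).
  have [d d0 hd] := hphi t j ht Uj; have [e e0 he] := hpsi t j ht Uj.
  exists (Num.min d e); first by rewrite lt_min d0.
  have key v : 0 <= v <= 1 -> `|v - t| < Num.min d e ->
      (phi v * (psi v)^-1 = phi t * (psi t)^-1)%g.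
    rewrite lt_min => hv /andP[vd ve].
    have := hd v hv vd; have := he v hv ve => E1 E2.
    by rewrite -(mulgKA (F j (f v)) (phi v)) E1 E2 mulgKA.
  move=> s u s0 su u1 sd ud; rewrite /Q !key //; apply/andP; lra.
by rewrite /Q => E; apply: (mulgI (phi 0)); rewrite mulVKg mulgA E mulgVK.
Qed.

Lemma holonomy_trans f s t u g h : s <= t -> t <= u ->
  holonomy f s t g -> holonomy f t u h -> holonomy f s u (g * h)%g.
Proof.
move=> st tu [phi hphi ->] [psi hpsi ->].
(* Left translation by c makes the second lift agree with the first at t. *)
pose c := (phi t * (psi t)^-1)%g.
pose chi v := (if v <= t then phi v else c * psi v)%g.
have chit v : t <= v -> chi v = (c * psi v)%g.
  rewrite /chi le_eqVlt => /orP[/eqP<-|]; first by rewrite lexx mulgVK.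
  by rewrite ltNge => /negPf->.
have chis v : v <= t -> chi v = phi v by rewrite /chi => ->.
exists chi; last by rewrite chis // chit // -!mulgA.
move=> v j /andP[sv vu] Uj.
have [vt|tv|vt] := ltgtP v t.
- have [|d d0 hd] := hphi v j _ Uj; first by rewrite sv ltW.
  exists (Num.min d (t - v)); first by rewrite lt_min d0 subr_gt0.
  move=> w /andP[sw wu]; rewrite lt_min => /andP[wd wv].
  have wt : w <= t by move: wv; rewrite ltr_norml; lra.
  by rewrite (chis w) // (chis v) ?(ltW vt) // hd // sw.
- have [|d d0 hd] := hpsi v j _ Uj; first by rewrite vu ltW.
  exists (Num.min d (v - t)); first by rewrite lt_min d0 subr_gt0.
  move=> w /andP[sw wu]; rewrite lt_min => /andP[wd wv].
  have tw : t <= w by move: wv; rewrite ltr_norml; lra.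
  by rewrite (chit w) // (chit v) ?(ltW tv) // -!mulgA hd // tw.
- subst v.
  have [|d d0 hd] := hphi t j _ Uj; first by rewrite st lexx.
  have [|e e0 he] := hpsi t j _ Uj; first by rewrite tu lexx.
  exists (Num.min d e); first by rewrite lt_min d0.
  move=> w /andP[sw wu]; rewrite lt_min => /andP[wd we].
  have [wt|/ltW tw] := leP w t; first by rewrite (chis w) // (chis t) // hd // sw.
  by rewrite chit // (chit t) // -!mulgA he // tw.
Qed.

Lemma continuous_within_ball (f : R -> X) (t : R) (Q : X -> Prop) :
  {within I, continuous f} -> I t -> (\forall y \near f t, Q y) ->
  exists2 d, 0 < d & forall v, I v -> `|v - t| < d -> Q (f v).
Proof.
move=> cf It nQ; have := cf => /subspace_continuousP/(_ t It)/(_ _ nQ).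
rewrite /= nbhs_simpl /= => /nbhs_ballP[d /= d0 hd].
by exists d => // v Iv vt; apply: hd => //; rewrite /ball /= distrC.
Qed.

Lemma holonomy_chart (f : R -> X) s t j : {within I, continuous f} ->
  0 <= s -> s <= t -> t <= 1 -> (forall v, s <= v <= t -> U j (f v)) ->
  holonomy f s t (F j (f s) * (F j (f t))^-1)%g.
Proof.
move=> cf s0 st t1 Uj.
exists (fun v => (F j (f v))^-1)%g; last by rewrite invgK.
move=> u k hu Uk; have Iu : I u by apply/itv01P; lra.
have [d d0 hd] := continuous_within_ball cf Iu (F_locally_constant (Uj _ hu) Uk).
exists d => // v hv vu; apply: (hd v _ vu).2.
by apply/itv01P; lra.
Qed.

Lemma holonomy_exists (f : R -> X) : {within I, continuous f} ->
  exists g, holonomy f 0 1 g.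
Proof.
move=> cf; apply: (interval_additive (Q := fun s t => exists g, holonomy f s t g)).
  move=> t ht; have It : I t by apply/itv01P.
  have [j Uj] := U_cover (f t).
  have [d d0 hd] := continuous_within_ball cf It (F_locally_constant Uj Uj).
  exists d => // s u s0 su u1 sd ud; exists (F j (f s) * (F j (f u))^-1)%g.
  apply: holonomy_chart => // v hv; apply: (hd v _ _).1.
    by apply/itv01P; lra.
  by move: sd ud; rewrite !ltr_norml; lra.
move=> s t u _ st tu _ [g hg] [h hh]; exists (g * h)%g.
exact: holonomy_trans hg hh.
Qed.

Lemma holonomy_rescale (f f' : R -> X) (a c s t : R) g : 0 < a ->
  (forall v, s <= v <= t -> f' v = f (a * v + c)) -> s <= t ->
  holonomy f (a * s + c) (a * t + c) g -> holonomy f' s t g.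
Proof.
move=> a0 ff' st [phi hphi ->]; exists (fun v => phi (a * v + c)) => //.
move=> u j hu Uj.
have [||d d0 hd] := hphi (a * u + c) j.
- by case/andP: hu => su ut; rewrite !lerD2r !ler_pM2l // su.
- by rewrite -ff'.
exists (d / a); first by rewrite divr_gt0.
move=> v hv vu; rewrite !ff' //; apply: hd.
  by case/andP: hv => sv vt; rewrite !lerD2r !ler_pM2l // sv.
rewrite (_ : a * v + c - (a * u + c) = (v - u) * a); last by ring.
by rewrite normrM (gtr0_norm a0) -ltr_pdivlMr.
Qed.

(** For u near u0 the row u runs through the same charts as the row u0, so its holonomy is locally
    constant in u; [interval_additive] is applied along the row and then again in u. *)
Lemma holonomy_homotopic x y (p q : path R x y) g h : path_homotopic p q ->
  holonomy p 0 1 g -> holonomy q 0 1 h -> g = h.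
Proof.
move=> [H [cH H0 H1 Hb]] hg hh.
have row u : I u -> {within I, continuous (fun t => H (t, u))}.
  move=> Iu; apply: (@within_comp _ _ _ _ (I `*` I) (fun t : R => (t, u))) cH _ => //.
  by apply: continuous_subspaceT; apply: pair_continuous => t; [exact: cvg_id|exact: cvg_cst].
have near2 (t u : R) (Q : X -> Prop) : I t -> I u -> (\forall y \near H (t, u), Q y) ->
    exists2 d, 0 < d & forall t' u', I t' -> I u' -> `|t' - t| < d -> `|u' - u| < d ->
      Q (H (t', u')).
  move=> It Iu nQ; have := cH => /subspace_continuousP/(_ (t, u) (conj It Iu))/(_ _ nQ).
  rewrite /= nbhs_simpl /= => /nbhs_ballP[d /= d0 hd].
  exists d => // t' u' It' Iu' ht' hu'; apply: (hd (t', u')); last by split.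
  by split; rewrite /ball /= distrC.
pose hol u g := holonomy (fun t => H (t, u)) 0 1 g.
have const u0 : I u0 -> exists2 d, 0 < d & forall u u' g g', I u -> I u' ->
    `|u - u0| < d -> `|u' - u0| < d -> hol u g -> hol u' g' -> g = g'.
  move=> Iu0.
  (* The ends of a partial row move with u, so its holonomy is locally constant only after
     normalisation by charts at both ends. For the whole row the ends are fixed and the
     normalisation cancels. *)
  pose Q s t := exists gam : R -> G, exists2 d, 0 < d & (forall u, I u -> `|u - u0| < d ->
      holonomy (fun t => H (t, u)) s t (gam u)) /\
    (forall j k, U j (H (s, u0)) -> U k (H (t, u0)) -> exists2 d', 0 < d' &
      forall u, I u -> `|u - u0| < d' ->
        ((F j (H (s, u)))^-1 * gam u * F k (H (t, u)) =
         (F j (H (s, u0)))^-1 * gam u0 * F k (H (t, u0)))%g).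
  have [] : Q 0 1.
    apply: interval_additive => [t ht|s t u s0 st tu u1].
      have It : I t by apply/itv01P.
      have [k Uk] := U_cover (H (t, u0)).
      have [d d0 hd] := near2 _ _ _ It Iu0 (F_locally_constant Uk Uk).
      exists d => // s v s0 sv v1 sd vd.
      have Is : I s by apply/itv01P; lra.
      have Iv : I v by apply/itv01P; lra.
      exists (fun u => F k (H (s, u)) * (F k (H (v, u)))^-1)%g; exists d => //; split.
        move=> u Iu ud; apply: (@holonomy_chart (fun t => H (t, u))) => //; first exact: row.
        move=> w hw; apply: (hd w u _ Iu _ ud).1; first by apply/itv01P; lra.
        by move: sd vd; rewrite !ltr_norml; lra.
      move=> j l Uj Ul.
      have n0 : `|u0 - u0| < d by rewrite subrr normr0.
      have [d1 d10 h1] := near2 _ _ _ Is Iu0 (F_locally_constant Uj (hd _ _ Is Iu0 sd n0).1).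
      have [d2 d20 h2] := near2 _ _ _ Iv Iu0 (F_locally_constant (hd _ _ Iv Iu0 vd n0).1 Ul).
      exists (Num.min d1 d2); first by rewrite lt_min d10.
      move=> u Iu; rewrite lt_min => /andP[ud1 ud2].
      have z (t' d' : R) : 0 < d' -> `|t' - t'| < d' by move=> ?; rewrite subrr normr0.
      have sp (a b c e : G) : (a * (b * c) * e = (a * b) * (c * e))%g by rewrite !mulgA.
      by rewrite !sp (h1 s u Is Iu (z _ _ d10) ud1).2 (h2 v u Iv Iu (z _ _ d20) ud2).2.
    move=> [g1 [d1 d10 [h1 c1]]] [g2 [d2 d20 [h2 c2]]].
    exists (fun u => g1 u * g2 u)%g; exists (Num.min d1 d2); first by rewrite lt_min d10.
    split=> [v Iv|j l Uj Ul].
      rewrite lt_min => /andP[v1 v2].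
      by apply: holonomy_trans (h1 v Iv v1) (h2 v Iv v2).
    have [k Uk] := U_cover (H (t, u0)).
    have [e1 e10 k1] := c1 j k Uj Uk; have [e2 e20 k2] := c2 k l Uk Ul.
    exists (Num.min e1 e2); first by rewrite lt_min e10.
    move=> v Iv; rewrite lt_min => /andP[v1 v2].
    have split_mid (a b c d m : G) : (a * (b * c) * d = (a * b * m) * (m^-1 * c * d))%g.
      by rewrite -!mulgA mulKVg.
    by rewrite (split_mid _ _ _ _ (F k (H (t, v)))) k1 // k2 // -split_mid.
  move=> gam [d d0 [hgam cgam]].
  have b0 u : I u -> H (0, u) = x by move=> /Hb[].
  have b1 u : I u -> H (1, u) = y by move=> /Hb[].
  have [j Uj] := U_cover x; have [k Uk] := U_cover y.
  have [||d' d'0 hd'] := cgam j k; rewrite ?b0 ?b1 //.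
  exists (Num.min d d'); first by rewrite lt_min d0.
  have key u e : I u -> `|u - u0| < Num.min d d' -> hol u e -> e = gam u0.
    rewrite lt_min => Iu /andP[ud ud'] he.
    rewrite (holonomy_uniq he (hgam u Iu ud)).
    have := hd' u Iu ud'; rewrite !b0 // !b1 //.
    by move=> /mulIg/mulgI.
  by move=> u u' e e' Iu Iu' ud ud' /(key _ _ Iu ud)-> /(key _ _ Iu' ud')->.
have I0 : I (0 : R) by rewrite /= in_itv /= lexx ler01.
have I1 : I (1 : R) by rewrite /= in_itv /= ler01 lexx.
have hol_ext (f f' : R -> X) e : (forall t, I t -> f t = f' t) ->
    holonomy f 0 1 e -> holonomy f' 0 1 e.
  move=> ff' he; apply: (@holonomy_rescale f f' 1 0) => //.
    by move=> v hv; rewrite mul1r addr0 ff' //; apply/itv01P.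
  by rewrite !addr0 mulr0 mulr1.
have hol0 : hol 0 g by apply: hol_ext hg => t /H0.
have hol1 : hol 1 h by apply: hol_ext hh => t /H1.
pose Q s t := forall e e', hol s e -> hol t e' -> e = e'.
suff : Q 0 1 by apply.
apply: interval_additive => [t ht|s t u s0 st tu u1 Q1 Q2 e e' he he'].
  have It : I t by apply/itv01P.
  have [d d0 hd] := const t It.
  exists d => // s u s0 su u1 sd ud e e'; apply: hd => //; apply/itv01P; lra.
have It : I t by apply/itv01P; lra.
have [m hm] := holonomy_exists (row t It).
by rewrite (Q1 e m he hm) (Q2 m e' hm he').
Qed.

Definition path_holonomy x y (p : path R x y) : G :=
  projT1 (cid (holonomy_exists (@path_continuous _ _ _ _ p))).

Lemma path_holonomyP x y (p : path R x y) : holonomy p 0 1 (path_holonomy p).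
Proof. by rewrite /path_holonomy; case: cid. Qed.

Lemma path_holonomy_homotopic x y (p q : path R x y) :
  path_homotopic p q -> path_holonomy p = path_holonomy q.
Proof. by move=> /holonomy_homotopic; apply; exact: path_holonomyP. Qed.

Lemma path_holonomy_chart x y (p : path R x y) j :
  (forall v, 0 <= v <= 1 -> U j (p v)) ->
  path_holonomy p = (F j x * (F j y)^-1)%g.
Proof.
move=> hU; apply: (holonomy_uniq (path_holonomyP p)).
have := holonomy_chart (@path_continuous _ _ _ _ p) (lexx 0) ler01 (lexx 1) hU.
by rewrite path0 path1.
Qed.

Lemma path_holonomy_concat x y z (p : path R x y) (q : path R y z) :
  path_holonomy (pconcat p q) = (path_holonomy p * path_holonomy q)%g.
Proof.
apply: (holonomy_uniq (path_holonomyP _)).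
apply: (@holonomy_trans _ _ 2^-1); try lra.
  apply: (@holonomy_rescale p _ 2 0) => //; try lra.
    by move=> v hv /=; rewrite /concat_fun addr0 ifT //; lra.
  by rewrite !addr0 mulr0 divff //; exact: path_holonomyP.
apply: (@holonomy_rescale q _ 2 (-1)) => //; try lra.
  move=> v hv /=; rewrite /concat_fun; case: ifPn => // hv'.
  have -> : v = 2^-1 by lra.
  by rewrite divff // subrr path0 path1.
rewrite divff // subrr (_ : 2 * 1 + -1 = 1 :> R); last by ring.
exact: path_holonomyP.
Qed.

Lemma path_holonomy_const x : path_holonomy (pconst R x) = 1%g.
Proof.
by have [j Uj] := U_cover x; rewrite (@path_holonomy_chart _ _ _ j) ?mulgV.
Qed.

Lemma path_holonomyV x y (p : path R x y) :
  path_holonomy (preverse p) = ((path_holonomy p)^-1)%g.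
Proof.
apply/esym/mulg1_eq; apply: (mulIg (path_holonomy p)); rewrite -mulgA.
by rewrite -path_holonomy_concat (path_holonomy_homotopic (preverse_concat p))
  path_holonomy_const mulg1 mul1g.
Qed.

Variables (b : X) (delta : forall x, path R b x).

Definition monodromy (g : pi1 R b) : G :=
  path_holonomy (Path (@loop_continuous _ _ _ (pi1_repr g)) (loop0 _) (loop1 _)).

Lemma monodromyE (p : path R b b) :
  monodromy (pi1_class (loop_of p)) = path_holonomy p.
Proof.
apply: path_holonomy_homotopic.
by have /pi1_classP := pi1_reprK (pi1_class (loop_of p)).
Qed.

Lemma monodromyM g h : (monodromy (g * h) = monodromy g * monodromy h)%g.
Proof.
rewrite /monodromy -path_holonomy_concat; apply: path_holonomy_homotopic.
have : pi1_class (pi1_repr (g * h)%g) = pi1_class (Defs.concat (pi1_repr g) (pi1_repr h)).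
  rewrite pi1_reprK -[in LHS](pi1_reprK g) -[in LHS](pi1_reprK h).
  exact: pi1_mulE.
by move/pi1_classP.
Qed.

(** The auxiliary paths contribute a coboundary, later named [transport]. *)
Lemma monodromy_based x y (p : path R x y) :
  monodromy (based_class delta p) =
  (path_holonomy (delta x) * path_holonomy p * (path_holonomy (delta y))^-1)%g.
Proof.
by rewrite /based_class monodromyE !path_holonomy_concat path_holonomyV mulgA.
Qed.

End Holonomy.

(** * Generation of the braid group *)

Local Open Scope classical_set_scope.
Local Open Scope ring_scope.

Section PlaneGroup.
Variables (R : realType) (m N : nat) (P : 'I_N -> R * R).
Local Notation V := ('I_m -> R * R).
Hypothesis P_height : forall k, -1 < (P k).2 < 1.
Variables (x0 x1 gap : R).
Hypothesis gap_gt0 : 0 < gap.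
Hypothesis x0_left : forall k, x0 + m%:R + gap *+ 4 < (P k).1.
Hypothesis x1_right : forall k, (P k).1 + gap *+ 4 < x1.
Hypothesis P_gap : forall k l : 'I_N, k != l ->
  (P k).1 + gap *+ 4 < (P l).1 \/ (P l).1 + gap *+ 4 < (P k).1.

Variables (X : topologicalType) (toX : V -> X).
Hypothesis toX_continuous : forall (T : topologicalType) (A : set T) (y : T -> V),
  (forall i, {within A, continuous (fun t => y t i)}) ->
  (forall t, A t -> in_conf P (y t)) -> {within A, continuous (fun t => toX (y t))}.
Hypothesis toX_surj : forall x, exists2 y, in_conf P y & toX y = x.
Hypothesis toX_relabel : forall s y, toX (relabel s y) = toX y.
Hypothesis toX_inj : forall y y', in_conf P y -> in_conf P y' ->
  toX y = toX y' -> exists s, y' = relabel s y.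
Hypothesis toX_open : forall y r, in_conf P y -> 0 < r ->
  nbhs (toX y) (toX @` box y r).

Definition joined (x y : X) : Prop := inhabited (path R x y).

Lemma joined_trans x y z : joined x y -> joined y z -> joined x z.
Proof. by move=> [p] [q]; exists; exact: pconcat p q. Qed.

Lemma joined_sym x y : joined x y -> joined y x.
Proof. by move=> [p]; exists; exact: preverse p. Qed.

Lemma joined_coherent A u v : coherent P A -> A u -> A v -> joined (toX u) (toX v).
Proof.
move=> cA Au Av; exists; apply: (segpath toX_continuous) => t.
exact: (lin_conf cA).
Qed.

Lemma coherent_raise u : generic P u -> coherent P (fun y : V => y = u \/ y = raise u).
Proof.
move=> gu; split=> [i j ij|i k].
  by case: (generic_dir gu ij) => h; [exists East|exists West] => ? [->|->].
have := gu.2 i k; rewrite neq_lt => /orP[]h; by [exists East => ? [->|->]|exists West => ? [->|->]].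
Qed.

Lemma coherent_base u : generic P u ->
  coherent P (fun y : V => y = raise u \/ y = base x0 u).
Proof.
move=> gu; split=> [i j ij|i k].
  case: (generic_dir gu ij) => h; [exists East|exists West] => ? [->|->] //=;
  by rewrite ltrD2l ltr_nat rk_lt.
by exists South => ? [->|->] /=; have := P_height k; lra.
Qed.

Definition standard : V := fun i => (x0 + i%:R, 2).

Lemma toX_base u : generic P u -> toX (base x0 u) = toX standard.
Proof.
move=> gu; have [s su] := sort_conf gu.1.
suff <- : relabel s (base x0 u) = standard by rewrite toX_relabel.
by rewrite -base_relabel; apply/funext => i; rewrite /base sorted_rk.
Qed.

(** Three kinds of motion in coherent families: perturb to a generic configuration, raise it, slide
    it to the base. *)
Lemma joined_standard y : in_conf P y -> joined (toX y) (toX standard).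
Proof.
move=> cy; have [r _ hr] := exists_clear_radius cy ltr01.
have r0 : 0 < r by have [] := hr.
have [u [bu _ gu _]] := perturb P y [::] r0.
apply: (joined_trans (joined_coherent (box_coherent hr) (box_center _ r0) bu)).
apply: (joined_trans (joined_coherent (coherent_raise gu) (or_introl erefl) (or_intror erefl))).
rewrite -(toX_base gu).
exact: joined_coherent (coherent_base gu) (or_introl erefl) (or_intror erefl).
Qed.

Lemma exists_paths (b : X) : exists delta : forall x, path R b x, True.
Proof.
suff h x : exists p : path R b x, True by exists (fun x => projT1 (cid (h x))).
have [y cy <-] := toX_surj b; have [z cz <-] := toX_surj x.
have [p] := joined_trans (joined_standard cy) (joined_sym (joined_standard cz)).
by exists p.
Qed.

Variables (b : X) (delta : forall x, path R b x).
Local Notation e := (edge toX_continuous delta).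

Let e_coherent A : coherent P A -> forall u v w, A u -> A v -> A w ->
  (e u v * e v w)%g = e u w.
Proof. by move=> cA u v w; exact: edge_coherent. Qed.
Let e_relabel s u v : e (relabel s u) (relabel s v) = e u v.
Proof. exact: edge_relabel. Qed.

Variable H : pi1 R b -> Prop.
Hypothesis H1 : H 1%g.
Hypothesis HM : forall x y, H x -> H y -> H (x * y)%g.
Hypothesis HV : forall x, H x -> H (x^-1)%g.
Hypothesis H_sig : forall r, (r.+1 < m)%N -> H (sig x0 e r).
Hypothesis H_rho : forall (i : 'I_m) k, H (rho P x0 x1 gap e i k).

Local Notation gau := (gauge x0 e).

Theorem sig_rho_generate g : H g.
Proof.
have box_ge c r u v : clear_radius P c r -> box c r u -> box c r v ->
    generic P u -> generic P v -> H (ge x0 e u v).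
  exact: (H_box P_height gap_gt0 x0_left x1_right P_gap e_relabel e_coherent H1 HM HV H_sig H_rho).
(* The vertices of a chain may fail to be generic, so H is tested after moving both ends to nearby
   generic configurations and closing up with the gauge. Quantifying over all such choices makes W
   composable. *)
pose W u v g := forall r r' u' v', clear_radius P u r -> clear_radius P v r' ->
  box u r u' -> box v r' v' -> generic P u' -> generic P v' ->
  H (gau u' * e u' u * g * e v v' * (gau v')^-1)%g.
have Wbox c r u v : in_conf P c -> clear_radius P c r -> box c r u -> box c r v ->
    W u v (e u v).
  move=> cc hc bu bv ru rv u' v' hu hv bu' bv' gu' gv'.
  have near_ (w : V) rw : clear_radius P w rw -> box c r w ->
      exists w', [/\ box w rw w', box c r w' & generic P w'].
    move=> hw bw; have rw0 : 0 < rw by have [] := hw.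
    have [r' /andP[r'0 r'rw] sub] := box_sub rw0 bw.
    have [w' [bw' _ gw' _]] := perturb P w [::] r'0.
    exists w'; split=> //; last exact: sub.
    by move=> i; have [] := bw' i; split; lra.
  have [u2 [bu2 cu2 gu2]] := near_ _ _ hu bu.
  have [v2 [bv2 cv2 gv2]] := near_ _ _ hv bv.
  have ru0 : 0 < ru by have [] := hu.
  have rv0 : 0 < rv by have [] := hv.
  have E1 := e_coherent (box_coherent hu) bu' bu2 (box_center _ ru0).
  have E2 := e_coherent (box_coherent hv) (box_center _ rv0) bv2 bv'.
  have E3 := e_coherent (box_coherent hc) cu2 bu bv.
  have E4 := e_coherent (box_coherent hc) cu2 bv cv2.
  have -> : (gau u' * e u' u * e u v * e v v' * (gau v')^-1)%g =
      (ge x0 e u' u2 * (ge x0 e u2 v2 * ge x0 e v2 v'))%g.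
    rewrite /ge -E1 -E2 -E4 -E3.
    move: (gau u') (gau v') (gau u2) (gau v2) => a1 a2 a3 a4.
    by rewrite !mulgA !mulgKV.
  by apply: HM; [exact: box_ge hu _ _ _ _|apply: HM;
    [exact: box_ge hc _ _ _ _|exact: box_ge hv _ _ _ _]].
have Wtrans u v w g1 h : in_conf P v -> W u v g1 -> W v w h -> W u w (g1 * h)%g.
  move=> cv Wuv Wvw ru rw u' w' hu hw bu' bw' gu' gw'.
  have [r _ hr] := exists_clear_radius cv ltr01.
  have r0 : 0 < r by have [] := hr.
  have [v' [bv' _ gv' _]] := perturb P v [::] r0.
  have := HM (Wuv _ _ _ _ hu hr bu' bv' gu' gv') (Wvw _ _ _ _ hr hw bv' bw' gv' gw').
  have bv := box_center v r0.
  have E1 : (e v v' * e v' v = 1)%g.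
    rewrite (e_coherent (box_coherent hr)) //.
    by apply: (@mulgI _ (e v v)); rewrite (e_coherent (box_coherent hr)) // mulg1.
  move: (gau u') (gau v') (gau w') => a1 a2 a3.
  by rewrite !mulgA mulgKV -(mulgA _ (e v v')) E1 mulg1.
have [v0 cv0 v0b] := toX_surj b.
have [r _ hr] := exists_clear_radius cv0 ltr01.
have r0 : 0 < r by have [] := hr.
have [v' [bv' _ gv' _]] := perturb P v0 [::] r0.
have E1 : (e v0 v' = (e v' v0)^-1)%g.
  apply/esym/mulg1_eq; rewrite (e_coherent (box_coherent hr)) //; last exact: box_center.
  by apply: (@mulgI _ (e v' v')); rewrite (e_coherent (box_coherent hr)) // mulg1.
pose x := (gau v' * e v' v0)%g.
(* Conjugation by x is onto. The gauge and the edge at the relabelled end coincide with those at the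
   start, so the chain yields exactly such a conjugate. *)
suff: forall h, H (x * h * x^-1)%g.
  move: x => x key.
  by have := key (x^-1 * g * x)%g; rewrite !mulgA mulgV mul1g mulgK.
move=> h; have [s Wh] := edge_chain toX_surj toX_relabel toX_inj toX_open
  Wbox Wtrans cv0 v0b h.
have := Wh _ _ _ _ hr (clear_radius_relabel s hr) bv' (box_relabel s bv') gv' (generic_relabel s gv').
rewrite e_relabel E1.
have -> : gau (relabel s v') = gau v'.
  by rewrite /gauge !base_relabel -![raise (relabel s _)]/(relabel s (raise _)) !e_relabel.
by rewrite /x; move: (gau v') => a; rewrite invgM !mulgA.
Qed.

End PlaneGroup.

(** * The hexagonal semidirect product *)

Local Open Scope ring_scope.
Local Open Scope group_scope.

Section Hexagonal.

(* Row vectors: u |-> v and v |-> v - u for the basis u, v of Z^2. *)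
Definition hex : 'M[int]_2 := (\matrix_(i, j)
  if i == ord0 then (if j == ord0 then 0 else 1) else (if j == ord0 then -1 else 1))%R.

Definition vec2 (x y : int) : 'rV[int]_2 := (\row_j if j == ord0 then x else y)%R.

Lemma vec2_hex x y : (vec2 x y *m hex = vec2 (- y) (x + y))%R.
Proof.
apply/rowP => j; rewrite !mxE !big_ord_recl big_ord0 !mxE /=.
by case: (j == ord0); ring.
Qed.

Lemma vec2D x y x' y' : (vec2 x y + vec2 x' y' = vec2 (x + x') (y + y'))%R.
Proof. by apply/rowP => j; rewrite !mxE; case: (j == ord0). Qed.

Lemma vec2_eta (v : 'rV[int]_2) : v = vec2 (v ord0 ord0) (v ord0 ord_max).
Proof.
by apply/rowP => j; rewrite mxE; case: j => [[|[|//]] hj] /=;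
  congr (v _ _); apply/val_inj.
Qed.

Lemma hex_unit : hex \in unitmx.
Proof.
(* [hex] is a root of t^2 - t + 1, so 1 - hex is its inverse. *)
have h : (hex *m (1%:M - hex) = 1%:M)%R.
  apply/matrixP => i j; rewrite !mxE !big_ord_recl big_ord0 !mxE.
  by case: i => [[|[|//]] hi]; case: j => [[|[|//]] hj].
by have [] := mulmx1_unit h.
Qed.

Variables (k : nat) (j0 : 'I_k).

(** Only coordinate [j0] acts: k = 1 and k = N + 1 give the two forms of the semidirect product. *)
Definition hex_act_fun (z : freeZ k) (v : freeZ 2) : freeZ 2 :=
  ((v : 'rV[int]_2) *m (hex ^ (z : 'rV[int]_k) ord0 j0))%R.

Fact hex_act1 v : hex_act_fun 1 v = v.
Proof. by rewrite /hex_act_fun mxE expr0z mulmx1. Qed.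

Fact hex_actM s t v : hex_act_fun (s * t) v = hex_act_fun s (hex_act_fun t v).
Proof.
by rewrite /hex_act_fun -mulmxA mxE addrC (exprzDr hex_unit).
Qed.

Fact hex_act_morph s v w :
  hex_act_fun s (v * w) = hex_act_fun s v * hex_act_fun s w.
Proof. exact: mulmxDl. Qed.

Definition hex_act : group_action (freeZ k) (freeZ 2) :=
  GroupAction hex_act1 hex_actM hex_act_morph.

Lemma hex_actE (z : freeZ k) (v : freeZ 2) :
  hex_act z v = ((v : 'rV[int]_2) *m (hex ^ (z : 'rV[int]_k) ord0 j0))%R.
Proof. by []. Qed.

Lemma hex_act_basis v : hex_act (freeZ_basis j0) v = ((v : 'rV[int]_2) *m hex)%R.
Proof. by rewrite hex_actE mxE !eqxx expr1z. Qed.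

Lemma hex_act_other i v : i != j0 -> hex_act (freeZ_basis i) v = v.
Proof. by move=> ij; rewrite hex_actE mxE eqxx eq_sym (negPf ij) expr0z mulmx1. Qed.

Lemma ubarE : ubar = vec2 1 0.
Proof. by rewrite [ubar]vec2_eta /ubar /freeZ_basis !mxE. Qed.

Lemma vbarE : vbar = vec2 0 1.
Proof. by rewrite [vbar]vec2_eta /vbar /freeZ_basis !mxE. Qed.

Lemma hex_act_ubar : hex_act (freeZ_basis j0) ubar = vbar.
Proof. by rewrite hex_act_basis ubarE vbarE vec2_hex. Qed.

Lemma hex_act_vbar : hex_act (freeZ_basis j0) vbar = ubar^-1 * vbar.
Proof.
rewrite hex_act_basis ubarE vbarE vec2_hex.
by apply/rowP => j; rewrite !mxE; case: (j == ord0).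
Qed.

End Hexagonal.

Definition invariant_group (N : nat) : groupType :=
  (semidirect (@hex_act 1 ord0) * freeZ N)%type.

Lemma invariant_eq N (p q : invariant_group N) : p.1 = q.1 -> p.2 = q.2 -> p = q.
Proof. by case: p q => [? ?] [? ?] /= -> ->. Qed.

(** Computable stand-in for a vector times a nonnegative power of sigma, so that products of
    permutation braids can be checked by evaluation; [tri_group] interprets it. *)
Definition triple := (int * int * nat)%type.

Definition rotate (k : nat) (z : int * int) : int * int :=
  iter k (fun z => (- z.2, z.1 + z.2)%R) z.

Definition tri_mul (t t' : triple) : triple :=
  let z := rotate t.2 t'.1 in ((t.1.1 + z.1, t.1.2 + z.2)%R, (t.2 + t'.2)%N).

(* Position p of a list w holds the final position of the strand that starts
   at p; lift3 sends w to the class of the corresponding positive permutation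
   braid, read off a bubble sort. *)
Fixpoint lift3 (fuel : nat) (w : seq nat) : triple :=
  if fuel is fuel'.+1 then
    match w with
    | [:: a; b; c; d] =>
      if (b < a)%N then tri_mul ((0, 0)%R, 1%N) (lift3 fuel' [:: b; a; c; d])
      else if (c < b)%N then tri_mul ((1, 0)%R, 1%N) (lift3 fuel' [:: a; c; b; d])
      else if (d < c)%N then tri_mul ((0, 0)%R, 1%N) (lift3 fuel' [:: a; b; d; c])
      else ((0, 0)%R, 0%N)
    | _ => ((0, 0)%R, 0%N)
    end
  else ((0, 0)%R, 0%N).

Definition comp4 (w w' : seq nat) := [seq nth 0 w' p | p <- w].

(** No pair exchanged by w is exchanged back by w'. Then lengths add, which is when positive
    permutation braids multiply as permutations do. *)
Definition no_return (w w' : seq nat) := all (fun q => all (fun p =>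
  (nth 0 w q < nth 0 w p)%N ==> (nth 0 w' (nth 0 w q) < nth 0 w' (nth 0 w p))%N)
  (iota 0 q)) (iota 0 4).

(** A finite check over pairs of permutations. Fuel 6 is the number of inversions of the longest
    permutation of four points; the three half twists go to sigma, u sigma and sigma. *)
Lemma lift3M_check : all (fun w => all (fun w' => no_return w w' ==>
  (lift3 6 (comp4 w w') == tri_mul (lift3 6 w) (lift3 6 w'))) (permutations (iota 0 4))) (permutations (iota 0 4)).
Proof. by vm_compute. Qed.

Lemma lift3M w w' : perm_eq w (iota 0 4) -> perm_eq w' (iota 0 4) -> no_return w w' ->
  lift3 6 (comp4 w w') = tri_mul (lift3 6 w) (lift3 6 w').
Proof.
rewrite -!mem_permutations => hw hw' h.
by have /allP/(_ w hw)/allP/(_ w' hw') := lift3M_check; rewrite h => /eqP.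
Qed.

Definition tri_group (t : triple) : semidirect (hex_act ord0) :=
  (vec2 t.1.1 t.1.2, (t.2%:Z *: freeZ_basis ord0)%R : freeZ 1).

Lemma tri_groupM t t' : tri_group (tri_mul t t') = tri_group t * tri_group t'.
Proof.
have rot n (z : int * int) : (vec2 z.1 z.2 *m hex ^+ n = vec2 (rotate n z).1 (rotate n z).2)%R.
  elim: n z => [|n IH] z; first by rewrite expr0 mulmx1.
  by rewrite exprSr mulmxA IH vec2_hex.
case: t => [[x y] k]; case: t' => [z l].
congr pair; last by apply/rowP => j; rewrite !mxE /= PoszD mulrDl.
transitivity (vec2 x y + vec2 z.1 z.2 *m hex ^+ k)%R; first by rewrite rot vec2D.
by rewrite hex_actE !mxE !eqxx mulr1.
Qed.

Definition lift_word w := tri_group (lift3 6 w).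

Lemma lift_wordM w w' : perm_eq w (iota 0 4) -> perm_eq w' (iota 0 4) -> no_return w w' ->
  lift_word (comp4 w w') = lift_word w * lift_word w'.
Proof. by move=> hw hw' h; rewrite /lift_word lift3M // tri_groupM. Qed.

Lemma tri_group0 : tri_group ((0, 0)%R, 0%N) = 1.
Proof.
by congr pair; apply/rowP => j; rewrite !mxE ?mul0r //; case: (j == ord0).
Qed.

Lemma lift_word_id : lift_word (iota 0 4) = 1.
Proof. by rewrite -tri_group0. Qed.

Lemma lift_word_swap r : (r < 3)%N ->
  lift_word (mkseq (fun p => if p == r then r.+1 else if p == r.+1 then r else p) 4) =
  tri_group ((r == 1%N)%:R%R, 0%R, 1%N).
Proof. by case: r => [|[|[|//]]]. Qed.

#[global] Opaque lift_word.

(** * Positive permutation braids on four strands *)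

Local Open Scope ring_scope.
Local Open Scope group_scope.

Section Words.
Local Open Scope nat_scope.

(** The permutation from a-ranks to b-ranks as a list; for injective a the sum has at most one
    term. *)
Definition word (a b : 'I_4 -> nat) : seq nat := mkseq (fun p => \sum_(i | a i == p) b i) 4.

Implicit Types a b c : 'I_4 -> nat.

Lemma nth_word a b i : injective a -> (forall i, a i < 4) -> nth 0 (word a b) (a i) = b i.
Proof.
move=> a_inj a4; rewrite nth_mkseq //.
have -> : \sum_(j | a j == a i) b j = \sum_(j | j == i) b j.
  by apply: eq_bigl => j; rewrite (inj_eq a_inj).
by rewrite big_pred1_eq.
Qed.

Lemma rank_onto a p : injective a -> (forall i, a i < 4) -> p < 4 -> exists i, a i = p.
Proof.
move=> a_inj a4 p4.
pose f i : 'I_4 := Ordinal (a4 i).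
have f_inj : injective f by move=> i j [/a_inj].
exists (invF f_inj (Ordinal p4)).
by rewrite -[LHS]/(val (f _)) f_invF.
Qed.

Lemma word_refl a : injective a -> (forall i, a i < 4) -> word a a = iota 0 4.
Proof.
move=> a_inj a4; apply: (@eq_from_nth _ 0); rewrite ?size_mkseq // => p p4.
by have [i <-] := rank_onto a_inj a4 p4; rewrite nth_word // nth_iota.
Qed.

Lemma word_id (w : nat -> nat) : word (@nat_of_ord 4) (fun i => w i) = mkseq w 4.
Proof.
apply: (@eq_from_nth _ 0) => [|p]; rewrite ?size_mkseq // => p4.
have -> : p = nat_of_ord (Ordinal p4) by [].
by rewrite nth_word; [rewrite nth_mkseq | exact: ord_inj | exact: ltn_ord].
Qed.

Lemma word_perm a b : injective a -> (forall i, a i < 4) ->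
  injective b -> (forall i, b i < 4) -> perm_eq (word a b) (iota 0 4).
Proof.
move=> a_inj a4 b_inj b4.
have sz : size (word a b) = 4 by rewrite size_mkseq.
apply: uniq_perm; last 1 first.
- have sub : {subset word a b <= iota 0 4}.
    move=> x /(nthP 0)[p]; rewrite sz => /(rank_onto a_inj a4)[i <-].
    by rewrite nth_word // => <-; rewrite mem_iota add0n; exact: b4.
  apply: (uniq_min_size _ sub _).2; last by rewrite sz.
  apply/(uniqP 0) => p q; rewrite !inE sz.
  move=> /(rank_onto a_inj a4)[i <-] /(rank_onto a_inj a4)[j <-].
  by rewrite !nth_word // => /b_inj ->.
- apply/(uniqP 0) => p q; rewrite !inE sz.
  move=> /(rank_onto a_inj a4)[i <-] /(rank_onto a_inj a4)[j <-].
  by rewrite !nth_word // => /b_inj ->.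
- exact: iota_uniq.
Qed.

Lemma word_comp a b c : injective a -> (forall i, a i < 4) ->
  injective b -> (forall i, b i < 4) -> comp4 (word a b) (word b c) = word a c.
Proof.
move=> a_inj a4 b_inj b4; apply: (@eq_from_nth _ 0); first by rewrite size_map !size_mkseq.
move=> p; rewrite size_map size_mkseq => p4.
rewrite (nth_map 0) ?size_mkseq //.
have [i <-] := rank_onto a_inj a4 p4.
by rewrite !nth_word.
Qed.

Lemma word_relabel (s : 'S_4) a b : word (fun i => a (s i)) (fun i => b (s i)) = word a b.
Proof.
apply/eq_mkseq => p.
by rewrite [RHS](reindex_inj (@perm_inj _ s)).
Qed.

Lemma word_no_return a b c : injective a -> (forall i, a i < 4) ->
  injective b -> (forall i, b i < 4) ->
  (forall i j, a i < a j -> b j < b i -> c j < c i) -> no_return (word a b) (word b c).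
Proof.
move=> a_inj a4 b_inj b4 h.
apply/allP => q; rewrite mem_iota add0n => /(rank_onto a_inj a4)[j <-].
apply/allP => p; rewrite mem_iota add0n /= => pj.
have [i Ei] := rank_onto a_inj a4 (ltn_trans pj (a4 j)).
rewrite -Ei in pj *; rewrite !nth_word //; apply/implyP.
exact: h.
Qed.

End Words.

(** * Ranks in a finite strict order *)

Section Ranks.
Variables (m : nat) (r : rel 'I_m).

Definition rank (i : 'I_m) : nat := #|[pred j | r j i]|.

Hypothesis r_irr : irreflexive r.
Hypothesis r_trans : transitive r.
Hypothesis r_total : forall i j, i != j -> r i j || r j i.

Lemma rank_lt i j : (rank i < rank j)%N = r i j.
Proof.
have mono i' j' : r i' j' -> (rank i' < rank j')%N.
  move=> ij; apply/fintype.proper_card/fintype.properP; split.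
    by apply/fintype.subsetP=> l; rewrite !inE => /r_trans; apply.
  by exists i'; rewrite inE ?r_irr.
apply/idP/idP => [|/mono//].
have [->|/r_total/orP[//|/mono]] := eqVneq i j; first by rewrite ltnn.
by rewrite ltnNge => /negP h /ltnW.
Qed.

Lemma rank_inj : injective rank.
Proof.
move=> i j E; apply/eqP; apply: contraT => /r_total.
by rewrite -!rank_lt E ltnn.
Qed.

Lemma rank_bound i : (rank i < m)%N.
Proof.
rewrite -[ltnRHS]card_ord; apply/fintype.proper_card/fintype.properP; split.
  exact: fintype.subset_predT.
by exists i; rewrite ?inE ?r_irr.
Qed.

Lemma rank_unique (f : 'I_m -> nat) : (forall i, (f i < m)%N) ->
  (forall i j, r i j -> (f i < f j)%N) -> rank =1 f.
Proof.
move=> fm fr; have f_inj : injective f.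
  move=> i j E; apply/eqP; apply: contraT => /r_total/orP[]/fr; by rewrite E ltnn.
have f_lt i j : (f i < f j)%N = r i j.
  apply/idP/idP => [|/fr//]; have [->|/r_total/orP[//|/fr]] := eqVneq i j.
    by rewrite ltnn.
  by rewrite ltnNge => /negP h /ltnW.
move=> i; pose g j : 'I_m := Ordinal (fm j).
have g_inj : injective g by move=> j l [/f_inj].
have -> : rank i = #|[pred p : 'I_m | (p < f i)%N]|.
  rewrite /rank -(fintype.card_image g_inj); apply: eq_card => p.
  rewrite !inE; apply/fintype.imageP/idP => [[j]|h].
    by rewrite inE -f_lt => h ->.
  exists (invF g_inj p); rewrite ?f_invF // inE -f_lt.
  by rewrite -[f (invF _ _)]/(val (g (invF g_inj p))) f_invF.
rewrite -sum1_card -(big_ord_widen_cond m (fun=> true) (fun=> 1%N)).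
  by rewrite sum1_card card_ord.
exact: ltnW.
Qed.

End Ranks.

Lemma eq_rank m (r r' : rel 'I_m) : r =2 r' -> rank r = rank r'.
Proof. by move=> h; apply/funext => i; apply: eq_card => j; rewrite !inE h. Qed.

Lemma rank_perm m (r : rel 'I_m) (s : 'S_m) i :
  rank (fun j l => r (s j) (s l)) i = rank r (s i).
Proof.
rewrite /rank -(fintype.card_image (@perm_inj _ s)); apply: eq_card => j.
rewrite !inE; apply/fintype.imageP/idP => [[l]|h].
  by rewrite inE => hl ->.
by exists (s^-1 j); rewrite ?inE permKV.
Qed.

(** * Projection charts *)

Local Open Scope classical_set_scope.
Local Open Scope ring_scope.

Section Charts.
Variables (R : realFieldType) (N : nat) (P : 'I_N -> R * R).
Local Notation V := ('I_4 -> R * R).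

Definition ell (s : R) (z : R * R) : R := z.1 - s * z.2.

Definition slope (s : R) (y : V) : rel 'I_4 := fun i j => ell s (y i) < ell s (y j).

Definition lex (y : V) : rel 'I_4 := fun i j =>
  ((y i).2 < (y j).2) || ((y i).2 == (y j).2) && ((y i).1 < (y j).1).

Definition chart (s : R) (y : V) : Prop :=
  (forall i j, i != j -> ell s (y i) != ell s (y j)) /\
  (forall i k, ell s (y i) != ell s (P k)).

(* For s going to -oo the order by [ell s] becomes the order [lex] by height, so
   that [crossings] records the pairs exchanged while rotating the projection. *)
Definition crossings (s : R) (y : V) : seq nat := word (rank (lex y)) (rank (slope s y)).

(* The points above puncture k and right of the line through it on which [ell s]
   is constant. A point crossing the horizontal side of this sector changes the
   count for all s alike, so that the transition functions stay constant. *)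
Definition winding (s : R) (y : V) : freeZ N :=
  \row_k - \sum_i (((P k).2 < (y i).2) && (ell s (P k) < ell s (y i)))%:R.

Lemma windingE s y k : (winding s y : 'rV[int]_N) ord0 k =
  - \sum_i (((P k).2 < (y i).2) && (ell s (P k) < ell s (y i)))%:R.
Proof. by rewrite mxE. Qed.

Definition chart_map (s : R) (y : V) : invariant_group N :=
  (lift_word (crossings s y), winding s y).

Lemma slope_strict s y : irreflexive (slope s y) /\ transitive (slope s y).
Proof. by split=> [i|j i k]; rewrite /slope ?ltxx //; exact: lt_trans. Qed.

Lemma lex_strict y : irreflexive (lex y) /\ transitive (lex y).
Proof.
split=> [i|j i k]; first by rewrite /lex !ltxx andbF.
rewrite /lex => /orP[h|/andP[/eqP-> h]] /orP[h'|/andP[/eqP E h']].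
- by rewrite (lt_trans h h').
- by rewrite -E h.
- by rewrite h'.
- by rewrite E ltxx eqxx (lt_trans h h').
Qed.

Lemma slope_total s y i j : chart s y -> i != j -> slope s y i j || slope s y j i.
Proof. by move=> [h _] /h; rewrite neq_lt. Qed.

Lemma lex_total y i j : (y i <> y j) -> lex y i j || lex y j i.
Proof.
rewrite /lex => h; have [?|?|E2] := ltgtP (y i).2 (y j).2; rewrite ?orbT //=.
have [//|//|E1] := ltgtP (y i).1 (y j).1; case: h.
by rewrite (surjective_pairing (y i)) E1 E2 -surjective_pairing.
Qed.

Lemma chart_distinct s y i j : chart s y -> i != j -> y i <> y j.
Proof. by move=> [h _] /h ij E; rewrite E eqxx in ij. Qed.

Lemma slope_rank s y : chart s y ->
  [/\ forall i j, (rank (slope s y) i < rank (slope s y) j)%N = slope s y i j,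
      injective (rank (slope s y)) & forall i, (rank (slope s y) i < 4)%N].
Proof.
have [irr tr] := slope_strict s y => cs; split=> [i j||i].
- by apply: rank_lt => // i' j'; exact: slope_total.
- by apply: rank_inj => // i' j'; exact: slope_total.
- exact: rank_bound.
Qed.

Lemma lex_rank y : (forall i j, i != j -> y i <> y j) ->
  [/\ forall i j, (rank (lex y) i < rank (lex y) j)%N = lex y i j,
      injective (rank (lex y)) & forall i, (rank (lex y) i < 4)%N].
Proof.
have [irr tr] := lex_strict y => h; split=> [i j||i].
- by apply: rank_lt => // i' j' /h; exact: lex_total.
- by apply: rank_inj => // i' j' /h; exact: lex_total.
- exact: rank_bound.
Qed.

Definition transition (s t : R) (y : V) := lift_word (word (rank (slope s y)) (rank (slope t y))).

(* As the slope grows, each pair of points changes its order at most once, so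
   the positive permutation braids compose with additive length. *)
Lemma crossings_transition s t y : s <= t -> chart s y -> chart t y ->
  lift_word (crossings t y) = (lift_word (crossings s y) * transition s t y)%g.
Proof.
move=> st cs ct; have [ls is_ bs] := slope_rank cs; have [lt_ it bt] := slope_rank ct.
have [ll il bl] := lex_rank (fun i j => @chart_distinct s y i j cs).
rewrite /crossings /transition -(word_comp (rank (slope t y)) il bl is_ bs).
apply: lift_wordM; try exact: word_perm.
apply: word_no_return => // i j; rewrite ll ls lt_ /lex /slope /ell.
by move=> /orP[|/andP[/eqP-> ]] h h'; nra.
Qed.

Lemma transition_sym s t y : chart s y -> chart t y ->
  ((lift_word (crossings s y))^-1 * lift_word (crossings t y))%g =
  (if s <= t then transition s t y else (transition t s y)^-1)%g.
Proof.
move=> cs ct; case: (leP s t) => st.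
  by rewrite (crossings_transition st cs ct) mulKg.
by rewrite (crossings_transition (ltW st) ct cs) invgM mulgKV.
Qed.

Lemma slope_stable s y : chart s y -> exists2 d, 0 < d & forall z, box y d z ->
  [/\ chart s z, slope s z =2 slope s y &
      forall i k, (ell s (P k) < ell s (z i)) = (ell s (P k) < ell s (y i))].
Proof.
move=> cs.
(* [ell s] has Lipschitz constant 1 + |s| for the sup norm; the factor 2 allows both points to
   move. *)
pose g (u v : R * R) := (ell s v - ell s u) / ((1 + `|s|) * 2).
pose L := [seq g (y p.1) (y p.2) | p <- enum {: 'I_4 * 'I_4}] ++
  [seq g (y p.1) (P p.2) | p <- enum {: 'I_4 * 'I_N}] ++
  [seq g (P p.2) (y p.1) | p <- enum {: 'I_4 * 'I_N}].
have [d /andP[d0 _] hd] := small_pos L (@ltr01 R).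
have s0 : 0 < (1 + `|s|) * 2 by have := normr_ge0 s; lra.
have gap u v : g u v \in L -> ell s u < ell s v -> d * ((1 + `|s|) * 2) < ell s v - ell s u.
  by move=> /hd h uv; rewrite -ltr_pdivlMr //; apply: h; rewrite divr_gt0 ?subr_gt0.
have near_ (u v : R * R) : `|v.1 - u.1| < d -> `|v.2 - u.2| < d ->
    `|ell s v - ell s u| < d * (1 + `|s|).
  move=> h1 h2; have -> : ell s v - ell s u = (v.1 - u.1) - s * (v.2 - u.2).
    by rewrite /ell; ring.
  apply: (le_lt_trans (ler_normB _ _)); rewrite normrM.
  by have := normr_ge0 s; have := normr_ge0 (v.2 - u.2); nra.
have lt2 i j z : box y d z -> ell s (y i) < ell s (y j) -> ell s (z i) < ell s (z j).
  move=> bz /gap h; have {h} := h _.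
  rewrite mem_cat; have -> : g (y i) (y j) \in [seq g (y p.1) (y p.2) | p <- enum {: 'I_4 * 'I_4}].
    by apply/mapP; exists (i, j); rewrite ?mem_enum.
  move=> /(_ isT) h; have [i1 i2] := bz i; have [j1 j2] := bz j.
  have := near_ _ _ i1 i2; have := near_ _ _ j1 j2; rewrite !ltr_norml.
  by move: h; rewrite mulrA; lra.
have ltP1 i k z : box y d z -> ell s (y i) < ell s (P k) -> ell s (z i) < ell s (P k).
  move=> bz /gap h; have {h} := h _.
  rewrite !mem_cat; have -> : g (y i) (P k) \in [seq g (y p.1) (P p.2) | p <- enum {: 'I_4 * 'I_N}].
    by apply/mapP; exists (i, k); rewrite ?mem_enum.
  rewrite orbT => /(_ isT) h; have [i1 i2] := bz i.
  have := near_ _ _ i1 i2; rewrite !ltr_norml; have := mulr_gt0 d0 s0.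
  by move: h; rewrite mulrA; lra.
have ltP2 i k z : box y d z -> ell s (P k) < ell s (y i) -> ell s (P k) < ell s (z i).
  move=> bz /gap h; have {h} := h _.
  rewrite !mem_cat; have -> : g (P k) (y i) \in [seq g (P p.2) (y p.1) | p <- enum {: 'I_4 * 'I_N}].
    by apply/mapP; exists (i, k); rewrite ?mem_enum.
  rewrite !orbT => /(_ isT) h; have [i1 i2] := bz i.
  have := near_ _ _ i1 i2; rewrite !ltr_norml; have := mulr_gt0 d0 s0.
  by move: h; rewrite mulrA; lra.
exists d => // z bz; split=> [|i j|i k].
- split=> [i j /cs.1|i k]; last have := cs.2 i k.
    by rewrite neq_lt => /orP[/(lt2 _ _ _ bz)/lt_eqF|/(lt2 _ _ _ bz)/gt_eqF] ->.
  by rewrite neq_lt => /orP[/(ltP1 _ _ _ bz)/lt_eqF|/(ltP2 _ _ _ bz)/gt_eqF] ->.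
- rewrite /slope; apply/idP/idP => [h|/(lt2 _ _ _ bz)//].
  have [E|ij] := eqVneq i j; first by rewrite E ltxx in h.
  have := cs.1 _ _ ij; rewrite neq_lt => /orP[//|/(lt2 _ _ _ bz)].
  by rewrite ltNge ltW.
- apply/idP/idP => [h|/(ltP2 _ _ _ bz)//].
  have := cs.2 i k; rewrite neq_lt => /orP[/(ltP1 _ _ _ bz)|//].
  by rewrite ltNge ltW.
Qed.

Lemma height_stable (y : V) : exists2 d, 0 < d & forall z, box y d z ->
  forall i k, (P k).2 != (y i).2 -> ((P k).2 < (z i).2) = ((P k).2 < (y i).2).
Proof.
pose L := [seq `|(y p.1).2 - (P p.2).2| | p <- enum {: 'I_4 * 'I_N}].
have [d /andP[d0 _] hd] := small_pos L (@ltr01 R).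
exists d => // z bz i k ne.
have : d < `|(y i).2 - (P k).2|.
  apply: hd; last by rewrite normr_gt0 subr_eq0 eq_sym.
  by apply/mapP; exists (i, k); rewrite ?mem_enum.
have [_] := bz i; rewrite ltr_norml lter_normr => h /orP[]h'; apply/idP/idP; lra.
Qed.

(** [crossings] may jump when two heights coincide, but by [transition_sym] the change from s to t
    depends only on the two projected orders, which are stable. *)
Lemma chart_map_locally_constant s t y : chart s y -> chart t y ->
  exists2 d, 0 < d & forall z, box y d z ->
  [/\ chart s z, chart t z &
    ((chart_map s z)^-1 * chart_map t z = (chart_map s y)^-1 * chart_map t y)%g].
Proof.
move=> cs ct; have [d1 d10 h1] := slope_stable cs; have [d2 d20 h2] := slope_stable ct.
have [d3 d30 h3] := height_stable y.
exists (Num.min d1 (Num.min d2 d3)); first by rewrite !lt_min d10 d20.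
move=> z bz.
have [|cs' ss ps] := h1 z; first by move=> i; have [] := bz i; rewrite !lt_min => /andP[-> _] /andP[-> _].
have [|ct' st pt] := h2 z; first by move=> i; have [] := bz i; rewrite !lt_min => /and3P[_ -> _] /and3P[_ -> _].
have {}h3 := h3 z; have {}h3 : forall i k, (P k).2 != (y i).2 -> ((P k).2 < (z i).2) = ((P k).2 < (y i).2).
  by apply: h3 => i; have [] := bz i; rewrite !lt_min => /and3P[_ _ ->] /and3P[_ _ ->].
split; [exact: cs'|exact: ct'|apply: invariant_eq].
  have E1 := transition_sym cs' ct'; have E2 := transition_sym cs ct.
  rewrite /transition (eq_rank ss) (eq_rank st) in E1; exact: (etrans E1 (esym E2)).
apply/rowP => k; rewrite !mxE !opprK -!sumrB; apply: eq_bigr => i _.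
(* [winding] may jump when a point reaches the height of a puncture; there both projections compare
   the two alike, so the jumps cancel. *)
rewrite ps pt; have [E|/h3->//] := eqVneq (P k).2 (y i).2.
have -> : ell s (P k) < ell s (y i) = (ell t (P k) < ell t (y i)).
  by rewrite /ell E !ltrD2r.
by rewrite !subrr.
Qed.

Lemma chart_relabel s (p : 'S_4) y : chart s y -> chart s (relabel p y).
Proof.
move=> [h1 h2]; split=> [i j ij|i k]; rewrite /relabel //.
by apply: h1; rewrite (inj_eq perm_inj).
Qed.

Lemma chart_map_relabel s (p : 'S_4) y : chart_map s (relabel p y) = chart_map s y.
Proof.
apply: invariant_eq; last first.
  apply/rowP => k; rewrite !mxE; congr (- _).
  by rewrite [RHS](reindex_inj (@perm_inj _ p)).
rewrite -[LHS]/(lift_word (crossings s (relabel p y))) -[RHS]/(lift_word (crossings s y)).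
congr lift_word; rewrite /crossings -[RHS](word_relabel p).
by congr word; apply/funext => i; rewrite -rank_perm.
Qed.

(** Two distinct points have the same projection for at most one s, so only finitely many s are
    excluded. *)
Lemma chart_cover y : in_conf P y -> exists s, chart s y.
Proof.
move=> [h1 h2].
pose g (u v : R * R) := (u.1 - v.1) / (u.2 - v.2).
pose L := [seq g (y p.1) (y p.2) | p <- enum {: 'I_4 * 'I_4}] ++
  [seq g (y p.1) (P p.2) | p <- enum {: 'I_4 * 'I_N}].
have [s /andP[s0 _] hs] := small_pos L (@ltr01 R).
have key u v : u <> v -> g u v \in L -> ell s u != ell s v.
  move=> uv /hs h; apply/eqP => E; apply: uv.
  have E' : u.1 - v.1 = s * (u.2 - v.2) by move: E; rewrite /ell; lra.
  have [E2|ne] := eqVneq u.2 v.2.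
    move: E'; rewrite E2 subrr mulr0 => /subr0_eq E1.
    by rewrite (surjective_pairing u) E1 E2 -surjective_pairing.
  have Eg : g u v = s by rewrite /g E' mulfK // subr_eq0.
  by rewrite Eg ltxx in h; have := h s0.
exists s; split=> [i j ij|i k]; apply: key; rewrite ?mem_cat.
- exact: h1.
- by apply/orP; left; apply/mapP; exists (i, j); rewrite ?mem_enum.
- exact: h2.
- by apply/orP; right; apply/mapP; exists (i, k); rewrite ?mem_enum.
Qed.

End Charts.

(** * Values of the invariant *)

Local Open Scope classical_set_scope.
Local Open Scope ring_scope.

Section Monodromy.
Variables (R : realType) (N : nat) (P : 'I_N -> R * R).
Local Notation V := ('I_4 -> R * R).
Variables (X : topologicalType) (toX : V -> X).
Hypothesis toX_continuous : forall (T : topologicalType) (A : set T) (y : T -> V),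
  (forall i, {within A, continuous (fun t => y t i)}) ->
  (forall t, A t -> in_conf P (y t)) -> {within A, continuous (fun t => toX (y t))}.
Hypothesis toX_surj : forall x, exists2 y, in_conf P y & toX y = x.
Hypothesis toX_relabel : forall s y, toX (relabel s y) = toX y.
Hypothesis toX_inj : forall y y', in_conf P y -> in_conf P y' ->
  toX y = toX y' -> exists s, y' = relabel s y.
Hypothesis toX_open : forall y r, in_conf P y -> 0 < r ->
  nbhs (toX y) (toX @` box y r).

Definition configuration (x : X) : V := projT1 (cid2 (toX_surj x)).

Lemma configurationP x : in_conf P (configuration x) /\ toX (configuration x) = x.
Proof. by rewrite /configuration; case: (cid2 _). Qed.

Lemma configuration_toX y : in_conf P y -> exists s, configuration (toX y) = relabel s y.
Proof.
by move=> cy; have [c E] := configurationP (toX y); apply: toX_inj.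
Qed.

Definition chart_at (s : R) (x : X) : Prop := chart P s (configuration x).
Definition chart_at_map (s : R) (x : X) := chart_map P s (configuration x).

Lemma chart_conf s y : chart P s y -> in_conf P y.
Proof.
move=> h; split=> [i j|i k E]; first exact: chart_distinct h.
by have := h.2 i k; rewrite E eqxx.
Qed.

Lemma chart_at_toX s y : in_conf P y -> chart_at s (toX y) <-> chart P s y.
Proof.
move=> cy; rewrite /chart_at; have [p ->] := configuration_toX cy.
split; last exact: chart_relabel.
move=> /(chart_relabel p^-1%g); congr chart; apply/funext => i.
by rewrite /relabel permKV.
Qed.

Lemma chart_at_map_toX s y : in_conf P y -> chart_at_map s (toX y) = chart_map P s y.
Proof.
move=> cy; rewrite /chart_at_map; have [p ->] := configuration_toX cy.
exact: chart_map_relabel.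
Qed.

Lemma chart_at_cover x : exists s, chart_at s x.
Proof. by apply: chart_cover; have [] := configurationP x. Qed.

Lemma chart_at_locally_constant x s t : chart_at s x -> chart_at t x ->
  \forall x' \near x, chart_at s x' /\
    ((chart_at_map s x')^-1 * chart_at_map t x' = (chart_at_map s x)^-1 * chart_at_map t x)%g.
Proof.
move=> cs ct; have [d d0 hd] := chart_map_locally_constant cs ct.
have [cx Ex] := configurationP x.
have := toX_open cx d0; rewrite Ex; apply: filterS => _ [z /hd[zs zt Ez] <-].
have cz := chart_conf zs.
by split; [apply/chart_at_toX|rewrite (chart_at_map_toX s cz) (chart_at_map_toX t cz); exact: Ez].
Qed.

Variables (b : X) (delta : forall x, path R b x).
Local Notation e := (edge toX_continuous delta).

Definition invariant : pi1 R b -> invariant_group N :=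
  @monodromy _ _ _ _ _ _ chart_at_cover chart_at_locally_constant b.

Definition transport (y : V) : invariant_group N :=
  path_holonomy chart_at_cover chart_at_locally_constant (delta (toX y)).

Lemma invariantM g h : invariant (g * h)%g = (invariant g * invariant h)%g.
Proof. exact: monodromyM. Qed.

Definition same_chart s (u v : V) := slope s u =2 slope s v /\
  forall i k, (ell s (P k) < ell s (u i)) = (ell s (P k) < ell s (v i)).

Lemma ell_lin s (u v : V) t i :
  ell s (lin u v t i) = (1 - t) * ell s (u i) + t * ell s (v i).
Proof. by rewrite /ell /lin /=; ring. Qed.

Lemma chart_lin s u v t : chart P s u -> chart P s v -> same_chart s u v -> 0 <= t <= 1 ->
  chart P s (lin u v t).
Proof.
have conv (a a' c c' : R) : a < c -> a' < c' -> 0 <= t <= 1 ->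
    (1 - t) * a + t * a' < (1 - t) * c + t * c'.
  move=> ac ac' /andP[t0 t1]; have [->|tn] := eqVneq t 0; first by lra.
  have : 0 < t by rewrite lt_neqAle eq_sym tn.
  by nra.
move=> [u1 u2] [v1 v2] [h1 h2] ht; split=> [i j ij|i k]; rewrite !ell_lin.
  have := h1 i j; have := h1 j i; rewrite /slope => E E'.
  have := u1 _ _ ij; rewrite neq_lt => /orP[l|l]; first by rewrite lt_eqF // conv // -E'.
  by rewrite gt_eqF // conv // -E.
have -> : ell s (P k) = (1 - t) * ell s (P k) + t * ell s (P k) by ring.
have := u2 i k; rewrite neq_lt => /orP[l|l]; last by rewrite gt_eqF // conv // -h2.
rewrite lt_eqF // conv // lt_neqAle v2 leNgt -h2 -leNgt; exact: ltW.
Qed.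

(** The segment stays in chart s, because [ell s] is affine and the orders at the two ends agree. *)
Lemma invariant_edge s u v : chart P s u -> chart P s v -> same_chart s u v ->
  invariant (e u v) = (transport u * (chart_map P s u * (chart_map P s v)^-1) *
    (transport v)^-1)%g.
Proof.
move=> cu cv uv.
have cl t : 0 <= t <= 1 -> chart P s (lin u v t) by exact: chart_lin.
have h t : 0 <= t <= 1 -> in_conf P (lin u v t) by move=> /cl; exact: chart_conf.
rewrite (edgeE _ _ h) /invariant monodromy_based.
rewrite (@path_holonomy_chart _ _ _ _ _ _ chart_at_cover chart_at_locally_constant _ _ (segpath toX_continuous h) s).
  by rewrite (chart_at_map_toX s (chart_conf cu)) (chart_at_map_toX s (chart_conf cv)).
by move=> t ht /=; apply/chart_at_toX; [exact: h|exact: cl].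
Qed.

Hypothesis P_height : forall k, -1 < (P k).2 < 1.
Variables (x0 x1 gap : R).
Hypothesis x01 : x0 < x1.
Hypothesis gap_gt0 : 0 < gap.
Hypothesis x0_left : forall k, x0 + 4%:R + gap *+ 4 < (P k).1.
Hypothesis x1_right : forall k, (P k).1 + gap *+ 4 < x1.
Hypothesis P_gap : forall k l : 'I_N, k != l ->
  (P k).1 + gap *+ 4 < (P l).1 \/ (P l).1 + gap *+ 4 < (P k).1.

Local Notation standard := (standard (m := 4) x0).
Local Notation ge := (ge x0 e).

(** So steep that a height difference of 1 outweighs any horizontal distance in play: points at
    height 2 or more project left of all punctures, those at height -2 or less to the right. *)
Let S := x1 + 5%:R - x0.

Definition bounded (y : V) := forall i, x0 <= (y i).1 <= x1 + 4%:R.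

Lemma steep_high k (z : R * R) : 2 <= z.2 -> z.1 <= x1 + 4%:R -> ell S z < ell S (P k).
Proof.
move=> z2 z1; have /andP[h1 h2] := P_height k; have h3 := x0_left k; have h4 := gap_gt0.
have S0 : 0 < S by move: x01; rewrite /S; lra.
have h : 0 < S * (z.2 - (P k).2 - 1) by apply: mulr_gt0 => //; lra.
by move: h x01; rewrite /ell /S; lra.
Qed.

Lemma steep_low k (z : R * R) : z.2 <= -2 -> x0 <= z.1 -> ell S (P k) < ell S z.
Proof.
move=> z2 z1; have /andP[h1 h2] := P_height k; have h3 := x1_right k; have h4 := gap_gt0.
have S0 : 0 < S by move: x01; rewrite /S; lra.
have h : 0 < S * ((P k).2 - z.2 - 1) by apply: mulr_gt0 => //; lra.
by move: h x01; rewrite /ell /S; lra.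
Qed.

Lemma high_chart (y : V) : bounded y -> (forall i, (y i).2 = 2) ->
  (forall i j, i != j -> (y i).1 != (y j).1) -> chart P S y.
Proof.
move=> yb y2 yd; split=> [i j /yd|i k]; rewrite /ell.
  by rewrite !y2 (inj_eq (addIr _)).
by rewrite -!/(ell _ _) lt_eqF // steep_high ?y2 //; case/andP: (yb i).
Qed.

Lemma invariantV g : invariant (g^-1)%g = ((invariant g)^-1)%g.
Proof.
apply/esym/mulg1_eq; rewrite -invariantM mulgV.
by apply: (@mulgI _ (invariant 1%g)); rewrite -invariantM !mulg1.
Qed.

Lemma flat_crossings s (y : V) : (forall i, (y i).2 = 2) ->
  (forall i j, i != j -> (y i).1 != (y j).1) -> lift_word (crossings s y) = 1%g.
Proof.
move=> y2 yd; have E : lex y =2 slope s y.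
  by move=> i j; rewrite /lex /slope /ell !y2 ltxx eqxx /= ltrD2r.
have [|_ li lb] := lex_rank (y := y); first by move=> i j /yd /eqP h E'; apply: h; rewrite E'.
by rewrite /crossings -(eq_rank E) word_refl // lift_word_id.
Qed.

Lemma flat_chart_map (y : V) : bounded y -> (forall i, (y i).2 = 2) ->
  (forall i j, i != j -> (y i).1 != (y j).1) -> chart_map P S y = 1%g.
Proof.
move=> yb y2 yd; apply: invariant_eq; first exact: flat_crossings.
apply/rowP => k; rewrite !mxE big1 ?oppr0 // => i _.
by rewrite [X in _ && X]ltNge ltW ?andbF // steep_high ?y2 //; case/andP: (yb i).
Qed.

Lemma generic_chart0 y : generic P y -> chart P 0 y.
Proof. by move=> [h1 h2]; split=> [i j /h1|i k]; rewrite /ell !mul0r !subr0. Qed.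

Lemma invariant_gauge u : generic P u -> bounded u ->
  invariant (gauge x0 e u) =
  (transport standard * (chart_map P 0 (raise u) * (chart_map P 0 u)^-1) * (transport u)^-1)%g.
Proof.
move=> gu bu; rewrite /gauge invariantM.
have br : bounded (raise u) by [].
have rd i j : i != j -> (raise u i).1 != (raise u j).1 by exact: gu.1.
have bb : bounded (base x0 u).
  move=> i /=; have := rk_bound u i; have : 0 <= (rk u i)%:R :> R by [].
  rewrite -(ltr_nat R); have := x01; lra.
have bd i j : i != j -> (base x0 u i).1 != (base x0 u j).1.
  by move=> /(generic_dir gu)[] /rk_lt h; rewrite /= (inj_eq (addrI _)) eqr_nat; lia.
have E1 : invariant (e (base x0 u) (raise u)) = (transport standard * (transport (raise u))^-1)%g.
  have sc : same_chart S (base x0 u) (raise u).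
    split=> [i j|i k].
      rewrite /slope /ell /= !ltrD2r ltrD2l ltr_nat.
      have [->|/(generic_dir gu)[h|h]] := eqVneq i j; first by rewrite ltnn ltxx.
        by rewrite h rk_lt.
      by rewrite [RHS]ltNge ltW //= ltnNge ltnW ?rk_lt.
    have low (y : V) : bounded y -> (y i).2 = 2 -> (ell S (P k) < ell S (y i)) = false.
      by move=> yb y2; rewrite ltNge ltW // steep_high ?y2 //; case/andP: (yb i).
    by rewrite !low.
  rewrite (invariant_edge (high_chart bb (fun=> erefl) bd) (high_chart br (fun=> erefl) rd) sc).
  rewrite (flat_chart_map bb (fun=> erefl) bd) (flat_chart_map br (fun=> erefl) rd).
  by rewrite invg1 !mulg1 /transport (toX_base _ toX_relabel gu).
have E2 : invariant (e (raise u) u) = (transport (raise u) *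
    (chart_map P 0 (raise u) * (chart_map P 0 u)^-1) * (transport u)^-1)%g.
  apply: invariant_edge; [exact: (@generic_chart0 (raise u))|exact: generic_chart0|].
  by split=> [i j|i k]; rewrite /slope /ell !mul0r !subr0.
rewrite E1 E2; move: (transport standard) (transport (raise u)) (transport u).
move: (chart_map P 0 (raise u) * (chart_map P 0 u)^-1)%g => w a1 a2 a3.
by rewrite !mulgA mulgKV.
Qed.

(* Raising uses the vertical projection (slope 0) and sliding at height 2 the
   steep projection (slope [S]); the comparison of both charts is all that
   remains of the transports. *)
Definition defect u v := ((chart_map P 0 (raise u) * (chart_map P 0 u)^-1) *
  (chart_map P S u * (chart_map P S v)^-1) *
  (chart_map P 0 (raise v) * (chart_map P 0 v)^-1)^-1)%g.

Lemma invariant_ge u v : generic P u -> bounded u -> generic P v -> bounded v ->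
  chart P S u -> chart P S v -> same_chart S u v ->
  invariant (ge u v) = (transport standard * defect u v * (transport standard)^-1)%g.
Proof.
move=> gu bu gv bv cu cv uv; rewrite /ge invariantM (invariantM (gauge x0 e u)) invariantV.
rewrite (invariant_gauge gu bu) (invariant_gauge gv bv).
rewrite (invariant_edge cu cv uv) /defect.
move: (chart_map P 0 (raise u) * (chart_map P 0 u)^-1)%g (chart_map P S u * (chart_map P S v)^-1)%g.
move: (chart_map P 0 (raise v) * (chart_map P 0 v)^-1)%g => w1 w2 w3.
move: (transport standard) (transport u) (transport v) => a1 a2 a3.
by rewrite !invgM !invgK !mulgA !mulgKV.
Qed.

Lemma winding_left s (y : V) : (forall i k, ell s (y i) < ell s (P k)) ->
  winding P s y = 1%g.
Proof.
move=> h; apply/rowP => k; rewrite !mxE big1 ?oppr0 // => i _.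
by rewrite [X in _ && X]ltNge ltW ?andbF.
Qed.

Section SigmaValue.
Variables (r : nat) (w : nat -> nat).
Hypothesis r3 : (r < 3)%N.
Hypothesis w_inj : injective w.
Hypothesis w4 : forall i, (i < 4)%N -> (w i < 4)%N.
Let y : V := line x0 w (bump R r).

Let y1 i : x0 <= (y i).1 <= x0 + 3%:R.
Proof.
have : ((w i)%:R <= 3%:R :> R) by rewrite ler_nat -ltnS; apply: w4.
by have : 0 <= (w i)%:R :> R by []; rewrite /y /=; lra.
Qed.

Let gy : generic P y.
Proof. by apply: (generic_line gap_gt0 x0_left) => [i j /w_inj/ord_inj|i]; last exact: w4. Qed.

Lemma line_slope_steep i j : slope S y i j = if i == r.+1 :> nat then j != r.+1 :> nat
  else (j != r.+1 :> nat) && (w i < w j)%N.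
Proof.
have := y1 i; have := y1 j; rewrite /slope /ell /S /y /bump /= -(ltr_nat R).
case: eqP => hi; case: eqP => hj /= h1 h2.
- by rewrite (_ : i = j) ?ltxx //; apply: ord_inj; rewrite hi hj.
- by apply/idP; move: x01; lra.
- by apply/negbTE; rewrite -leNgt; move: x01; lra.
- by apply/idP/idP; lra.
Qed.

Lemma line_slope0 i j : slope 0 y i j = (w i < w j)%N.
Proof. by rewrite /slope /ell !mul0r !subr0 /= ltrD2l ltr_nat. Qed.

Lemma line_lex i j : lex y i j = if i == r.+1 :> nat then (j == r.+1 :> nat) && (w i < w j)%N
  else (j == r.+1 :> nat) || (w i < w j)%N.
Proof.
rewrite /lex /y /bump /= ltrD2l ltr_nat -(ltr_nat R).
have h23 : (2 : R) < 3 by lra.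
case: eqP => hi; case: eqP => hj /=; rewrite ?ltxx ?eqxx //= ?h23 //.
by rewrite ltNge ltW //= gt_eqF.
Qed.

Lemma line_chart : chart P S y.
Proof.
split=> [i j ij|i k].
  have h (i' j' : 'I_4) : i' != j' -> slope S y i' j' || slope S y j' i'.
    move=> ne; have : w i' != w j' by rewrite (inj_eq w_inj).
    rewrite !line_slope_steep neq_ltn; case: eqP => hi; case: eqP => hj //=.
    by case/eqP: ne; apply: ord_inj; rewrite hi hj.
  by rewrite neq_lt; exact: h.
rewrite lt_eqF // steep_high //; first by have := bump_gt1 R r i; rewrite /y /bump /=; case: eqP => _; lra.
by have := y1 i; have := x01; lra.
Qed.

Lemma line_bounded : bounded y.
Proof. by move=> i; have := y1 i; have := x01; lra. Qed.

End SigmaValue.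

Local Ltac bool_lia := repeat (case: ifP => ? //=); lia.

Lemma invariant_sig r : (r < 3)%N -> invariant (sig x0 e r) =
  (transport standard * ((tri_group ((r == 1%N)%:R, 0, 1%N), 1%g) : invariant_group N) *
    (transport standard)^-1)%g.
Proof.
move=> r3; pose u : V := line x0 (@nat_of_ord 4) (bump R r); pose v : V := line x0 (swap r) (bump R r).
rewrite -[sig x0 e r]/(ge u v).
have id4 i : (i < 4)%N -> (i < 4)%N by [].
have sw4 i : (i < 4)%N -> (swap r i < 4)%N by exact: (@swap_bound 4).
have sw_inj := @swap_inj r.
(* f ranks by height and g by the steep projection, and both are the same before and after the
   exchange. Only the projection of slope 0 sees the exchange. *)
pose f (i : 'I_4) := if i == r.+1 :> nat then 3%N else if (i < r.+1)%N then val i else i.-1.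
pose g (i : 'I_4) := if i == r.+1 :> nat then 0%N else if (i < r.+1)%N then i.+1 else val i.
have cu : chart P S u by exact: (@line_chart r id).
have cv : chart P S v by exact: (@line_chart r (swap r)).
have gu : generic P u by apply: (generic_line gap_gt0 x0_left) => [i j /ord_inj|i].
have gv : generic P v.
  by apply: (generic_line gap_gt0 x0_left) => [i j /swap_inj/ord_inj|i]; last exact: sw4.
have bu : bounded u by exact: (@line_bounded r id).
have bv : bounded v by exact: (@line_bounded r (swap r)).
have lexR (y : V) : generic P y -> (forall i j, lex y i j -> (f i < f j)%N) ->
    rank (lex y) = f.
  move=> [gy _] h; have [irr tr] := lex_strict y; apply/funext.
  apply: rank_unique => // [i j /gy ij|i]; last by rewrite /f; have := ltn_ord i; bool_lia.
  by apply: lex_total => E; rewrite E eqxx in ij.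
have slopeR s (y : V) (h : 'I_4 -> nat) : chart P s y -> (forall i, (h i < 4)%N) ->
    (forall i j, slope s y i j -> (h i < h j)%N) -> rank (slope s y) = h.
  move=> cy h4 hh; have [irr tr] := slope_strict s y; apply/funext.
  by apply: rank_unique => // i j; exact: slope_total cy.
have g4 i : (g i < 4)%N by rewrite /g; have := ltn_ord i; bool_lia.
have lu : rank (lex u) = f.
  apply: lexR => // i j; rewrite (@line_lex r id) /f.
  by have := ltn_ord i; have := ltn_ord j; bool_lia.
have lv : rank (lex v) = f.
  apply: lexR => // i j; rewrite (@line_lex r (swap r)) /f /swap.
  by have := ltn_ord i; have := ltn_ord j; bool_lia.
have Su : rank (slope S u) = g.
  apply: slopeR => // i j; rewrite (@line_slope_steep r id) // /g.
  by bool_lia.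
have Sv : rank (slope S v) = g.
  apply: slopeR => // i j; rewrite (@line_slope_steep r (swap r)) // /g /swap.
  by bool_lia.
have zu : rank (slope 0 u) = @nat_of_ord 4.
  by apply: slopeR => // [|i j]; [exact: generic_chart0|rewrite (@line_slope0 r id)].
have zv : rank (slope 0 v) = (fun i => swap r (nat_of_ord i)).
  apply: slopeR => [|i|i j]; [exact: generic_chart0|exact: sw4|].
  by rewrite (@line_slope0 r (swap r)).
have hu i k : ell S (u i) < ell S (P k).
  apply: steep_high; last by case/andP: (bu i).
  by rewrite /u /line /bump /=; case: eqP => _; lra.
have hv i k : ell S (v i) < ell S (P k).
  apply: steep_high; last by case/andP: (bv i).
  by rewrite /v /line /bump /=; case: eqP => _; lra.
have uv : same_chart S u v.
  split=> [i j|i k]; last by rewrite !ltNge !ltW.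
  have [<- _ _] := slope_rank cu; have [<- _ _] := slope_rank cv.
  by rewrite Su Sv.
have left (y : V) : (forall i, (y i).1 <= x0 + 3%:R) -> forall i k, ell 0 (y i) < ell 0 (P k).
  by move=> hy i k; have := hy i; have := x0_left k; rewrite /ell !mul0r !subr0; have := gap_gt0; lra.
have u1 i : (u i).1 <= x0 + 3%:R.
  by rewrite /= lerD2l ler_nat -ltnS.
have v1 i : (v i).1 <= x0 + 3%:R.
  by rewrite /= lerD2l ler_nat -ltnS; exact: sw4.
have E1 : chart_map P S u = chart_map P S v.
  apply: invariant_eq.
    by rewrite -[LHS]/(lift_word (crossings S u)) -[RHS]/(lift_word (crossings S v))
      /crossings lu lv Su Sv.
  by rewrite -[LHS]/(winding P S u) -[RHS]/(winding P S v) !winding_left.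
have flat (y : V) : generic P y -> (forall i, (y i).1 <= x0 + 3%:R) -> chart_map P 0 (raise y) = 1%g.
  move=> [gy _] hy; apply: invariant_eq.
    by rewrite -[LHS]/(lift_word (crossings 0 (raise y))) flat_crossings.
  exact: (winding_left (left (raise y) hy)).
have E2 : chart_map P 0 v = (chart_map P 0 u *
    ((tri_group ((r == 1%N)%:R, 0, 1%N), 1) : invariant_group N))%g.
  apply: invariant_eq; last first.
    have Wv : winding P 0 v = 1%g by exact: winding_left (left _ v1).
    have Wu : winding P 0 u = 1%g by exact: winding_left (left _ u1).
    change (winding P 0 v = (winding P 0 u * 1)%g).
    by rewrite Wv Wu mulg1.
  change (lift_word (crossings 0 v) =
    (lift_word (crossings 0 u) * tri_group ((r == 1%N)%:R, 0, 1%N))%g).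
  have [_ f_inj f4] := lex_rank (fun i j => chart_distinct (i := i) (j := j) cu).
  rewrite lu in f_inj f4.
  rewrite /crossings lu lv zu zv -(word_comp _ f_inj f4 (@ord_inj 4) (@ltn_ord 4)).
  rewrite -(lift_word_swap r3) -/(swap r) -(word_id (swap r)); apply: lift_wordM.
  - exact: (word_perm f_inj f4 (@ord_inj 4) (@ltn_ord 4)).
  - apply: (word_perm (@ord_inj 4) (@ltn_ord 4)) => [i j /sw_inj/ord_inj//|i].
    exact: sw4 (ltn_ord i).
  - apply: (word_no_return f_inj f4 (@ord_inj 4) (@ltn_ord 4)) => i j fij ji.
    have hj : j = r.+1 :> nat by move: r3 fij ji; rewrite /f; clear; bool_lia.
    by move: ji; rewrite hj /swap; clear; bool_lia.
rewrite (invariant_ge gu bu gv bv cu cv uv) /defect E1 (flat _ gu u1) (flat _ gv v1) E2.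
move: ((_, 1%g) : invariant_group N) => t.
move: (chart_map P 0 u) (chart_map P S v) (transport standard) => a1 a2 a3.
by rewrite mulgV mulg1 !mul1g invgK mulKg.
Qed.

Lemma invariant_rho (i : 'I_4) k : invariant (rho P x0 x1 gap e i k) =
  (transport standard * ((1%g, freeZ_basis k) : invariant_group N) *
    (transport standard)^-1)%g.
Proof.
pose y t : V := pole P x0 x1 i k t.
rewrite -[rho P x0 x1 gap e i k]/(ge (y (- gap)) (y gap)).
have hg := gap_gt0.
pose small (t : R) := 0 < `|t| <= gap *+ 2.
have s1 : small (- gap) by rewrite /small normrN gtr0_norm // hg /=; lra.
have s2 : small gap by rewrite /small gtr0_norm // hg /=; lra.
have gy t : small t -> generic P (y t).
  by move=> st; exact: (generic_pole gap_gt0 x0_left x1_right P_gap).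
have sy t : small t -> sorted_conf (y t).
  by move=> /andP[_ st]; exact: (sorted_pole gap_gt0 x0_left x1_right).
have y2 t (j : 'I_4) : (y t j).2 = (if j == i then -2 else 2).
  by rewrite /y /pole -val_eqE; case: ltngtP.
have yi t : (y t i).1 = (P k).1 + t by rewrite /y /pole ltnn eqxx.
have by_ t : small t -> bounded (y t).
  move=> /andP[_]; rewrite ler_norml => st j; rewrite /y /pole.
  have := x0_left k; have := x1_right k => h1 h2.
  have h0 : 0 <= j%:R :> R by [].
  have h4 : j%:R <= 4 :> R by rewrite ler_nat ltnW.
  by case: ltngtP => _ /=; move: x01; lra.
have high t (j : 'I_4) l : small t -> j != i -> ell S (y t j) < ell S (P l).
  move=> st ji; apply: steep_high; first by rewrite y2 (negPf ji).
  by case/andP: (by_ t st j).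
have low t l : small t -> ell S (P l) < ell S (y t i).
  move=> st; apply: steep_low; first by rewrite y2 eqxx.
  by case/andP: (by_ t st i).
have sl t (a c : 'I_4) : small t -> slope S (y t) a c =
    if a == i then false else (c == i) || (a < c)%N.
  move=> st; rewrite /slope.
  have [->|ai] := eqVneq a i.
    have [->|ci] := eqVneq c i; first by rewrite ltxx.
    by apply/negbTE; rewrite -leNgt ltW // (lt_trans (high t c k st ci)) // low.
  have [->|ci] := eqVneq c i; first by rewrite (lt_trans (high t a k st ai)) // low.
  by rewrite /ell !y2 (negPf ai) (negPf ci) ltrD2r sy.
have lx t (a c : 'I_4) : small t -> lex (y t) a c =
    if a == i then c != i else (c != i) && (a < c)%N.
  move=> st; rewrite /lex !y2 (sy t st).
  have h22 : (-2 : R) < 2 by lra.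
  have [->|ai] := eqVneq a i.
    have [->|ci] := eqVneq c i; first by rewrite ltnn ltxx andbF.
    by rewrite h22.
  have [->|ci] := eqVneq c i; first by rewrite ltNge ltW // gt_eqF.
  by rewrite ltxx eqxx.
have cy t : small t -> chart P S (y t).
  move=> st; split=> [a c ac|a l].
    have : slope S (y t) a c || slope S (y t) c a.
      rewrite !sl //; move: ac; rewrite neq_ltn; have [->|ai] := eqVneq a i.
        have [->|ci] := eqVneq c i; first by rewrite ltnn.
        by [].
      by have [->|ci] := eqVneq c i.
    by rewrite neq_lt.
  have [->|ai] := eqVneq a i; first by rewrite gt_eqF // low.
  by rewrite lt_eqF // high.
have cu := cy _ s1; have cv := cy _ s2; have gu := gy _ s1; have gv := gy _ s2.
have bu := by_ _ s1; have bv := by_ _ s2.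
have uv : same_chart S (y (- gap)) (y gap).
  split=> [a c|a l]; first by rewrite !sl.
  have [->|ai] := eqVneq a i; first by rewrite !low.
  by rewrite !ltNge !ltW // high.
have lexE : rank (lex (y (- gap))) = rank (lex (y gap)) by apply: eq_rank => a c; rewrite !lx.
have WS t : small t -> winding P S (y t) = 1%g.
  move=> st; apply/rowP => l; rewrite !mxE big1 ?oppr0 // => j _.
  have [->|ji] := eqVneq j i.
    rewrite y2 eqxx ltNge ltW //; have := P_height l; lra.
  by rewrite [X in _ && X]ltNge ltW ?andbF // high.
have E1 : chart_map P S (y (- gap)) = chart_map P S (y gap).
  apply: invariant_eq.
    change (lift_word (crossings S (y (- gap))) = lift_word (crossings S (y gap))).
    have E : rank (slope S (y (- gap))) = rank (slope S (y gap)).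
      by apply: eq_rank => a c; rewrite !sl.
    by rewrite /crossings lexE E.
  exact: (etrans (WS _ s1) (esym (WS _ s2))).
have E0 : lift_word (crossings 0 (y (- gap))) = lift_word (crossings 0 (y gap)).
  have E : rank (slope 0 (y (- gap))) = rank (slope 0 (y gap)).
    by apply: eq_rank => a c; rewrite /slope /ell !mul0r !subr0 (sy _ s1) (sy _ s2).
  by rewrite /crossings lexE E.
have flat t : small t -> lift_word (crossings 0 (raise (y t))) = 1%g.
  by move=> st; exact: (@flat_crossings 0 (raise (y t)) (fun=> erefl) (gy t st).1).
(* Only strand i differs from its raised position: low it is under every puncture and not counted,
   raised it counts for the punctures left of it. Between offsets -gap and gap this changes for k
   alone. *)
have D t l : small t -> (winding P 0 (raise (y t)) : 'rV[int]_N) ord0 l -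
    (winding P 0 (y t) : 'rV[int]_N) ord0 l = - ((P l).1 < (P k).1 + t)%R%:R.
  move=> st; rewrite !windingE opprK addrC -sumrB (bigD1 i isT) big1; last first.
    by move=> j ji; rewrite [(raise (y t) j).2]/= y2 (negPf ji) /ell !mul0r !subr0 subrr.
  have h2 : (P l).2 < 2 by have := P_height l; lra.
  have h3 : ((P l).2 < -2) = false by apply/negbTE; rewrite -leNgt; have := P_height l; lra.
  by rewrite Monoid.mulm1 [(raise (y t) i).2]/= y2 eqxx h3 h2 /ell !mul0r !subr0 yi sub0r.
rewrite (invariant_ge gu bu gv bv cu cv uv) /defect E1.
suff -> : (chart_map P 0%R (raise (y (- gap)%R)) * (chart_map P 0%R (y (- gap)%R))^-1 *
    (chart_map P S (y gap) * (chart_map P S (y gap))^-1) *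
    (chart_map P 0%R (raise (y gap)) * (chart_map P 0%R (y gap))^-1)^-1 =
    ((1, freeZ_basis k) : invariant_group N))%g by [].
rewrite mulgV mulg1; apply: invariant_eq.
  change ((lift_word (crossings 0%R (raise (y (- gap)%R))) *
    (lift_word (crossings 0%R (y (- gap)%R)))^-1 *
    (lift_word (crossings 0%R (raise (y gap))) * (lift_word (crossings 0%R (y gap)))^-1)^-1)%g = 1%g).
  by rewrite E0 (flat _ s1) (flat _ s2) mulgV.
change (((winding P 0 (raise (y (- gap))) : 'rV[int]_N) - winding P 0 (y (- gap))) -
  ((winding P 0 (raise (y gap)) : 'rV[int]_N) - winding P 0 (y gap)) = delta_mx ord0 k)%R.
apply/rowP => l.
have sub4 (a1 a2 a3 a4 : 'rV[int]_N) : ((a1 - a2) - (a3 - a4)) ord0 l =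
  (a1 ord0 l - a2 ord0 l) - (a3 ord0 l - a4 ord0 l) by rewrite !mxE.
rewrite sub4 (D _ l s1) (D _ l s2) mxE opprK eqxx /=.
have [->|lk] := eqVneq l k.
  have -> : ((P k).1 < (P k).1 - gap) = false by apply/negbTE; rewrite -leNgt; lra.
  by have -> : (P k).1 < (P k).1 + gap by lra.
suff -> : ((P l).1 < (P k).1 - gap) = ((P l).1 < (P k).1 + gap) by rewrite addNr.
by case: (P_gap lk) => h; apply/idP/idP; lra.
Qed.

End Monodromy.

(** * Stereographic projection *)

Local Open Scope classical_set_scope.
Local Open Scope ring_scope.

Section ContinuousAlgebra.
Variables (R : realType) (T : topologicalType).
Implicit Types f g : T -> R.

Lemma continuous_mul_fun f g : continuous f -> continuous g ->
  continuous (fun p => f p * g p).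
Proof. by move=> cf cg p; apply: cvgM; [exact: cf | exact: cg]. Qed.

Lemma continuous_add_fun f g : continuous f -> continuous g ->
  continuous (fun p => f p + g p).
Proof. by move=> cf cg p; apply: cvgD; [exact: cf | exact: cg]. Qed.

Lemma continuous_sub_fun f g : continuous f -> continuous g ->
  continuous (fun p => f p - g p).
Proof. by move=> cf cg p; apply: cvgB; [exact: cf | exact: cg]. Qed.

Lemma continuous_cst_fun (a : R) : continuous (fun _ : T => a).
Proof. by move=> p; exact: cvg_cst. Qed.

Lemma continuous_div_fun f g p : {for p, continuous f} -> {for p, continuous g} ->
  g p != 0 -> {for p, continuous (fun p => f p / g p)}.
Proof. by move=> cf cg g0; apply: cvgM => //; exact: cvgV. Qed.

End ContinuousAlgebra.

Section Stereographic.
Variable R : realType.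
Local Notation V3 := 'rV[R]_3.

Definition vec3 (x y z : R) : V3 :=
  \row_(i < 3) (if i == 0 :> nat then x else if i == 1%N :> nat then y else z).
Definition c1 (p : V3) : R := p ord0 ord0.
Definition c2 (p : V3) : R := p ord0 (lift ord0 ord0).
Definition c3 (p : V3) : R := p ord0 (lift ord0 (lift ord0 ord0)).

Lemma c1E x y z : c1 (vec3 x y z) = x. Proof. by rewrite /c1 mxE. Qed.
Lemma c2E x y z : c2 (vec3 x y z) = y. Proof. by rewrite /c2 mxE. Qed.
Lemma c3E x y z : c3 (vec3 x y z) = z. Proof. by rewrite /c3 mxE. Qed.

Lemma vec3P (p q : V3) : c1 p = c1 q -> c2 p = c2 q -> c3 p = c3 q -> p = q.
Proof.
move=> h1 h2 h3; apply/rowP => i.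
have : [\/ i = ord0, i = lift ord0 ord0 | i = lift ord0 (lift ord0 ord0)].
  case: i => -[|[|[|//]]] h; [apply: Or31|apply: Or32|apply: Or33]; exact: val_inj.
by case=> ->.
Qed.

Lemma sum3 (p : V3) : \sum_i p ord0 i ^+ 2 = c1 p ^+ 2 + c2 p ^+ 2 + c3 p ^+ 2.
Proof. by rewrite !big_ord_recl big_ord0 addr0 addrA. Qed.

Lemma continuous_c1 : continuous c1. Proof. exact: coord_continuous. Qed.
Lemma continuous_c2 : continuous c2. Proof. exact: coord_continuous. Qed.
Lemma continuous_c3 : continuous c3. Proof. exact: coord_continuous. Qed.

Lemma continuous_vec3 (T : topologicalType) (f g h : T -> R) :
  continuous f -> continuous g -> continuous h ->
  continuous (fun t => vec3 (f t) (g t) (h t)).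
Proof.
move=> cf cg ch t; apply/cvg_ballP => e e0.
have nf := cvg_ball (cf t) e0; have ng := cvg_ball (cg t) e0; have nh := cvg_ball (ch t) e0.
near=> u; split=> // i j; rewrite !mxE.
case: ifP => _; first by near: u; exact: nf.
by case: ifP => _; near: u; [exact: ng | exact: nh].
Unshelve. all: by end_near. Qed.

(* The reflection exchanging the unit vector [n] with the north pole: it is the
   identity, with junk coefficient 0^-1 = 0, when [n] is already the pole. *)
Section Reflection.
Variable n : V3.
Hypothesis n_unit : c1 n ^+ 2 + c2 n ^+ 2 + c3 n ^+ 2 = 1.

(** With w the vector from the pole to n, k is 2 over the squared length of w, which is 2 (1 - c3 n)
    for a unit vector n. *)
Let w3 := c3 n - 1.
Let k : R := (1 - c3 n)^-1.

Definition reflect (p : V3) : V3 :=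
  let t := k * (c1 p * c1 n + c2 p * c2 n + c3 p * w3) in
  vec3 (c1 p - t * c1 n) (c2 p - t * c2 n) (c3 p - t * w3).

Let k_or : c3 n = 1 /\ c1 n = 0 /\ c2 n = 0 \/ k * (1 - c3 n) = 1.
Proof.
have [h|h] := eqVneq (c3 n) 1; last first.
  by right; rewrite /k mulVf // subr_eq0 eq_sym.
left; split=> //.
have : c1 n ^+ 2 + c2 n ^+ 2 = 0 by move: n_unit; rewrite h expr1n; lra.
have := sqr_ge0 (c1 n); have := sqr_ge0 (c2 n) => h2 h1 h0.
have z1 : c1 n ^+ 2 = 0 by lra.
have z2 : c2 n ^+ 2 = 0 by lra.
by split; apply/eqP; rewrite -sqrf_eq0 ?z1 ?z2 eqxx.
Qed.

Lemma reflectK : involutive reflect.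
Proof.
move=> p; case: k_or => [[h3 [h1 h2]]|hk].
  by apply: vec3P; rewrite /reflect !(c1E, c2E, c3E) /w3 h1 h2 h3 subrr !mulr0 !subr0.
have ww : k * (c1 n ^+ 2 + c2 n ^+ 2 + w3 ^+ 2) = 2.
  rewrite (_ : _ + w3 ^+ 2 = 2 * (1 - c3 n)); first by rewrite mulrCA hk mulr1.
  by rewrite /w3; have := n_unit; lra.
have key t : t = k * (c1 p * c1 n + c2 p * c2 n + c3 p * w3) ->
    k * ((c1 p - t * c1 n) * c1 n + (c2 p - t * c2 n) * c2 n + (c3 p - t * w3) * w3) = - t.
  move=> tE; transitivity (k * (c1 p * c1 n + c2 p * c2 n + c3 p * w3) -
    t * (k * (c1 n ^+ 2 + c2 n ^+ 2 + w3 ^+ 2))); first by ring.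
  by rewrite ww -tE; ring.
by apply: vec3P; rewrite /reflect !(c1E, c2E, c3E) key // ; ring.
Qed.

Lemma reflect_norm p : c1 (reflect p) ^+ 2 + c2 (reflect p) ^+ 2 + c3 (reflect p) ^+ 2 =
  c1 p ^+ 2 + c2 p ^+ 2 + c3 p ^+ 2.
Proof.
case: k_or => [[h3 [h1 h2]]|hk].
  by rewrite /reflect !(c1E, c2E, c3E) /w3 h1 h2 h3 subrr !mulr0 !subr0.
have ww : k * (c1 n ^+ 2 + c2 n ^+ 2 + w3 ^+ 2) = 2.
  rewrite (_ : _ + w3 ^+ 2 = 2 * (1 - c3 n)); first by rewrite mulrCA hk mulr1.
  by rewrite /w3; have := n_unit; lra.
rewrite /reflect !(c1E, c2E, c3E).
set d := c1 p * c1 n + c2 p * c2 n + c3 p * w3.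
transitivity (c1 p ^+ 2 + c2 p ^+ 2 + c3 p ^+ 2 - 2 * k * d ^+ 2 +
  k * d ^+ 2 * (k * (c1 n ^+ 2 + c2 n ^+ 2 + w3 ^+ 2))); first by rewrite /d; ring.
by rewrite ww; ring.
Qed.

Lemma reflect_pole : reflect n = vec3 0 0 1.
Proof.
case: k_or => [[h3 [h1 h2]]|hk]; apply: vec3P; rewrite /reflect !(c1E, c2E, c3E) /w3.
- by rewrite h1 h2 mulr0 subr0.
- by rewrite h1 h2 mulr0 subr0.
- by rewrite h1 h2 h3 subrr !mulr0 subr0.
all: have -> : k * (c1 n * c1 n + c2 n * c2 n + c3 n * (c3 n - 1)) = 1.
all: try (rewrite (_ : _ + _ = 1 - c3 n) // ; have := n_unit; lra).
all: by ring.
Qed.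

Lemma continuous_reflect : continuous reflect.
Proof.
have cM := @continuous_mul_fun R V3; have cD := @continuous_add_fun R V3.
have cB := @continuous_sub_fun R V3; have cC := @continuous_cst_fun R V3.
have cd : continuous (fun p => k * (c1 p * c1 n + c2 p * c2 n + c3 p * w3)).
  apply: (cM) => //; apply: (cD); [apply: (cD)|]; apply: (cM) => //;
  [exact: continuous_c1|exact: continuous_c2|exact: continuous_c3].
apply: continuous_vec3; apply: (cB); try (apply: (cM) => //);
  [exact: continuous_c1|exact: continuous_c2|exact: continuous_c3].
Qed.

Definition stereo (p : V3) : R * R :=
  let q := reflect p in (c1 q / (1 - c3 q), c2 q / (1 - c3 q)).

Definition unstereo (z : R * R) : V3 :=
  let d := (z.1 ^+ 2 + z.2 ^+ 2 + 1)^-1 in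
  reflect (vec3 (2 * z.1 * d) (2 * z.2 * d) (1 - 2 * d)).

Let dpos (z : R * R) : 0 < z.1 ^+ 2 + z.2 ^+ 2 + 1.
Proof. by have := sqr_ge0 z.1; have := sqr_ge0 z.2; lra. Qed.

Lemma unstereo_unit z : \sum_i unstereo z ord0 i ^+ 2 = 1.
Proof.
rewrite sum3 /unstereo reflect_norm !(c1E, c2E, c3E).
have d0 := dpos z; set D := _ + 1 in d0 *.
have DE : z.1 ^+ 2 + z.2 ^+ 2 = D - 1 by rewrite /D; ring.
have dn : D != 0 by rewrite gt_eqF.
transitivity (4 * (z.1 ^+ 2 + z.2 ^+ 2) * D^-1 ^+ 2 + (1 - 2 * D^-1) ^+ 2); first by ring.
by rewrite DE; field.
Qed.

Lemma unstereoK : cancel unstereo stereo.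
Proof.
have key (a D : R) : 0 < D -> 2 * a * D^-1 / (1 - (1 - 2 * D^-1)) = a.
  move=> D0; have dn : D != 0 by rewrite gt_eqF.
  have -> : 1 - (1 - 2 * D^-1) = 2 / D by ring.
  by field.
move=> z; rewrite /stereo /unstereo reflectK !(c1E, c2E, c3E) !key //.
exact/esym/surjective_pairing.
Qed.

Lemma unstereo_neq z : unstereo z <> n.
Proof.
move=> /(congr1 (fun p => c3 (reflect p))).
rewrite reflect_pole /unstereo reflectK !c3E.
have : 0 < (z.1 ^+ 2 + z.2 ^+ 2 + 1)^-1 by rewrite invr_gt0.
lra.
Qed.

Lemma stereo_den (p : V3) : \sum_i p ord0 i ^+ 2 = 1 -> p <> n -> 1 - c3 (reflect p) != 0.
Proof.
rewrite sum3 -reflect_norm => pu pn; rewrite subr_eq0; apply/eqP => q3.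
apply: pn; rewrite -(reflectK p) -[RHS]reflectK reflect_pole; congr reflect.
have := pu; rewrite -q3 expr1n => h.
have := sqr_ge0 (c1 (reflect p)); have := sqr_ge0 (c2 (reflect p)) => h2 h1.
apply: vec3P; [rewrite [RHS]c1E|rewrite [RHS]c2E|by rewrite [RHS]c3E -q3].
  by apply/eqP; rewrite -sqrf_eq0; apply/eqP; lra.
by apply/eqP; rewrite -sqrf_eq0; apply/eqP; lra.
Qed.

Lemma stereoK (p : V3) : \sum_i p ord0 i ^+ 2 = 1 -> p <> n -> unstereo (stereo p) = p.
Proof.
move=> pu pn; rewrite -[RHS]reflectK /unstereo; congr reflect.
have den := stereo_den pu pn.
move: pu; rewrite sum3 -reflect_norm /stereo /=; set q := reflect p in den * => qu.
set x := c1 q in qu *; set y := c2 q in qu *; set z := c3 q in qu den *.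
have E : (x / (1 - z)) ^+ 2 + (y / (1 - z)) ^+ 2 + 1 = 2 / (1 - z).
  rewrite !expr_div_n -mulrDl (_ : x ^+ 2 + y ^+ 2 = (1 - z) * (1 + z)); last by lra.
  by field.
have k1 a : 2 * (a / (1 - z)) * (2 / (1 - z))^-1 = a by field.
have k3 : 1 - 2 * (2 / (1 - z))^-1 = z by field.
by apply: vec3P; rewrite E; [rewrite c1E k1|rewrite c2E k1|rewrite c3E k3].
Qed.

Lemma continuous_unstereo : continuous unstereo.
Proof.
have cM := @continuous_mul_fun R (R * R)%type; have cD := @continuous_add_fun R (R * R)%type.
have cB := @continuous_sub_fun R (R * R)%type; have cC := @continuous_cst_fun R (R * R)%type.
have cf : continuous (fun z : R * R => z.1) by move=> z; exact: cvg_fst.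
have cs : continuous (fun z : R * R => z.2) by move=> z; exact: cvg_snd.
have cd : continuous (fun z : R * R => (z.1 ^+ 2 + z.2 ^+ 2 + 1)^-1).
  move=> z; apply: cvgV; first by rewrite gt_eqF.
  apply: (cD (fun z => z.1 ^+ 2 + z.2 ^+ 2) (fun=> 1)) => //.
  by apply: (cD); apply: (cM).
have cv : continuous (fun z : R * R => let d := (z.1 ^+ 2 + z.2 ^+ 2 + 1)^-1 in
    vec3 (2 * z.1 * d) (2 * z.2 * d) (1 - 2 * d)).
  apply: continuous_vec3; [by apply: (cM) => //; exact: (cM)|by apply: (cM) => //; exact: (cM)|].
  by apply: (cB) => //; exact: (cM).
by move=> z; apply: (continuous_comp (cv z)); exact: continuous_reflect.
Qed.

Lemma continuous_stereo (p : V3) : \sum_i p ord0 i ^+ 2 = 1 -> p <> n ->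
  {for p, continuous stereo}.
Proof.
move=> pu pn; have den := stereo_den pu pn.
have cr (f : V3 -> R) : continuous f -> {for p, continuous (fun p => f (reflect p))}.
  by move=> cf; exact: (@continuous_comp V3 V3 R reflect f p (@continuous_reflect p) (cf _)).
have c13 : continuous (fun p : V3 => 1 - c3 p).
  apply: (@continuous_sub_fun R V3 (fun=> 1) c3); last exact: continuous_c3.
  exact: continuous_cst_fun.
have cd := cr _ c13.
have h1 := continuous_div_fun (cr _ continuous_c1) cd den.
have h2 := continuous_div_fun (cr _ continuous_c2) cd den.
exact: (cvg_pair h1 h2).
Qed.

End Reflection.
End Stereographic.

(** * Configurations of the punctured sphere in plane coordinates *)

Local Open Scope classical_set_scope.
Local Open Scope ring_scope.

Lemma initial_cvg (S : choiceType) (T : topologicalType) (f : S -> T)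
    (F : set_system S) (s : S) :
  Filter F -> f @ F --> f s -> F --> (s : initial_topology f).
Proof.
move=> FF cF A [B [[C oC <-] /= Cs BA]].
by apply: filterS BA _; apply: (cF C); exact: open_nbhs_nbhs.
Qed.

Lemma continuous_ptws (T : topologicalType) (K : choiceType) (M : topologicalType)
    (g : T -> {ptws K -> M}) :
  (forall i, continuous (fun t => g t i)) -> continuous g.
Proof.
move=> cg t; apply/cvg_sup => i; apply: initial_cvg.
exact: cg.
Qed.

Lemma continuous_subtype (T M : topologicalType) (A : set M) (g : T -> set_type A) :
  continuous (fun t => set_val (g t)) -> continuous g.
Proof. by move=> cg t; apply: initial_cvg; exact: cg. Qed.

Lemma subtype_val_continuous (M : topologicalType) (A : set M) :
  continuous (set_val : set_type A -> M).
Proof. exact: initial_continuous. Qed.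

Section SphereConfig.
Local Open Scope quotient_scope.
Variables (R : realType) (N m : nat) (x : 'I_N.+1 -> sphere2 R).
Hypothesis x_inj : injective x.
Local Notation M := (punctured_sphere x).
Local Notation V := ('I_m -> R * R).
Variable b0 : config M m.
Variables (s k : R).
Hypothesis k_gt0 : 0 < k.

Let n0 : 'rV[R]_3 := \val (x ord0).

Lemma sphere_unit (p : sphere2 R) : \sum_i (\val p) ord0 i ^+ 2 = 1.
Proof. exact: (set_mem (valP p)). Qed.

Let n0_unit : c1 n0 ^+ 2 + c2 n0 ^+ 2 + c3 n0 ^+ 2 = 1.
Proof. by rewrite -sum3; exact: sphere_unit. Qed.

(** The coefficient s is there to separate the abscissae of the punctures, the factor k to bring
    their heights between -1 and 1; [general_position] supplies both. *)
Definition shear (z : R * R) : R * R := (z.1 + s * z.2, k * z.2).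
Definition unshear (z : R * R) : R * R := (z.1 - s * (z.2 / k), z.2 / k).

Let kn0 : k != 0. Proof. by rewrite gt_eqF. Qed.

Lemma shearK : cancel shear unshear.
Proof. by case=> a c; rewrite /shear /unshear /= [k * c]mulrC mulfK // addrK. Qed.

Lemma unshearK : cancel unshear shear.
Proof. by case=> a c; rewrite /shear /unshear /= subrK mulrC mulfVK. Qed.

Lemma continuous_shear : continuous shear.
Proof.
have cf : continuous (fun z : R * R => z.1) by move=> z; exact: cvg_fst.
have cs : continuous (fun z : R * R => z.2) by move=> z; exact: cvg_snd.
apply: pair_continuous.
  apply: continuous_add_fun => //; apply: continuous_mul_fun => //.
  exact: continuous_cst_fun.
by apply: continuous_mul_fun => //; exact: continuous_cst_fun.
Qed.

Lemma continuous_unshear : continuous unshear.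
Proof.
have cf : continuous (fun z : R * R => z.1) by move=> z; exact: cvg_fst.
have cs : continuous (fun z : R * R => z.2 / k).
  apply: continuous_mul_fun; last exact: continuous_cst_fun.
  by move=> z; exact: cvg_snd.
apply: pair_continuous => //; apply: continuous_sub_fun => //.
by apply: continuous_mul_fun => //; exact: continuous_cst_fun.
Qed.

Definition puncture (i : 'I_N) : R * R :=
  shear (stereo n0 (\val (x (lift ord0 i)))).

Definition coord (p : M) : R * R := shear (stereo n0 (\val (\val p))).

Let M_neq (p : M) i : \val p <> x i.
Proof. by move=> E; apply: (set_mem (valP p)); exists i. Qed.

Let M_neq0 (p : M) : \val (\val p) <> n0.
Proof. by move=> /val_inj; exact: M_neq. Qed.

Lemma coord_inj : injective coord.
Proof.
move=> p q /(can_inj shearK) E; apply/val_inj/val_inj.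
rewrite -(stereoK n0_unit (sphere_unit _) (@M_neq0 p)).
by rewrite -(stereoK n0_unit (sphere_unit _) (@M_neq0 q)) E.
Qed.

Lemma coord_puncture p i : coord p <> puncture i.
Proof.
move=> /(can_inj shearK) E; apply: (@M_neq p (lift ord0 i)).
apply/val_inj; rewrite -(stereoK n0_unit (sphere_unit _) (@M_neq0 p)) E.
rewrite stereoK //; first exact: sphere_unit.
by move=> /val_inj/x_inj/eqP; rewrite eq_sym (negPf (neq_lift _ _)).
Qed.

Let S_of (z : R * R) : sphere2 R :=
  exist _ (unstereo n0 (unshear z)) (mem_set (unstereo_unit n0_unit (unshear z))).

Let S_of_punctured z : (forall i, z <> puncture i) -> (~` range x) (S_of z).
Proof.
move=> zP [i _ E]; have {}E : \val (x i) = unstereo n0 (unshear z) by rewrite E.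
have [j ij|i0] := unliftP ord0 i; last first.
  by apply: (@unstereo_neq R n0 n0_unit (unshear z)); rewrite -E i0.
by apply: (zP j); rewrite /puncture -ij E unstereoK // unshearK.
Qed.

Let M_of z (h : forall i, z <> puncture i) : M :=
  exist _ (S_of z) (mem_set (S_of_punctured h)).

Let coord_of z (h : forall i, z <> puncture i) : coord (M_of h) = z.
Proof. by rewrite /coord /= unstereoK // unshearK. Qed.

Let config_of_neq (y : V) (h : in_conf puncture y) :
  [set y : {ptws 'I_m -> M} | forall i j, i != j -> y i <> y j]
    (fun i => M_of (h.2 i)).
Proof. by move=> i j ij /(congr1 coord); rewrite !coord_of; exact: h.1. Qed.

Let config_of (y : V) (h : in_conf puncture y) : config M m :=
  exist _ (fun i => M_of (h.2 i)) (mem_set (@config_of_neq y h)).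

Definition coords (q : config M m) : V := fun i => coord (config_fun q i).

Lemma coords_conf q : in_conf puncture (coords q).
Proof.
split=> [i j ij /coord_inj|i k']; last exact: coord_puncture.
exact: (set_mem (valP q)).
Qed.

Let config_inj q q' : coords q = coords q' -> q = q'.
Proof.
move=> E; apply/val_inj/funext => i; apply: coord_inj.
exact: (congr1 (fun f => f i) E).
Qed.

Let coords_of y (h : in_conf puncture y) : coords (config_of h) = y.
Proof. by apply/funext => i; rewrite /coords coord_of. Qed.

(** The class of [b0] is a default value for tuples that are not configurations. *)
Definition toX (y : V) : unordered_config M m :=
  match pselect (in_conf puncture y) with
  | left h => \pi_(unordered_config M m) (config_of h)
  | right _ => \pi_(unordered_config M m) b0
  end.

Let toX_conf y (h : in_conf puncture y) :
  toX y = \pi_(unordered_config M m) (config_of h).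
Proof.
rewrite /toX; case: pselect => [h'|//].
by congr \pi; apply: config_inj; rewrite !coords_of.
Qed.

Lemma toX_coords q : toX (coords q) = \pi_(unordered_config M m) q.
Proof.
rewrite /toX; case: pselect => [h|[]]; last exact: coords_conf.
by congr \pi; apply: config_inj; rewrite coords_of.
Qed.

Lemma toX_surj X : exists2 y, in_conf puncture y & toX y = X.
Proof.
exists (coords (generic_quotient.repr X)); first exact: coords_conf.
by rewrite toX_coords reprK.
Qed.

Lemma pi_relabel q q' : \pi_(unordered_config M m) q = \pi_(unordered_config M m) q' <->
  exists t, coords q' = relabel t (coords q).
Proof.
have key : \pi_{eq_quot (perm_equiv M m)} q = \pi_{eq_quot (perm_equiv M m)} q' <->
    perm_rel q q'.
  by split=> [/eqP|h]; [|apply/eqP]; rewrite eqmodE.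
split=> [h|[t E]].
  have /asboolP[t ht] : perm_rel q q' by exact/key.
  by exists t; apply/funext => i; rewrite /relabel /coords ht.
suff : perm_rel q q' by move/key.
apply/asboolP; exists t => i.
by apply: coord_inj; rewrite -[RHS]/(coords q' i) E.
Qed.

Lemma toX_relabel t y : toX (relabel t y) = toX y.
Proof.
have [h|h] := pselect (in_conf puncture y); last first.
  rewrite /toX; case: pselect => [/in_conf_relabel//|_].
  by case: pselect.
have h' : in_conf puncture (relabel t y) by apply/in_conf_relabel.
rewrite (toX_conf h) (toX_conf h'); apply/esym/pi_relabel.
by exists t; rewrite !coords_of.
Qed.

Lemma toX_inj y y' : in_conf puncture y -> in_conf puncture y' ->
  toX y = toX y' -> exists t, y' = relabel t y.
Proof.
move=> h h'; rewrite (toX_conf h) (toX_conf h') => /pi_relabel.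
by rewrite !coords_of.
Qed.

Lemma continuous_coord : continuous coord.
Proof.
move=> p; have cs : {for \val (\val p), continuous (stereo n0)}.
  by apply: continuous_stereo => //; try exact: sphere_unit; exact: M_neq0.
have cv1 := @subtype_val_continuous _ (~` range x) p.
have cv2 := @subtype_val_continuous _ _ (\val p : sphere2 R).
have cv := continuous_comp cv1 cv2.
exact: (continuous_comp (continuous_comp cv cs) (@continuous_shear _)).
Qed.

Lemma toX_continuous (T : topologicalType) (A : set T) (y : T -> V) :
  (forall i, {within A, continuous (fun t => y t i)}) ->
  (forall t, A t -> in_conf puncture (y t)) -> {within A, continuous (fun t => toX (y t))}.
Proof.
move=> cy Ay.
pose q (t : T) : config M m :=
  match pselect (in_conf puncture (y t)) with left h => config_of h | right _ => b0 end.
have qE t : toX (y t) = \pi_(unordered_config M m) (q t).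
  by rewrite /toX /q; case: pselect.
have -> : (fun t => toX (y t)) = (fun t => \pi_(unordered_config M m) (q t)).
  by apply/funext.
suff cq : continuous (q : subspace A -> config M m).
  by move=> t; apply: (continuous_comp (cq t)); exact: pi_continuous.
apply: continuous_subtype; apply: continuous_ptws => i.
apply: continuous_subtype; apply: continuous_subtype.
have cc : continuous (fun z => unstereo n0 (unshear z)).
  move=> z; apply: (continuous_comp (@continuous_unshear z)).
  exact: continuous_unstereo.
have cu : {within A, continuous (fun t => unstereo n0 (unshear (y t i)))}.
  move=> t; exact: (@continuous_comp (subspace A) _ _ (fun t : subspace A => y t i)
    (fun z => unstereo n0 (unshear z)) t (cy i t) (cc _)).
apply: (subspace_eq_continuous _ cu) => t /set_mem At.
by rewrite /from_subspace /q; case: pselect => [h|[]]; [|exact: Ay].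
Qed.

(** The unordered configurations having some labelling in the box form a set whose preimage is a
    union of relabelled boxes, open by continuity of the coordinates. *)
Lemma toX_open y r : in_conf puncture y -> 0 < r -> nbhs (toX y) (toX @` box y r).
Proof.
move=> cy r0.
pose O : set (unordered_config M m) :=
  [set X | exists2 q, \pi_(unordered_config M m) q = X & box y r (coords q)].
have Oy : O (toX y).
  by exists (config_of cy); [rewrite (toX_conf cy) | rewrite coords_of; exact: box_center].
have subO : O `<=` toX @` box y r.
  by move=> X [q <- bq]; exists (coords q) => //; exact: toX_coords.
apply: (filterS subO); apply: open_nbhs_nbhs; split=> //.
suff : open (\pi_(unordered_config M m) @^-1` O) by [].
have ceval i : continuous (fun q : config M m => coords q i).
  move=> q; have cq := @subtype_val_continuous {ptws 'I_m -> M} _ q.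
  have cp := @proj_continuous 'I_m (fun=> M) i (\val q).
  exact: (continuous_comp (continuous_comp cq cp) (@continuous_coord _)).
rewrite openE => q [q' /pi_relabel[t tE] bq].
have near_i i : \forall z \near q, (`|(coords z i).1 - (y (t i)).1| < r /\
    `|(coords z i).2 - (y (t i)).2| < r).
  have [b1 b2] := bq (t i).
  have qi : coords q i = coords q' (t i) by rewrite tE.
  pose W : set (R * R) := [set w | `|w.1 - (y (t i)).1| < r /\ `|w.2 - (y (t i)).2| < r].
  suff nW : nbhs (coords q i) W by exact: (ceval i q _ nW).
  rewrite qi; exists ([set u | `|u - (y (t i)).1| < r], [set u | `|u - (y (t i)).2| < r]).
    have nb (c v : R) : `|v - c| < r -> nbhs v [set u | `|u - c| < r].
      move=> vc; apply/nbhs_ballP; exists (r - `|v - c|); first by rewrite /= subr_gt0.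
      move=> u; rewrite /ball /= distrC => uv.
      by have := ler_distD v u c; lra.
    by split; exact: nb.
  by move=> [u v] [].
have near_all : \forall z \near q, forall i, (`|(coords z i).1 - (y (t i)).1| < r /\
    `|(coords z i).2 - (y (t i)).2| < r).
  exact: filter_forall near_i.
apply: filterS near_all => z hz.
have cz : in_conf puncture (relabel t^-1%g (coords z)).
  by apply/in_conf_relabel; exact: coords_conf.
exists (config_of cz).
  by rewrite -(toX_conf cz) toX_relabel toX_coords.
by move=> i; rewrite coords_of /relabel; have := hz (t^-1%g i); rewrite permKV.
Qed.

End SphereConfig.

(** * General position *)

Local Open Scope ring_scope.

(** A coincidence of two sheared abscissae determines s, so finitely many values are excluded; the
    remaining constants only have to be small or large enough. *)
Lemma general_position (R : realFieldType) (N m : nat) (z : 'I_N -> R * R) : injective z ->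
  exists s k x0 x1 gap, let P i := ((z i).1 + s * (z i).2, k * (z i).2) in
  [/\ 0 < k, 0 < gap, x0 < x1, forall i, -1 < (P i).2 < 1 &
      [/\ forall i, x0 + m%:R + gap *+ 4 < (P i).1, forall i, (P i).1 + gap *+ 4 < x1 &
        forall i j, i != j -> (P i).1 + gap *+ 4 < (P j).1 \/ (P j).1 + gap *+ 4 < (P i).1]].
Proof.
move=> z_inj.
pose g (p : 'I_N * 'I_N) := ((z p.1).1 - (z p.2).1) / ((z p.2).2 - (z p.1).2).
have [s /andP[s0 _] hs] := small_pos [seq g p | p <- enum {: 'I_N * 'I_N}] (@ltr01 R).
have [k /andP[k0 _] hk] := small_pos [seq (`|(z i).2| + 1)^-1 | i <- enum 'I_N] (@ltr01 R).
pose a i := (z i).1 + s * (z i).2.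
have a_inj i j : i != j -> a i != a j.
  move=> ij; apply/eqP => E; case/eqP: ij; apply: z_inj.
  have E' : (z i).1 - (z j).1 = s * ((z j).2 - (z i).2) by move: E; rewrite /a; lra.
  have [E2|ne] := eqVneq (z j).2 (z i).2.
    move: E'; rewrite E2 subrr mulr0 => /subr0_eq E1.
    by rewrite (surjective_pairing (z i)) E1 -E2 -surjective_pairing.
  have Eg : g (i, j) = s by rewrite /g E' mulfK // subr_eq0.
  have := hs (g (i, j)); rewrite Eg ltxx => h; suff: false by [].
  by apply: h => //; apply/mapP; exists (i, j); rewrite ?mem_enum.
have [gap /andP[g0 _] hg] := small_pos [seq `|a p.1 - a p.2| / 4%:R | p <- enum {: 'I_N * 'I_N}] (@ltr01 R).
pose M := \sum_i `|a i|.
have aM i : `|a i| <= M by rewrite /M (bigD1 i) //= lerDl sumr_ge0.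
exists s, k, (- M - m%:R - gap *+ 4 - 1), (M + gap *+ 4 + 1), gap => P.
have M0 : 0 <= M by exact: sumr_ge0.
have m0 : 0 <= m%:R :> R by [].
split=> //; [by lra| |split].
- move=> i; rewrite /P /= -ltr_norml normrM (gtr0_norm k0).
  have z0 : 0 < `|(z i).2| + 1 by have := normr_ge0 (z i).2; lra.
  have : k < (`|(z i).2| + 1)^-1.
    by apply: hk; rewrite ?invr_gt0 //; apply/mapP; exists i; rewrite ?mem_enum.
  rewrite -(ltr_pM2r z0) mulVf ?gt_eqF // => h.
  by apply: le_lt_trans h; rewrite ler_pM2l //; lra.
- by move=> i; rewrite -[(P i).1]/(a i); have := aM i; rewrite ler_norml; lra.
- by move=> i; rewrite -[(P i).1]/(a i); have := aM i; rewrite ler_norml; lra.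
- move=> i j ij; rewrite -[(P i).1]/(a i) -[(P j).1]/(a j).
  have : gap < `|a i - a j| / 4%:R.
    apply: hg; first by apply/mapP; exists (i, j); rewrite ?mem_enum.
    by rewrite divr_gt0 // normr_gt0 subr_eq0 a_inj.
  rewrite ltr_pdivlMr // lter_normr => /orP[]; lra.
Qed.

(** * Groups with braid relations *)

Local Open Scope classical_set_scope.
Local Open Scope group_scope.

Section IntegerPowers.
Variable G : groupType.
Implicit Types g h : G.

Definition zpow g (z : int) : G := match z with Posz n => g ^+ n | Negz n => g ^- n.+1 end.

Lemma zpow1 g : zpow g 1 = g. Proof. by rewrite /= expg1. Qed.

Lemma zpowS g z : zpow g (z + 1)%R = zpow g z * g.
Proof.
case: z => n; first by rewrite /= addn1 expgSr.
case: n => [|n]; first by rewrite /= expg1 mulVg.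
rewrite (_ : (Negz n.+1 + 1)%R = Negz n); last by rewrite !NegzE; lia.
by rewrite /= [in RHS]expgS invgM mulgKV.
Qed.

Lemma zpowB g z : zpow g (z - 1)%R = zpow g z * g^-1.
Proof. by rewrite -[z in RHS](subrK 1%R) zpowS mulgK. Qed.

Lemma int_ind1 (P : int -> Prop) : P 0%R -> (forall z, P z -> P (z + 1)%R) ->
  (forall z, P z -> P (z - 1)%R) -> forall z, P z.
Proof.
move=> P0 PS PP; elim/int_rect => // n; first by rewrite -addn1 PoszD => /PS.
by rewrite -addn1 PoszD opprD => /PP.
Qed.

Lemma zpowD g y z : zpow g (y + z)%R = zpow g y * zpow g z.
Proof.
elim/int_ind1: z => [|z IH|z IH]; first by rewrite addr0 mulg1.
  by rewrite addrA !zpowS IH mulgA.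
by rewrite addrA !zpowB IH mulgA.
Qed.

Lemma zpowN g z : zpow g (- z)%R = (zpow g z)^-1.
Proof. by apply/esym/mulg1_eq; rewrite -zpowD subrr. Qed.

Lemma commute_zpow g h z : commute g h -> commute g (zpow h z).
Proof.
by move=> c; case: z => n /=; [exact: commuteX|exact/commuteV/commuteX].
Qed.

Lemma zpow_conj g h z : zpow (g ^ h) z = zpow g z ^ h.
Proof. by case: z => n; rewrite /= ?conjVg conjXg. Qed.

Lemma zpowMg g h z : commute g h -> zpow (g * h) z = zpow g z * zpow h z.
Proof.
move=> c; case: z => n /=; first exact: expgMn.
rewrite expgMn // invgM.
by apply/commute_sym/commuteV/commute_sym/commuteV/commuteX2.
Qed.

Lemma zpowVg g z : zpow g^-1 z = (zpow g z)^-1.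
Proof. by case: z => n /=; rewrite expVgn. Qed.

End IntegerPowers.

Lemma row_int_ind k (Q : 'rV[int]_k -> Prop) : (Q 0)%R ->
  (forall v w, Q v -> Q w -> Q (v + w)%R) -> (forall v, Q v -> Q (- v)%R) ->
  (forall j, Q (delta_mx ord0 j)) -> forall v, Q v.
Proof.
move=> Q0 QD QN Qd v; rewrite (row_sum_delta v); apply: big_ind => // j _.
elim/int_ind1: (v _ _) => [|z IH|z IH]; first by rewrite scale0r.
  by rewrite scalerDl scale1r; apply: QD.
by rewrite scalerBl scale1r; apply: QD => //; exact: QN.
Qed.

Section BraidRelations.
Variables (G : groupType) (m N : nat) (s : nat -> G) (r : nat -> 'I_N -> G).

(** Generation takes the form of an induction principle. The alternative in [rel_poles] is due to
    the punctures not being numbered from left to right. *)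
Record braid_relations : Prop := BraidRelations {
  rel_far : forall p q, (p.+1 < q)%N -> (q.+1 < m)%N -> commute (s p) (s q);
  rel_braid : forall p, (p.+2 < m)%N -> s p * s p.+1 * s p = s p.+1 * s p * s p.+1;
  rel_push : forall i k, (i.+1 < m)%N -> r i k = s i * r i.+1 k * (s i)^-1;
  rel_poles : forall i k l, (i.+1 < m)%N -> k != l ->
    commute (r i k) (r i.+1 l) \/ commute (r i l) (r i.+1 k);
  rel_pole_far : forall i p k, (i < m)%N -> (p.+1 < m)%N -> p != i -> p.+1 != i ->
    commute (r i k) (s p);
  rel_generation : forall H : G -> Prop, H 1 -> (forall x y, H x -> H y -> H (x * y)) ->
    (forall x, H x -> H x^-1) -> (forall p, (p.+1 < m)%N -> H (s p)) ->
    (forall i k, (i < m)%N -> H (r i k)) -> forall g, H g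
}.

Hypothesis rels : braid_relations.

Lemma rho_constant k : (forall p, (p.+1 < m)%N -> commute (r 0 k) (s p)) ->
  forall i, (i < m)%N -> r i k = r 0 k.
Proof.
move=> c; elim=> [//|i IH] im.
have := rel_push rels k im; rewrite IH ?(ltn_trans _ im) // => E.
apply: (@mulgI _ (s i)); apply: (@mulIg _ (s i)^-1).
by rewrite -E -(c i im) mulgK.
Qed.

Lemma rho_commute : (1 < m)%N -> (forall k p, (p.+1 < m)%N -> commute (r 0 k) (s p)) ->
  forall k l, commute (r 0 k) (r 0 l).
Proof.
move=> m1 c k l; have [->//|kl] := eqVneq k l.
have E k' : r 1 k' = r 0 k' by exact: rho_constant (c k') _ m1.
by have [] := rel_poles rels m1 kl; rewrite E // => /commute_sym.
Qed.

Lemma commute_generated x : (forall p, (p.+1 < m)%N -> commute x (s p)) ->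
  (forall i k, (i < m)%N -> commute x (r i k)) -> forall g, commute x g.
Proof.
move=> cs cr; apply: (rel_generation rels (H := commute x)) => //; first exact: commute1.
  by move=> y z; apply: commuteM.
by move=> y; apply: commuteV.
Qed.

Lemma abelian_of_equal_sigmas : (3 <= m)%N -> (forall p, (p.+1 < m)%N -> s p = s 0) ->
  forall x y : G, commute x y.
Proof.
move=> m3 sE.
have c k p : (p.+1 < m)%N -> commute (r 0 k) (s p).
  (* The loop of strand 0 is far from the half twist of strands 1 and 2, which exists since m >= 3
     and equals all the others. *)
  move=> pm; rewrite sE // -(sE 1%N) //.
  by apply: (rel_pole_far rels) => //; exact: leq_trans m3.
have rE k i := rho_constant (c k) (i := i).
have rr := rho_commute (ltnW m3) c.
move=> x y; apply: commute_generated => [p pm|i k im]; apply: commute_sym;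
  apply: commute_generated => [p' pm'|i' k' im'].
- by rewrite (sE p pm) (sE p' pm').
- by rewrite rE //; apply/commute_sym/c.
- by rewrite rE //; exact: c.
- by rewrite !rE.
Qed.

Lemma sigma_conj p : (p.+2 < m)%N -> s p.+1 = s p ^ (s p.+1 * s p).
Proof.
move=> pm; rewrite conjgE; apply: (@mulgI _ (s p.+1 * s p)); rewrite !mulgA mulgV mul1g.
by rewrite (rel_braid rels pm).
Qed.

Lemma sigma_eq p : (p.+2 < m)%N -> commute (s p) (s p.+1) -> s p.+1 = s p.
Proof.
move=> pm c; rewrite (sigma_conj pm) conjgE.
have c' : commute (s p.+1 * s p) (s p) by apply/commute_sym/commuteM.
by rewrite -c' mulKg.
Qed.

(** Adjacent half twists are conjugate, so they differ by a commutator; this being central, they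
    commute, and the braid relation makes them equal. *)
Lemma abelian_of_central_commutators : (3 <= m)%N ->
  (forall x y z : G, commute [~ x, y] z) -> forall x y : G, commute x y.
Proof.
move=> m3 cen; apply: abelian_of_equal_sigmas => //.
elim=> [//|p IH] pm; rewrite -IH; last exact: ltnW.
apply: sigma_eq => //; rewrite (sigma_conj pm) -(mulKVg (s p) (_ ^ _)) -commgEl.
by apply: commuteM; [exact: commute_refl|apply/commute_sym/cen].
Qed.

Definition metabelian := forall x y z w : G, commute [~ x, y] [~ z, w].

Lemma sigma_quotient p : (p.+2 < m)%N ->
  s p.+1 * (s p)^-1 = [~ s p.+1 * s p, (s p)^-1].
Proof.
by move=> pm; rewrite {1}(sigma_conj pm) /commg !conjgE !mulgA invgK.
Qed.

(** The quotient c of [s p.+2] by [s p] commutes with [s p]. Quotients of adjacent half twists are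
    commutators, so c is a product of two of them and commutes with [s p.+1] as well. The braid
    relation between [s p.+1] and [c * s p] then reduces to c = c^2. *)
Lemma sigma_period p : metabelian -> (p.+3 < m)%N -> s p.+2 = s p.
Proof.
move=> meta pm; have pm1 : (p.+2 < m)%N by exact: ltnW.
set a := s p; set b := s p.+1; pose c := s p.+2 * a^-1.
have Ec : s p.+2 = c * a by rewrite /c mulgKV.
have ca : commute c a.
  apply/commute_sym/commuteM; last exact/commuteV.
  exact: (rel_far rels).
have cu : commute c (b * a^-1).
  rewrite /c (_ : s p.+2 * a^-1 = (s p.+2 * b^-1) * (b * a^-1)); last by rewrite mulgA mulgKV.
  rewrite /a /b !sigma_quotient //; apply/commute_sym/commuteM; exact: meta.
have cb : commute c b by rewrite -(mulgKV a b); apply: commuteM.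
have := rel_braid rels pm; have := rel_braid rels pm1; rewrite -/a -/b Ec => B1 B2.
suff c1 : c = 1 by rewrite c1 mul1g.
apply: (@mulgI _ c); rewrite mulg1; apply: (@mulIg _ (a * b * a)).
have E1 : b * (c * a) * b = c * (a * b * a).
  by rewrite B1 mulgA -cb !mulgA.
have E2 : c * a * b * (c * a) = c * c * (a * b * a).
  have -> : c * a * b * (c * a) = c * (a * b * c) * a by rewrite !mulgA.
  by rewrite -(commuteM ca cb) !mulgA.
by rewrite -E2 -B2 E1.
Qed.

(** m >= 5 provides [s 3], which equals [s 1] and commutes with [s 0]; so [s 0] and [s 1] commute
    and coincide. *)
Lemma abelian_of_metabelian : (5 <= m)%N -> metabelian -> forall x y : G, commute x y.
Proof.
move=> m5 meta; apply: abelian_of_equal_sigmas; first by lia.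
have E2 p : (p.+3 < m)%N -> s p.+2 = s p by exact: sigma_period.
have E1 p : (p.+2 < m)%N -> s p.+1 = s p.
  elim: p => [|p IH] pm; last by rewrite E2 // IH //; lia.
  apply: sigma_eq => //; rewrite -(E2 1%N) //.
  by apply: (rel_far rels).
by elim=> [//|p IH] pm; rewrite E1 // IH //; lia.
Qed.

End BraidRelations.

(** * Cosets and commutator subgroups *)

Local Open Scope classical_set_scope.
Local Open Scope group_scope.

Section Cosets.
Variables (G : groupType) (K : normalSubgroup G).

Lemma cosetM x y : coset K (x * y) = coset K x * coset K y.
Proof. exact: gmulfM. Qed.

Lemma cosetV x : coset K x^-1 = (coset K x)^-1.
Proof. exact: gmulfV. Qed.

Lemma coset_commuteP x y : commute (coset K x) (coset K y) <-> (K : set G) [~ y, x].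
Proof.
have E : [~ y, x] = (x * y)^-1 * (y * x) by rewrite commgEl conjgE invgM !mulgA.
by rewrite /commute -!cosetM E -coset_eq.
Qed.

Lemma coset_commg x y : coset K [~ x, y] = [~ coset K x, coset K y].
Proof. by rewrite !commgEl !conjgE !(cosetM, cosetV). Qed.

Lemma coset1P x : coset K x = 1 <-> (K : set G) x.
Proof.
rewrite -(coset_gmulf1 K); split=> [/esym/coset_eq|h]; first by rewrite invg1 mul1g.
by apply/esym/coset_eq; rewrite invg1 mul1g.
Qed.

Lemma braid_relations_coset m N (s : nat -> G) (r : nat -> 'I_N -> G) :
  braid_relations m s r ->
  braid_relations m (fun p => coset K (s p)) (fun i k => coset K (r i k)).
Proof.
move=> [far braid push poles pole_far gen]; split.
- by move=> p q pq qm; have := congr1 (coset K) (far p q pq qm); rewrite !cosetM.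
- by move=> p pm; have := congr1 (coset K) (braid p pm); rewrite !cosetM.
- by move=> i k im; have := congr1 (coset K) (push i k im); rewrite !cosetM cosetV.
- by move=> i k l im kl; case: (poles i k l im kl) => /(congr1 (coset K));
    rewrite !cosetM; [left|right].
- move=> i p k im pm h1 h2.
  by have := congr1 (coset K) (pole_far i p k im pm h1 h2); rewrite !cosetM.
move=> H H1 HM HV Hs Hr X; rewrite -(coset_reprK X).
apply: (gen (fun g => H (coset K g))) => // [x y Hx Hy|x Hx]; rewrite ?cosetM ?cosetV; [exact: HM|exact: HV].
Qed.

End Cosets.

Section CommutatorSubgroups.
Variable G : groupType.

Lemma generated_sub (S : set G) (K : subgroup G) : S `<=` K -> Defs.generated S `<=` K.
Proof.
by move=> SK x; apply; split=> //; [exact: sgrp1|move=> a b; exact: sgrpM|move=> a; exact: sgrpV].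
Qed.

Lemma commutator_mem (A C : set G) x y : A x -> C y -> commutator_subgroup A C [~ x, y].
Proof. by move=> Ax Cy D [_ _ _]; apply; exists x, y. Qed.

Lemma commutator_sub (A C : set G) (K : subgroup G) :
  (forall x y, A x -> C y -> (K : set G) [~ x, y]) -> commutator_subgroup A C `<=` K.
Proof. by move=> h; apply: generated_sub => _ [x [y [Ax Cy ->]]]; exact: h. Qed.

Lemma derived1_sub (K : normalSubgroup G) :
  (forall X Y : quotient_group K, commute X Y) -> derived G 1 `<=` K.
Proof.
by move=> h; apply: commutator_sub => x y _ _; apply/coset_commuteP.
Qed.

Lemma derived2_sub : derived G 2 `<=` derived G 1.
Proof.
by apply: (@commutator_sub _ _ (derived G 1)) => x y _ _; exact: commutator_mem.
Qed.

Lemma lower_central3_sub : lower_central G 3 `<=` lower_central G 2.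
Proof.
by apply: (@commutator_sub _ _ (lower_central G 2)) => x y _ _; exact: commutator_mem.
Qed.

Lemma derived_metabelian : metabelian (quotient_group (derived G 2)).
Proof.
move=> X Y Z W; rewrite -(coset_reprK X) -(coset_reprK Y) -(coset_reprK Z) -(coset_reprK W).
rewrite -!coset_commg; apply/coset_commuteP.
by apply: commutator_mem; exact: commutator_mem.
Qed.

Variables (m N : nat) (s : nat -> G) (r : nat -> 'I_N -> G).
Hypothesis rels : braid_relations m s r.

Lemma lower_central_stable : (3 <= m)%N -> lower_central G 3 = lower_central G 2.
Proof.
move=> m3; apply/seteqP; split; first exact: lower_central3_sub.
(* [derived G 1] and [lower_central G 2] unfold to the same set. *)
apply: (@derived1_sub (lower_central G 3)).
apply: (abelian_of_central_commutators (braid_relations_coset _ rels)) => // X Y Z.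
rewrite -(coset_reprK X) -(coset_reprK Y) -(coset_reprK Z) -coset_commg.
by apply/coset_commuteP; apply: commutator_mem => //; exact: commutator_mem.
Qed.

Lemma derived_stable : (5 <= m)%N -> derived G 2 = derived G 1.
Proof.
move=> m5; apply/seteqP; split; first exact: derived2_sub.
apply: derived1_sub.
apply: (abelian_of_metabelian (braid_relations_coset _ rels)) => //.
exact: derived_metabelian.
Qed.

End CommutatorSubgroups.

(** * Homomorphisms induced on quotients *)

Section QuotientLift.
Variables (G T : groupType) (K : normalSubgroup G) (f : G -> T).
Hypothesis fM : {morph f : x y / x * y}.
Hypothesis fK : forall x, (K : set G) x -> f x = 1.

Definition quotient_lift (X : quotient_group K) : T := f (coset_repr X).

Lemma quotient_lift_coset x : quotient_lift (coset K x) = f x.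
Proof.
apply: (@mulgI _ (f (coset_repr (coset K x))^-1)); rewrite -!fM mulVg.
have /coset_eq h : coset K (coset_repr (coset K x)) = coset K x by exact: coset_reprK.
by rewrite (fK h) fK //; exact: sgrp1.
Qed.

Lemma quotient_liftM : {morph quotient_lift : X Y / X * Y}.
Proof.
move=> X Y; rewrite -(coset_reprK X) -(coset_reprK Y) -cosetM.
by rewrite !quotient_lift_coset fM.
Qed.

Lemma quotient_lift1 : quotient_lift 1 = 1.
Proof. by apply: (@mulgI _ (quotient_lift 1)); rewrite -quotient_liftM !mulg1. Qed.

HB.instance Definition _ := isUMagmaMorphism.Build (quotient_group K) T quotient_lift
  (quotient_lift1, quotient_liftM).

Definition quotient_map : {multiplicative quotient_group K -> T} := quotient_lift.

Lemma quotient_map_bijective : (forall x, f x = 1 -> (K : set G) x) ->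
  (forall t, exists x, f x = t) -> bijective quotient_map.
Proof.
move=> finj fsurj; pose g t := coset K (projT1 (cid (fsurj t))).
have fg t : f (projT1 (cid (fsurj t))) = t by case: (cid _).
have fV x : f x^-1 = (f x)^-1.
  by apply/esym/mulg1_eq; rewrite -fM mulgV fK //; exact: sgrp1.
exists g => [X|t]; last by rewrite /= quotient_lift_coset fg.
rewrite -(coset_reprK X) /= quotient_lift_coset; apply/coset_eq/finj.
by rewrite fM fV fg mulVg.
Qed.

End QuotientLift.

(** * Quotients for four strands *)

Local Open Scope classical_set_scope.
Local Open Scope group_scope.

Section FourStrands.
Variables (G : groupType) (N : nat) (s : nat -> G) (r : nat -> 'I_N -> G).
Hypothesis rels : braid_relations 4 s r.
Variable phi : G -> invariant_group N.
Hypothesis phiM : {morph phi : x y / x * y}.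
Hypothesis phi_s : forall p, (p < 3)%N -> phi (s p) = (tri_group ((p == 1%N)%:R, 0, 1%N)%R, 1).
Hypothesis phi_r : forall i k, (i < 4)%N -> phi (r i k) = (1, freeZ_basis k).

Local Notation Q := (quotient_group (derived G 2)).
Local Notation cos := (coset (derived G 2)).

Let rQ := braid_relations_coset (derived G 2) rels.
Let meta : metabelian Q := @derived_metabelian G.

Let a : Q := cos (s 0).
Let b : Q := cos (s 1).
Let c (k : 'I_N) : Q := cos (r 0 k).
Let u : Q := b * a^-1.
Let v : Q := u ^ a^-1.

Let s2 : cos (s 2) = a. Proof. exact: (sigma_period rQ meta). Qed.

Let ca k : commute (c k) a.
(* The loop of strand 0 is far from [s 2], which equals [s 0] modulo the second derived subgroup. *)
Proof. by rewrite -s2; apply: (rel_pole_far rQ). Qed.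

Let cb k : commute (c k) b.
Proof. by apply: (rel_pole_far rQ). Qed.

Let cs k p : (p.+1 < 4)%N -> commute (c k) (cos (s p)).
Proof. by case: p => [|[|[|//]]] _; [exact: ca|exact: cb|rewrite s2; exact: ca]. Qed.

Let cc k l : commute (c k) (c l).
Proof. by apply: (rho_commute rQ) => // k' p; exact: cs. Qed.

Let rE i k : (i < 4)%N -> cos (r i k) = c k.
Proof. by move=> i4; apply: (rho_constant rQ) => // p; exact: cs. Qed.

Let uE : u = [~ b * a, a^-1]. Proof. exact: (sigma_quotient rQ). Qed.

Let uv : commute u v.
Proof. by rewrite /v uE conjRg; exact: meta. Qed.

(** The braid relation rewritten in u: the action of a satisfies t^2 - t + 1 = 0 on u. *)
Let va : v ^ a^-1 = u^-1 * v.
Proof.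
have B : a * b * a = b * a * b by exact: (rel_braid rQ).
apply: (@mulgI _ u); rewrite mulKVg /v -conjgM.
have bE : b = u * a by rewrite /u mulgKV.
have h (x y : Q) : x ^ y^-1 = y * x * y^-1 by rewrite conjgE invgK mulgA.
rewrite -invgM !h; apply: (@mulIg _ (a * a * a)).
transitivity (b * a * b); first by rewrite bE invgM !mulgA !mulgKV.
by rewrite -B bE !mulgA !mulgKV.
Qed.

Let vec_part (w : 'rV[int]_2) : Q := zpow u (w ord0 ord0) * zpow v (w ord0 ord_max).

Let vec_partD w w' : vec_part (w + w')%R = vec_part w * vec_part w'.
Proof.
rewrite /vec_part !mxE !zpowD !mulgA; congr (_ * _); rewrite -!mulgA; congr (_ * _).
by apply/commute_zpow/commute_sym/commute_zpow.
Qed.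

Let vec_part_hex w : vec_part w ^ a^-1 = vec_part (w *m hex)%R.
Proof.
rewrite [w in RHS]vec2_eta vec2_hex /vec_part !mxE /= conjMg -!zpow_conj va -/v.
have uVv : commute u^-1 v by apply/commute_sym/commuteV/commute_sym.
rewrite (zpowMg _ uVv) zpowVg zpowN mulgA zpowD mulgA; congr (_ * _).
by apply/commuteV/commute_zpow/commute_sym/commute_zpow.
Qed.

Let vec_part_conj z w : vec_part w ^ (zpow a z)^-1 = vec_part (w *m (hex ^ z))%R.
Proof.
rewrite -zpowN; elim/int_ind1: z => [|z IH|z IH].
- by rewrite oppr0 conjg1 expr0z mulmx1.
- rewrite opprD zpowB conjgM IH vec_part_hex -mulmxA; congr (vec_part (w *m _)%R).
  by rewrite (exprzDr hex_unit) expr1z.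
- rewrite opprD opprK zpowS conjgM IH.
  have <- : vec_part (w *m hex ^ (z - 1))%R ^ a^-1 = vec_part (w *m hex ^ z)%R.
    by rewrite vec_part_hex -mulmxA -[in RHS](subrK 1%R z) (exprzDr hex_unit _ 1) expr1z.
  by rewrite conjgKV.
Qed.

Let pole_part (w : 'rV[int]_N) : Q := \prod_(k < N) zpow (c k) (w ord0 k).

Let commute_pole_part x : (forall k, commute x (c k)) -> forall w, commute x (pole_part w).
Proof. by move=> h w; apply: commute_prod => k _; exact: commute_zpow. Qed.

Let pole_partD w w' : pole_part (w + w')%R = pole_part w * pole_part w'.
Proof.
rewrite -prodgM_commute; last first.
  by move=> k l _ _; apply/commute_zpow/commute_sym/commute_zpow.
by apply: eq_bigr => k _; rewrite mxE zpowD.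
Qed.

Let pole_part_basis k : pole_part (delta_mx ord0 k) = c k.
Proof.
rewrite /pole_part (eq_bigr (fun l => if l == k then c k else 1)); last first.
  by move=> l _; rewrite mxE eqxx /=; case: eqP => [->|_]; rewrite ?zpow1.
suff h (l : seq 'I_N) : uniq l ->
    \prod_(j <- l) (if j == k then c k else 1) = if k \in l then c k else 1.
  by rewrite h ?index_enum_uniq // mem_index_enum.
elim: l => [|j l IH] /=; first by rewrite big_nil.
move=> /andP[jl /IH E]; rewrite big_cons E in_cons eq_sym.
by case: eqP jl => [<- /negPf->|_ _]; rewrite ?mulg1 ?mul1g.
Qed.

(* The inverse of the map induced by phi. *)
Let psi (t : invariant_group N) : Q :=
  vec_part t.1.1 * zpow a ((t.1.2 : 'rV[int]_1) ord0 ord0) * pole_part t.2.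

Let cu k : commute (c k) u.
Proof. by apply: commuteM; [exact: cb|apply/commuteV; exact: ca]. Qed.

Let cv k : commute (c k) v.
Proof.
rewrite /v conjgE invgK; apply: commuteM; first exact: ca.
by apply: commuteM; [exact: cu|apply/commuteV; exact: ca].
Qed.

(** Conjugation by a acts on u and v as [hex] does, and each [c k] commutes with a, u and v, so the
    factors reorder as in the semidirect product. *)
Let psiM : {morph psi : x y / x * y}.
Proof.
move=> [[w x] y] [[w' x'] y'].
have E1 : psi ((w, x), y) = vec_part w * zpow a ((x : 'rV[int]_1) ord0 ord0) * pole_part y by [].
have E2 : psi ((w', x'), y') = vec_part w' * zpow a ((x' : 'rV[int]_1) ord0 ord0) * pole_part y' by [].
have -> : psi ((((w, x), y) : invariant_group N) * (((w', x'), y') : invariant_group N)) =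
    vec_part ((w : 'rV[int]_2) + (w' : 'rV[int]_2) *m hex ^ (x : 'rV[int]_1) ord0 ord0)%R *
    zpow a (((x : 'rV[int]_1) + (x' : 'rV[int]_1))%R ord0 ord0) *
    pole_part ((y : 'rV[int]_N) + (y' : 'rV[int]_N))%R by [].
rewrite E1 E2 vec_partD pole_partD -vec_part_conj mxE zpowD.
have P1 : commute (vec_part w' * zpow a ((x' : 'rV[int]_1) ord0 ord0)) (pole_part y).
  apply: commute_pole_part => k; apply/commute_sym/commuteM.
    by apply: commuteM; apply: commute_zpow; [exact: cu|exact: cv].
  by apply: commute_zpow; exact: ca.
have -> (p q p' q' : Q) : p * q * pole_part y * (p' * q' * pole_part y') =
    p * q * (pole_part y * (p' * q')) * pole_part y' by rewrite !mulgA.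
rewrite -P1 conjgE invgK !mulgA mulgKV.
by [].
Qed.

(** Both sides are multiplicative, so generators suffice. It places the kernel of phi inside the
    second derived subgroup. *)
Let psi_phi g : psi (phi g) = cos g.
Proof.
have psi1 : psi 1 = 1 by apply: (@mulgI _ (psi 1)); rewrite -psiM !mulg1.
have phi1 : phi 1 = 1 by apply: (@mulgI _ (phi 1)); rewrite -phiM !mulg1.
have psiV t : psi t^-1 = (psi t)^-1 by apply/esym/mulg1_eq; rewrite -psiM mulgV.
have phiV x : phi x^-1 = (phi x)^-1 by apply/esym/mulg1_eq; rewrite -phiM mulgV.
apply: (rel_generation rels (H := fun g => psi (phi g) = cos g)) => //.
- by rewrite phi1 psi1.
- by move=> x y Ex Ey; rewrite phiM psiM Ex Ey cosetM.
- by move=> x Ex; rewrite phiV psiV Ex cosetV.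
- have v0 (x y : int) : vec_part (vec2 x y) = zpow u x * zpow v y.
    by rewrite /vec_part !mxE.
  have p0 : pole_part 0 = 1.
    by rewrite /pole_part big1 // => k _; rewrite mxE.
  move=> p p3; rewrite (phi_s p3) /psi /= v0 p0 mulg1 !mxE eqxx mulr1 zpow1.
  case: p p3 => [|[|[|//]]] _ /=; rewrite ?mulg1 ?mul1g //.
    by rewrite expg1 mulgKV.
- move=> i k i4; rewrite (phi_r _ i4) rE // /psi /= pole_part_basis.
  by rewrite /vec_part !mxE /= !mul1g.
Qed.

Let phi1 : phi 1 = 1. Proof. by apply: (@mulgI _ (phi 1)); rewrite -phiM !mulg1. Qed.
Let phiV x : phi x^-1 = (phi x)^-1.
Proof. by apply/esym/mulg1_eq; rewrite -phiM mulgV phi1. Qed.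

Let phi_commutator x y : phi [~ x, y] = [~ phi x, phi y].
Proof. by rewrite !commgEl !conjgE !(phiM, phiV). Qed.

Let vec_emb (w : freeZ 2) : invariant_group N := ((w, 1), 1).
Let sig_emb (x : freeZ 1) : invariant_group N := ((1, x), 1).
Let pole_emb (y : freeZ N) : invariant_group N := (1, y).

Let vec_embM : {morph vec_emb : x y / x * y}.
Proof.
move=> w w'; apply: invariant_eq; last by rewrite /= mulg1.
by apply: (congr2 pair); [rewrite -[RHS]/(w * hex_act ord0 1 w') gact1|rewrite -[RHS]/(1 * 1) mulg1].
Qed.

Let sig_embM : {morph sig_emb : x y / x * y}.
Proof.
move=> x x'; apply: invariant_eq; last by rewrite /= mulg1.
apply: (congr2 pair) => //.
by rewrite -[RHS]/(1 * hex_act ord0 x 1) gact_one mulg1.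
Qed.

Let pole_embM : {morph pole_emb : x y / x * y}.
Proof.
move=> y y'; apply: invariant_eq => //.
by rewrite -[RHS]/(1 * 1) mulg1.
Qed.

(** The subgroup D keeps track of the preimages: the vector part has to be reached from the derived
    subgroup. *)
Lemma span_image k (D : subgroup G) (e : freeZ k -> invariant_group N) :
  {morph e : x y / x * y} ->
  (forall j, exists2 g, (D : set G) g & phi g = e (freeZ_basis j)) ->
  forall w, exists2 g, (D : set G) g & phi g = e w.
Proof.
move=> eM he; have e1 : e 1 = 1 by apply: (@mulgI _ (e 1)); rewrite -eM !mulg1.
apply: (@row_int_ind k (fun w => exists2 g, (D : set G) g & phi g = e w)) => //.
- by exists 1; [exact: sgrp1|rewrite phi1 -e1].
- move=> w w' [g Dg Eg] [g' Dg' Eg']; exists (g * g'); first exact: sgrpM.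
  by rewrite phiM Eg Eg' -eM.
- move=> w [g Dg Eg]; exists g^-1; first exact: sgrpV.
  rewrite phiV Eg; apply/esym; apply: (@mulgI _ (e w)).
  by rewrite mulgV -eM -e1; congr (e _); exact: mulgV.
Qed.

Let tri_split x y k : tri_group ((x, y), k) = tri_group ((x, y), 0%N) * tri_group ((0, 0)%R, k).
Proof. by rewrite -tri_groupM /tri_mul /= !addr0. Qed.

Let phi_u : phi (s 1 * (s 0)^-1) = vec_emb ubar.
Proof.
rewrite phiM phiV !phi_s // tri_split.
apply: invariant_eq; last by rewrite /= mulgV.
change (tri_group (1%R, 0%R, 0%N) * tri_group ((0, 0)%R, 1%N) *
  (tri_group ((0, 0)%R, 1%N))^-1 = (ubar, 1)).
rewrite mulgK /tri_group ubarE /=; congr pair.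
by apply/rowP => j; rewrite !mxE mul0r.
Qed.

Let tri1 : tri_group ((0, 0)%R, 1%N) = (1, freeZ_basis ord0).
Proof.
rewrite /tri_group; congr pair; last by rewrite scale1r.
by apply/rowP => j; rewrite !mxE /=; case: (j == ord0).
Qed.

Let phi_s0 : phi (s 0) = sig_emb (freeZ_basis ord0).
Proof. by rewrite phi_s // tri1. Qed.

Let phi_v : phi ((s 1 * (s 0)^-1) ^ (s 0)^-1) = vec_emb vbar.
Proof.
rewrite conjgE invgK (phiM (s 0)) (phiM _ (s 0)^-1) phi_u phiV phi_s0 mulgA.
apply: (@mulIg _ (sig_emb (freeZ_basis ord0))); rewrite mulgKV.
apply: invariant_eq; last by rewrite /= mulg1.
change ((1 * @hex_act 1 ord0 (freeZ_basis ord0) ubar, freeZ_basis ord0 * 1) =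
  (vbar * @hex_act 1 ord0 1 1, 1 * freeZ_basis ord0) :> semidirect (@hex_act 1 ord0)).
by rewrite hex_act_ubar gact1 !mulg1 !mul1g.
Qed.

Lemma derived1_phi w : exists2 g, derived G 1 g & phi g = vec_emb w.
Proof.
have du : derived G 1 (s 1 * (s 0)^-1).
  by rewrite (sigma_quotient rels) //; exact: commutator_mem.
apply: (@span_image 2 (derived G 1)) => // -[[|[|//]] hj].
  have -> : Ordinal hj = ord0 by exact: val_inj.
  by exists (s 1 * (s 0)^-1).
have -> : Ordinal hj = ord_max by exact: val_inj.
exists ((s 1 * (s 0)^-1) ^ (s 0)^-1); last exact: phi_v.
exact: (@sgrpJ _ (derived G 1)).
Qed.

Lemma phi_surjective t : exists g, phi g = t.
Proof.
case: t => [[w x] y].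
have [g1 _ E1] := derived1_phi w.
(* [lower_central G 1] is all of G, here packaged as a subgroup. *)
have [g2 _ E2] : exists2 g, lower_central G 1 g & phi g = sig_emb x.
  apply: (@span_image 1 (lower_central G 1)) => // j; exists (s 0) => //.
  by rewrite (ord1 j).
have [g3 _ E3] : exists2 g, lower_central G 1 g & phi g = pole_emb y.
  apply: (@span_image N (lower_central G 1)) => // k; exists (r 0 k) => //.
  by rewrite phi_r.
exists (g1 * g2 * g3); rewrite !phiM E1 E2 E3.
apply: invariant_eq; last by rewrite /= !mul1g.
change ((w * @hex_act 1 ord0 1 1 * @hex_act 1 ord0 (1 * x) 1, 1 * x * 1) =
  (w, x) :> semidirect (@hex_act 1 ord0)).
by rewrite gact1 gact_one !mulg1 !mul1g.
Qed.

Lemma derived1_trivial g : derived G 1 g -> phi g = vec_emb (phi g).1.1.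
Proof.
pose K : set G := [set g | phi g = vec_emb (phi g).1.1].
have K1 : K 1 by rewrite /K /= phi1.
have KM x y : K x -> K y -> K (x * y).
  by rewrite /K /= => Ex Ey; rewrite phiM Ex Ey -vec_embM.
have KV x : K x -> K x^-1.
  rewrite /K /= => Ex; rewrite phiV Ex.
  have -> : (vec_emb (phi x).1.1)^-1 = vec_emb ((phi x).1.1)^-1.
    apply/mulg1_eq; rewrite -vec_embM mulgV; exact: esym.
  by [].
move=> Dg; apply: (Dg K); split=> // _ [x [y [_ _ ->]]]; rewrite /K /= phi_commutator.
apply: invariant_eq; last first.
  change ([~ (phi x).2, (phi y).2] = 1); apply/eqP/commgP; exact: addrC.
rewrite [LHS]surjective_pairing; congr pair.
change ([~ (phi x).1.2, (phi y).1.2] = 1); apply/eqP/commgP; exact: addrC.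
Qed.

Lemma derived2_trivial g : derived G 2 g -> phi g = 1.
Proof.
move=> Dg; apply: (Dg [set g | phi g = 1]); split=> [//|x y|x|_ [x [y [Dx Dy ->]]]] /=.
- by rewrite phiM => -> ->; rewrite mulg1.
- by rewrite phiV => ->; rewrite invg1.
rewrite phi_commutator; apply/eqP/commgP.
rewrite (derived1_trivial Dx) (derived1_trivial Dy) /commute -!vec_embM; congr vec_emb.
exact: addrC.
Qed.

Lemma phi_kernel g : phi g = 1 -> derived G 2 g.
Proof.
move=> E; apply/coset1P; rewrite -psi_phi E.
by apply: (@mulgI _ (psi 1)); rewrite -psiM !mulg1.
Qed.

Definition merge_coords (x : freeZ 1) (y : freeZ N) : freeZ N.+1 :=
  row_mx (x : 'rV[int]_1) (y : 'rV[int]_N).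

Lemma merge_coordsM x x' y y' :
  merge_coords (x * x') (y * y') = merge_coords x y * merge_coords x' y'.
Proof. exact: (esym (@add_row_mx _ _ _ _ (x : 'rV[int]_1) (y : 'rV[int]_N) x' y')). Qed.

Lemma merge_coords0 x y : merge_coords x y = 1 -> x = 1 /\ y = 1.
Proof.
move=> E; apply: (@eq_row_mx _ _ _ _ (x : 'rV[int]_1) (y : 'rV[int]_N) 0%R 0%R).
by rewrite row_mx0; exact: E.
Qed.

(** Regroups (Z^2 x| Z) x Z^N as Z^2 x| Z^(N+1), with sigma as coordinate 0. *)
Definition merge (t : invariant_group N) : semidirect (@hex_act N.+1 ord0) :=
  (t.1.1, merge_coords t.1.2 t.2).

Lemma mergeM : {morph merge : x y / x * y}.
Proof.
move=> [[w x] y] [[w' x'] y']; congr pair; last exact: merge_coordsM.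
change (w * @hex_act 1 ord0 x w' = w * @hex_act N.+1 ord0 (merge_coords x y) w').
congr (_ * _); rewrite !hex_actE; congr (_ *m hex ^ _)%R.
have -> : ord0 = lshift N (ord0 : 'I_1) :> 'I_(1 + N) by exact: val_inj.
exact/esym/row_mxEl.
Qed.

Lemma merge_surjective t : exists u, merge u = t.
Proof.
case: t => w z; exists ((w, lsubmx (z : 'rV[int]_(1 + N))), rsubmx (z : 'rV[int]_(1 + N))).
exact: (congr1 (pair w) (@hsubmxK _ _ _ _ (z : 'rV[int]_(1 + N)))).
Qed.

Lemma merge_kernel t : merge t = 1 -> t = 1.
Proof.
case: t => [[w x] y] E.
have [/= -> ->] := merge_coords0 (congr1 snd E).
by have -> : w = 1 by exact: (congr1 fst E).
Qed.

Let f0 y := merge (phi y).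
Let g0 (y : subgroup_group (derived G 1)) : freeZ 2 := (phi (subgroup_val y)).1.1.
Let h0 y : freeZ N.+1 := (f0 y).2.

Let f0M : {morph f0 : x y / x * y}. Proof. by move=> x y; rewrite /f0 phiM mergeM. Qed.
Let h0M : {morph h0 : x y / x * y}. Proof. by move=> x y; rewrite /h0 f0M. Qed.

Let derived1_val (y : subgroup_group (derived G 1)) : derived G 1 (subgroup_val y).
Proof. exact: (set_mem (valP y)). Qed.

Let g0M : {morph g0 : x y / x * y}.
Proof.
move=> x y; rewrite /g0 -[subgroup_val (x * y)]/(subgroup_val x * subgroup_val y) phiM.
by rewrite (derived1_trivial (derived1_val x)) (derived1_trivial (derived1_val y)) -vec_embM.
Qed.

Let f0_derived2 y : derived G 2 y -> f0 y = 1.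
Proof.
move=> /derived2_trivial E; rewrite /f0 E.
by apply: (@mulgI _ (merge 1)); rewrite -mergeM !mulg1.
Qed.

Let g0_derived2 y : restr (derived G 1) (derived G 2) y -> g0 y = 1.
Proof. by move=> Dy; rewrite /g0 derived2_trivial. Qed.

Let h0_derived1 y : lower_central G 2 y -> h0 y = 1.
Proof.
by move=> Dy; rewrite /h0 /f0 (derived1_trivial Dy); exact: (@row_mx0 _ 1 1 N).
Qed.

Theorem four_strand_quotients :
  [/\ isomorphic Q (semidirect (@hex_act 1 ord0) * freeZ N)%type,
      isomorphic (quotient_group (restr (derived G 1) (derived G 2))) (freeZ 2)
    & exists (f : {multiplicative Q -> semidirect (@hex_act N.+1 ord0)})
             (g : {multiplicative
                     quotient_group (restr (derived G 1) (derived G 2)) -> freeZ 2})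
             (h : {multiplicative quotient_group (lower_central G 2) -> freeZ N.+1}),
        [/\ bijective f, bijective g, bijective h,
            forall y : subgroup_group (derived G 1),
              f (coset (derived G 2) (subgroup_val y)) =
              (g (coset (restr (derived G 1) (derived G 2)) y), 1)
          & forall y : G,
              (f (coset (derived G 2) y)).2 = h (coset (lower_central G 2) y)]].
Proof.
have bf : bijective (quotient_map f0M f0_derived2).
  apply: quotient_map_bijective => [x /merge_kernel|t]; first exact: phi_kernel.
  have [t' <-] := merge_surjective t; have [y <-] := phi_surjective t'.
  by exists y.
have bg : bijective (quotient_map g0M g0_derived2).
  apply: quotient_map_bijective => [x E|w].
    by apply: phi_kernel; rewrite (derived1_trivial (derived1_val x)) -/(g0 x) E.
  have [y Dy Ey] := derived1_phi w.
  by exists (exist _ y (mem_set Dy)); rewrite /g0 -[subgroup_val _]/y Ey.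
have bh : bijective (quotient_map h0M h0_derived1).
  apply: quotient_map_bijective => [x /merge_coords0[E1 E2]|z].
    (* x and d have the same image, so [d^-1 * x] lies in the second derived subgroup and x in the
       first. *)
    have [d Dd Ed] := derived1_phi (phi x).1.1.
    rewrite -(mulKVg d x); apply: (@sgrpM _ (lower_central G 2)) => //.
    apply: derived2_sub; apply: phi_kernel; rewrite phiM phiV Ed.
    have {2}-> : phi x = vec_emb (phi x).1.1.
      apply: invariant_eq => //; rewrite [LHS]surjective_pairing; congr pair; exact: E1.
    by rewrite mulVg.
  have [t' Et] := merge_surjective (1, z); have [y Ey] := phi_surjective t'.
  by exists y; rewrite /h0 /f0 Ey Et.
split; last 1 first.
- exists (quotient_map f0M f0_derived2), (quotient_map g0M g0_derived2), (quotient_map h0M h0_derived1).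
  split=> // y.
    rewrite [LHS](quotient_lift_coset f0M f0_derived2).
    rewrite [X in (X, 1)](quotient_lift_coset g0M g0_derived2) /f0 /g0.
    rewrite (derived1_trivial (derived1_val y)); congr pair; exact: (@row_mx0 _ 1 1 N).
  rewrite [X in X.2](quotient_lift_coset f0M f0_derived2).
  by rewrite [RHS](quotient_lift_coset h0M h0_derived1).
- exists (quotient_map phiM derived2_trivial); apply: quotient_map_bijective.
    exact: phi_kernel.
  exact: phi_surjective.
- by exists (quotient_map g0M g0_derived2).
Qed.

End FourStrands.

(** * Conclusion *)

Local Open Scope classical_set_scope.
Local Open Scope ring_scope.

Section PlaneBraids.
Variables (R : realType) (m N : nat) (P : 'I_N -> R * R).
Local Notation V := ('I_m -> R * R).
Hypothesis P_height : forall k, -1 < (P k).2 < 1.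
Variables (x0 x1 gap : R).
Hypothesis gap_gt0 : 0 < gap.
Hypothesis x0_left : forall k, x0 + m%:R + gap *+ 4 < (P k).1.
Hypothesis x1_right : forall k, (P k).1 + gap *+ 4 < x1.
Hypothesis P_gap : forall k l : 'I_N, k != l ->
  (P k).1 + gap *+ 4 < (P l).1 \/ (P l).1 + gap *+ 4 < (P k).1.

Variables (X : topologicalType) (toX : V -> X).
Hypothesis toX_continuous : forall (T : topologicalType) (A : set T) (y : T -> V),
  (forall i, {within A, continuous (fun t => y t i)}) ->
  (forall t, A t -> in_conf P (y t)) -> {within A, continuous (fun t => toX (y t))}.
Hypothesis toX_surj : forall x, exists2 y, in_conf P y & toX y = x.
Hypothesis toX_relabel : forall s y, toX (relabel s y) = toX y.
Hypothesis toX_inj : forall y y', in_conf P y -> in_conf P y' ->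
  toX y = toX y' -> exists s, y' = relabel s y.
Hypothesis toX_open : forall y r, in_conf P y -> 0 < r ->
  nbhs (toX y) (toX @` box y r).
Variables (b : X) (delta : forall x, path R b x).
Local Notation e := (edge toX_continuous delta).

Lemma plane_braid_relations :
  braid_relations m (sig x0 e) (fun i k => rho P x0 x1 gap e i k).
Proof.
have eR : forall s u v, e (relabel s u) (relabel s v) = e u v.
  by move=> s u v; exact: edge_relabel.
have eC : forall A, coherent P A -> forall u v w, A u -> A v -> A w ->
    (e u v * e v w)%g = e u w.
  by move=> A cA u v w; exact: edge_coherent.
split.
- move=> p q pq qm.
  have p1 : (p.+1 < m)%N by lia.
  exact: (sig_far P_height gap_gt0 x0_left eR eC
    (p := Ordinal (ltnW p1)) (q := Ordinal p1) (p' := Ordinal (ltnW qm)) (q' := Ordinal qm)).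
- move=> p pm; have p1 : (p.+1 < m)%N by lia.
  exact: (sig_braid P_height gap_gt0 x0_left eR eC
    (p := Ordinal (ltnW p1)) (q := Ordinal p1) (r := Ordinal pm)).
- move=> i k im.
  exact: (rho_sig P_height gap_gt0 x0_left x1_right P_gap eR eC
    (i := Ordinal (ltnW im)) (j := Ordinal im)).
(* The puncture further left is paired with the first strand. *)
- move=> i k l im kl; have h := P_gap kl.
  have rr := rho_rho P_height gap_gt0 x0_left x1_right P_gap eR eC
    (i := Ordinal (ltnW im)) (j := Ordinal im).
  case: h => h; [left|right]; apply: rr => //; have := gap_gt0; lra.
- move=> i p k im pm pi p1i.
  exact: (rho_sig_far P_height gap_gt0 x0_left x1_right P_gap eR eC
    (i := Ordinal im) (p := Ordinal (ltnW pm)) (q := Ordinal pm)).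
- move=> H H1 HM HV Hs Hr g.
  apply: (sig_rho_generate P_height gap_gt0 x0_left x1_right P_gap toX_surj toX_relabel
    toX_inj toX_open H1 HM HV Hs).
  by move=> i k; apply: Hr.
Qed.

End PlaneBraids.

Local Open Scope group_scope.

Theorem theorem9 (R : realType) (n : nat) (hn : (2 <= n)%N)
    (x : 'I_n -> sphere2 R) (hx : injective x)
    (m : nat) (b : unordered_config (punctured_sphere x) m) :
  let B : groupType := braid_group R b in
  [/\ (3 <= m)%N -> lower_central B 3 = lower_central B 2,
      (5 <= m)%N -> derived B 2 = derived B 1
    & m = 4%N ->
      [/\ exists act : group_action (freeZ 1) (freeZ 2),
            [/\ act (freeZ_basis ord0) ubar = vbar,
                act (freeZ_basis ord0) vbar = ubar^-1 * vbar
              & isomorphic (quotient_group (derived B 2))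
                           (semidirect act * freeZ n.-1)%type],
          isomorphic (quotient_group (restr (derived B 1) (derived B 2)))
                     (freeZ 2)
        & exists act : group_action (freeZ n) (freeZ 2),
            [/\ forall i : 'I_n, val i = 0%N ->
                  act (freeZ_basis i) ubar = vbar /\
                  act (freeZ_basis i) vbar = ubar^-1 * vbar,
                forall i : 'I_n, (0 < val i)%N ->
                  act (freeZ_basis i) ubar = ubar /\
                  act (freeZ_basis i) vbar = vbar
              & exists (f : {multiplicative quotient_group (derived B 2) ->
                               semidirect act})
                       (g : {multiplicative
                               quotient_group (restr (derived B 1) (derived B 2)) ->
                               freeZ 2})
                       (h : {multiplicative quotient_group (lower_central B 2) ->
                               freeZ n}),
                  [/\ bijective f, bijective g, bijective h,
                      forall y : subgroup_group (derived B 1),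
                        f (coset (derived B 2) (subgroup_val y)) =
                        (g (coset (restr (derived B 1) (derived B 2)) y), 1)
                    & forall y : B,
                        (f (coset (derived B 2) y)).2 =
                        h (coset (lower_central B 2) y)]]]].
Proof.
(* n = N + 1: the first puncture is the centre of projection, the other N stay in the plane. *)
case: n hn x hx b => [//|N] hn x hx b B.
pose z (i : 'I_N) := stereo (\val (x ord0)) (\val (x (lift ord0 i))).
have z_inj : injective z.
  move=> i j E; apply: (@lift_inj _ ord0); apply: (hx); apply: val_inj.
  have K l : unstereo (\val (x ord0)) (z l) = \val (x (lift ord0 l)).
    apply: stereoK; [by rewrite -sum3; exact: sphere_unit|exact: sphere_unit|].
    by move=> /val_inj/hx/eqP; rewrite eq_sym (negPf (neq_lift _ _)).
  by rewrite -[LHS]K -[RHS]K E.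
have [s [k [x0 [x1 [gap [k0 g0 x01 hP [x0l x1r hgap]]]]]]] := general_position m z_inj.
pose P := puncture x s k.
have {}hP : forall i, (-1 < (P i).2 < 1)%R := hP.
have {}x0l : forall i, (x0 + m%:R + gap *+ 4 < (P i).1)%R := x0l.
have {}x1r : forall i, ((P i).1 + gap *+ 4 < x1)%R := x1r.
have {}hgap : forall i j, i != j ->
  ((P i).1 + gap *+ 4 < (P j).1)%R \/ ((P j).1 + gap *+ 4 < (P i).1)%R := hgap.
pose b0 : config (punctured_sphere x) m := generic_quotient.repr b.
have toXc := @toX_continuous R N m x b0 s k k0.
have toXs := toX_surj hx b0 s k0.
have toXr := toX_relabel b0 s k0.
have toXi := @toX_inj R N m x b0 s k k0.
have toXo := @toX_open R N m x hx b0 s k k0.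
have [delta _] := exists_paths hP x0 toXc toXs toXr b.
have rels := plane_braid_relations hP g0 x0l x1r hgap toXc toXs toXr toXi toXo delta.
split; [exact: lower_central_stable rels|exact: derived_stable rels|move=> m4].
subst m.
(* The invariant takes the wanted values up to conjugation by the transport to the standard
   configuration; phi undoes this conjugation. *)
pose kappa := transport toXs toXi toXo delta (standard x0).
pose phi (g : B) : invariant_group N :=
  kappa^-1 * invariant toXs toXi toXo g * kappa.
have phiM : {morph phi : g h / g * h}.
  by move=> g h; rewrite /phi invariantM !mulgA mulgK.
have [|i k' i4|Q1 Q2 Q3] := @four_strand_quotients B N _ _ rels phi phiM.
- move=> p p3; rewrite /phi.
  rewrite (invariant_sig toXc toXs toXr toXi toXo delta hP x01 g0 x0l p3).
  by rewrite !mulgA mulVg mul1g mulgKV.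
- rewrite /phi.
  rewrite (invariant_rho toXc toXs toXr toXi toXo delta hP x01 g0 x0l x1r hgap (Ordinal i4)).
  by rewrite !mulgA mulVg mul1g mulgKV.
split=> //.
- exists (@hex_act 1 ord0); split; [exact: hex_act_ubar|exact: hex_act_vbar|exact: Q1].
- exists (@hex_act N.+1 ord0); split=> [i i0|i i0|//].
    have -> : i = ord0 by exact: val_inj.
    by split; [exact: hex_act_ubar|exact: hex_act_vbar].
  have ne : i != ord0 by rewrite -val_eqE -lt0n.
  by split; exact: hex_act_other.
Qed.
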